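(* Let $\Omega \subset \mathbb{R}^2$ be a nonempty, compact, regular closed and rotationally invariant set with a finite number of connected components. For $R>0$ let $R\Omega = \{z \in \mathbb{R}^2 : z/R \in \Omega\}$ and let $\lambda_k^{R\Omega}$, $k=1,2,\dots$, be the $k$-th eigenvalue of the localization operator $A_{R\Omega}^{g_0}$. Then $$\left| \lambda_k^{R\Omega} - \frac{1}{2}\operatorname{erfc}\left( \sqrt{2\pi}\,\frac{k-R^2|\Omega|}{R|\partial \Omega|} \right) \right| = O\left( \frac{1}{R} \right) \quad \text{as } R\to\infty,$$ uniformly in $k$; that is, there exist constants $C, R_0>0$ depending only on $\Omega$ such that for all $R \ge R_0$ and all integers $k\ge 1$ the left-hand side is at most $C/R$.
   Context: For $(x,\omega)\in\mathbb{R}^2$ and $f \in L^2(\mathbb{R})$, the time-frequency shift is $\pi(x,\omega)f(t) = e^{2\pi i \omega t} f(t-x)$. The short-time Fourier transform with window $g \in L^2(\mathbb{R})$ is $V_g f(x,\omega) = \langle f, \pi(x,\omega) g\rangle = \int_{\mathbb{R}} f(t)\overline{g(t-x)}e^{-2\pi i \omega t}\,dt$. For a bounded measurable set $\Omega\subset\mathbb{R}^2$, the localization operator $A_\Omega^g : L^2(\mathbb{R})\to L^2(\mathbb{R})$ is $$A_\Omega^g f = \int_\Omega V_g f(x,\omega)\,\pi(x,\omega) g \,dx\,d\omega$$ (understood weakly); it is a compact, positive, self-adjoint operator. The window is the standard Gaussian $g_0(t) = 2^{1/4}e^{-\pi t^2}$. Eigenvalues are listed in non-increasing order, counted with multiplicity.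 A set $\Omega$ is regular closed if $\Omega = \overline{\operatorname{int}(\Omega)}$. It is rotationally invariant if $\Omega = \{z\in\mathbb{R}^2 : |z|\in S\}$ for some $S\subset[0,\infty)$. $|\Omega|$ denotes the area (Lebesgue measure) of $\Omega$ and $|\partial\Omega|$ the length (1-dimensional Hausdorff measure) of its boundary. $\operatorname{erfc}(x) = \frac{2}{\sqrt{\pi}}\int_x^\infty e^{-s^2}\,ds$. *)

(* Defs.v *)
From HB Require Import structures.
From mathcomp Require Import all_boot all_order all_algebra.
From mathcomp.real_closed Require Import complex.
From mathcomp Require Import all_classical all_reals all_analysis.
Import Order.TTheory GRing.Theory Num.Theory.
Import numFieldNormedType.Exports.

Set Implicit Arguments.
Unset Strict Implicit.
Unset Printing Implicit Defensive.

Local Open Scope classical_set_scope.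
Local Open Scope ring_scope.

Local Notation mu1 := (@lebesgue_measure _).
Local Notation mu2 := (@lebesgue_measure _ \x @lebesgue_measure _)%E.

(* Complex-valued functions are integrated through their real and imaginary
   parts; outside the integrable functions the value is irrelevant. *)
Definition cintegral (R : realType) (d : measure_display) (T : measurableType d)
    (mu : {measure set T -> \bar R}) (D : set T) (f : T -> R[i]) : R[i] :=
  Complex (Rintegral mu D (fun t => complex.Re (f t)))
          (Rintegral mu D (fun t => complex.Im (f t))).

(* Square-integrable representatives. Elements of L^2 are these up to equality
   almost everywhere. *)
Definition L2 (R : realType) : set (R -> R[i]) :=
  [set f : R -> R[i] | [/\ measurable_fun [set: measurableTypeR R]
                 (fun t => complex.Re (f t) : measurableTypeR R),
               measurable_fun [set: measurableTypeR R]
                 (fun t => complex.Im (f t) : measurableTypeR R) &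
               (\int[mu1]_t ((ComplexField.Normc.normc (f t)) ^+ 2)%:E < +oo)%E ] ].

Definition inner (R : realType) (f h : R -> R[i]) : R[i] :=
  cintegral mu1 setT (fun t => f t * conjc (h t)).

Definition cis (R : realType) (theta : R) : R[i] :=
  Complex (cos theta) (sin theta).

Definition tfshift (R : realType) (z : R * R) (f : R -> R[i]) : R -> R[i] :=
  fun t => cis (2 * pi * z.2 * t) * f (t - z.1).

Definition stft (R : realType) (g f : R -> R[i]) (z : R * R) : R[i] :=
  inner f (tfshift z g).

Definition gauss_window (R : realType) (t : R) : R[i] :=
  real_complex R (2 `^ (4^-1) * expR (- (pi * t ^+ 2))).

(* The graph of the localization operator: [u] represents the weak integral
   of [stft g f z *: tfshift z g] over [z] in [Omega]. It determines [u] up to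
   equality almost everywhere. *)
Definition loc_op (R : realType) (g : R -> R[i]) (Omega : set (R * R))
    (f u : R -> R[i]) : Prop :=
  [/\ L2 f, L2 u &
      forall h, L2 h ->
        inner u h =
        cintegral mu2 Omega (fun z => stft g f z * inner (tfshift z g) h)].

(* Operators on L^2 are represented by their graphs on representatives. *)
Definition eigenspace_of (R : realType) (A : (R -> R[i]) -> (R -> R[i]) -> Prop)
    (m : R) : set (R -> R[i]) :=
  [set f | A f (fun t => real_complex R m * f t)].

Definition has_dim (R : realType) (E : set (R -> R[i])) (n : nat) : Prop :=
  exists F : 'I_n -> R -> R[i],
    [/\ forall i, E (F i),
        forall c : 'I_n -> R[i],
          {ae @lebesgue_measure R, forall t, \sum_(i < n) c i * F i t = 0} ->
          forall i, c i = 0 &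
        forall f, E f -> exists c : 'I_n -> R[i],
          {ae @lebesgue_measure R, forall t, f t = \sum_(i < n) c i * F i t}].

(* The listing of the eigenvalues of a compact, positive, self-adjoint operator:
   each positive real occurs exactly as often as the dimension of its
   eigenspace (zero times if it is not an eigenvalue). If there are only
   finitely many positive eigenvalues, the listing is continued by 0. *)
Definition eigenvalue_listing (R : realType)
    (A : (R -> R[i]) -> (R -> R[i]) -> Prop) (lam : nat -> R) : Prop :=
  [/\ forall i j, (i <= j)%N -> lam j <= lam i,
      forall i, 0 <= lam i &
      forall m : R, 0 < m -> exists n : nat,
        has_dim (eigenspace_of A m) n /\ ([set i | lam i = m] #= `I_n)%card].

(* Here [k] counts from 1, while the listing starts at index 0. *)
Definition kth_eigenvalue (R : realType)
    (A : (R -> R[i]) -> (R -> R[i]) -> Prop) (k : nat) : R :=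
  xget (fun=> 0) [set lam | eigenvalue_listing A lam] k.-1.

(* The norm of the library on [R * R] is the maximum norm. *)
Definition enorm (R : realType) (z : R * R) : R :=
  Num.sqrt (z.1 ^+ 2 + z.2 ^+ 2).

Definition rotation_invariant (R : realType) (Omega : set (R * R)) : Prop :=
  exists2 S : set R, S `<=` [set s | 0 <= s] & Omega = [set z | S (enorm z)].

Definition dilate (R : realType) (r : R) (Omega : set (R * R)) : set (R * R) :=
  [set z | Omega (z.1 / r, z.2 / r)].

(* The point [0] is added so that the empty set has diameter 0, not [-oo]. *)
Definition diam (R : realType) (U : set (R * R)) : \bar R :=
  ereal_sup (0%E |` [set d | exists z w, [/\ U z, U w & d = (enorm (z - w))%:E]]).

Definition hausdorff1_pre (R : realType) (delta : R) (A : set (R * R)) : \bar R :=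
  ereal_inf [set (\sum_(0 <= i <oo) diam (U i))%E |
    U in [set U : nat -> set (R * R) |
           A `<=` \bigcup_i U i /\ forall i, (diam (U i) <= delta%:E)%E]].

Definition hausdorff1 (R : realType) (A : set (R * R)) : \bar R :=
  ereal_sup [set hausdorff1_pre delta A | delta in [set delta : R | 0 < delta]].

Definition area (R : realType) (Omega : set (R * R)) : R := fine (mu2 Omega).

Definition perimeter (R : realType) (Omega : set (R * R)) : R :=
  fine (hausdorff1 (closure Omega `\` interior Omega)).

Definition erfc (R : realType) (x : R) : R :=
  2 / Num.sqrt pi * Rintegral mu1 `[x, +oo[ (fun s => expR (- s ^+ 2)).

(* Main.v *)
(* The Gaussian window gives pi(z) g_0 = u(z) e^(-pi |z|^2 / 2) sum_k z^k phi_k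
   with |u(z)| = 1, where the phi_k are orthogonal Hermite functions with
   |phi_k|^2 = pi^k / k!. On a rotation invariant set the monomials z^j conj(z)^k
   with j <> k integrate to 0, so the localization operator is diagonal in (phi_k),
   and its k-th diagonal entry is the integral of e^(-pi |z|^2) (pi |z|^2)^k / k!.
   Omega being a finite union of annuli { a_i <= pi |z|^2 <= b_i }, the entry for
   r Omega is the sum over i of F_k (r^2 b_i) - F_k (r^2 a_i), with F_k the
   distribution function of the Gamma law of shape k + 1, and a Berry-Esseen bound
   gives F_k (y) = erfc ((k - y) / sqrt (2 y)) / 2 + O (1 / sqrt y) uniformly in k.
   Hence, up to O (1 / r), the entries above erfc (x) / 2 are those whose index lies in
   one of the intervals [r^2 a_i - x r sqrt (2 a_i), r^2 b_i + x r sqrt (2 b_i)]; their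
   total length r^2 |Omega| + x r |bd Omega| / sqrt (2 pi) counts these entries up to a
   bounded error, and solving for x gives the k-th entry in decreasing order. *)
Require Import Defs.
From HB Require Import structures.
From mathcomp Require Import all_boot all_order all_algebra ring lra.
From mathcomp.real_closed Require Import complex.
From mathcomp Require Import all_classical all_reals all_analysis measurable_realfun.
Import Order.TTheory GRing.Theory Num.Theory.
Import numFieldNormedType.Exports.

Set Implicit Arguments.
Unset Strict Implicit.
Unset Printing Implicit Defensive.

Local Open Scope classical_set_scope.
Local Open Scope ring_scope.

(** * Calculus on the real line *)

(** The normal approximation must be uniform in the index, so it is obtained by comparing densities:
    scaled to agree at [y = j], those of the Gamma and Gaussian laws differ on [[j / 2, 2 j]] by a
    multiple of [|y - j| / j ^ (3/2)] times a Gaussian weight, which integrates to O(1 / sqrt j).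
    Outside this range both tails are small, the Gamma one by Chebyshev's inequality for the Poisson
    law. The operator side rests on one estimate: the expansion of pi(z) g_0 in the Hermite
    functions has a remainder O(2 ^- N), uniformly for bounded z. It gives the orthogonality
    relations by comparing power series coefficients, the measurability of the integrand, and
    termwise integration. Eigenspaces for m > 0 are then exact, since the operator annihilates every
    vector orthogonal to all Hermite functions. Several annuli are handled through a common
    separation [delta]: an index can be near one annulus only and, within it, near one end only; all
    other terms are O(1 / r). Finally, the perimeter is a Hausdorff measure, so the length of a
    union of circles has to be found from arbitrary covers. *)

Section calculus.
Context {R : realType}.
Implicit Types (f g df : R -> R) (a b x y : R).

Lemma is_derive_continuous f x d : is_derive x 1 f d -> {for x, continuous f}.
Proof. by move=> fd; apply/differentiable_continuous/derivable1_diffP. Qed.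

Lemma mean_value f df a b : a <= b ->
  (forall x, a <= x <= b -> is_derive x 1 f (df x)) ->
  exists2 c, a <= c <= b & f b - f a = df c * (b - a).
Proof.
move=> ab fd.
have [||c cab E] := @MVT_segment R f df a b ab.
- move=> x; rewrite in_itv/= => /andP[ax xb]; apply: fd.
  by rewrite !ltW.
- apply: continuous_in_subspaceT => x; rewrite inE/= in_itv/= => xab.
  exact: is_derive_continuous (fd _ xab).
- by exists c => //; move: cab; rewrite in_itv.
Qed.

Lemma derive_ge0_homo f df a b : a <= b ->
  (forall x, a <= x <= b -> is_derive x 1 f (df x)) ->
  (forall x, a <= x <= b -> 0 <= df x) -> f a <= f b.
Proof.
move=> ab fd d0; have [c cab E] := mean_value ab fd.
by rewrite -subr_ge0 E mulr_ge0 ?subr_ge0// d0.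
Qed.

Lemma is_derive_ext f g x (d e : R) :
  is_derive x 1 f d -> (forall y, f y = g y) -> d = e -> is_derive x 1 g e.
Proof. by move=> fd fg <-; rewrite (_ : g = f)//; apply/funext. Qed.

Lemma is_derive_add f g x (d e : R) : is_derive x 1 f d -> is_derive x 1 g e ->
  is_derive x 1 (fun y => f y + g y) (d + e).
Proof. exact: is_deriveD. Qed.

Lemma is_derive_sub f g x (d e : R) : is_derive x 1 f d -> is_derive x 1 g e ->
  is_derive x 1 (fun y => f y - g y) (d - e).
Proof. exact: is_deriveB. Qed.

Lemma is_derive_opp f x (d : R) : is_derive x 1 f d ->
  is_derive x 1 (fun y => - f y) (- d).
Proof. exact: is_deriveN. Qed.

Lemma is_derive_mul f g x (d e : R) : is_derive x 1 f d -> is_derive x 1 g e ->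
  is_derive x 1 (fun y => f y * g y) (d * g x + f x * e).
Proof.
move=> fd ge; have := is_deriveM fd ge.
by rewrite addrC (mulrC d).
Qed.

Lemma is_derive_pow f x n (d : R) : is_derive x 1 f d ->
  is_derive x 1 (fun y => f y ^+ n) (n%:R * f x ^+ n.-1 * d).
Proof.
move=> fd; have := is_deriveX n fd.
by move/is_derive_ext; apply => // y; rewrite fctE.
Qed.

Lemma is_derive_compose f g x (d e : R) : is_derive (g x) 1 f e ->
  is_derive x 1 g d -> is_derive x 1 (fun y => f (g y)) (e * d).
Proof. exact: is_derive1_comp. Qed.

Lemma is_derive_exp f x (d : R) : is_derive x 1 f d ->
  is_derive x 1 (fun y => expR (f y)) (expR (f x) * d).
Proof. by move=> fd; apply: is_derive_compose. Qed.

Lemma is_derive_var x : is_derive x 1 (fun y : R => y) (1 : R).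
Proof. exact: is_derive_id. Qed.

Lemma is_derive_const x c : is_derive x 1 (fun _ : R => c) (0 : R).
Proof. exact: is_derive_cst. Qed.

Lemma is_derive_scale f x (k d : R) :
  is_derive x 1 f d -> is_derive x 1 (fun y => k * f y) (k * d).
Proof. exact: is_deriveZ. Qed.

End calculus.

(** * The Gaussian tail *)

Section erfc.
Context {R : realType}.
Implicit Types x y : R.
Local Notation mu := (@lebesgue_measure R).

(** The upper tail at [x] of the normal law of mean 0 and variance 1/2, whose density is
    [exp (- s ^ 2) / sqrt pi]. *)
Definition gtail x : R := 1 / 2 * erfc x.

Let F x := Rintegral mu `]-oo, x] (@gauss_fun R).

(** The fundamental theorem of calculus is applied with a variable upper endpoint, so the tail is
    first rewritten as one minus a lower integral. *)
Lemma gtailE x : gtail x = 1 - (Num.sqrt pi)^-1 * F x.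
Proof.
have s0 : Num.sqrt pi != 0 :> R by rewrite gt_eqF// sqrtr_gt0 pi_gt0.
have iT : mu.-integrable [set` Interval -oo%O +oo%O] (EFin \o @gauss_fun R).
  by rewrite set_itvNyy; exact: integrableT_gauss.
have := Rintegral_itvB iT (erefl : (-oo%O <= BRight x)%O) (erefl : (BRight x <= +oo%O)%O).
rewrite Rintegral_itv_obnd_cbnd; last exact: integrableS iT.
rewrite set_itvNyy {1}/Rintegral integralT_gauss/= => E.
rewrite /gtail /erfc -[X in _ * (_ * X) = _]E -/(F x).
by field.
Qed.

Lemma is_derive_gtail x : is_derive x 1 gtail (- (Num.sqrt pi)^-1 * expR (- x ^+ 2)).
Proof.
have iT : mu.-integrable [set` Interval -oo%O (BRight (x + 1))] (EFin \o @gauss_fun R).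
  apply: integrableS integrableT_gauss => //.
have [|||dF DF] := @continuous_FTC1 R (@gauss_fun R) -oo%O x (x + 1) _ iT.
- by rewrite ltrDl.
- by rewrite ltNye_eq.
- exact: continuous_gauss_fun.
rewrite (_ : gtail = fun x => 1 - (Num.sqrt pi)^-1 * F x); last first.
  by apply/funext => z; rewrite gtailE.
have dF' : is_derive x 1 F (gauss_fun x).
  by rewrite -DF derive1E; exact: derivableP.
have := is_deriveB (is_derive_cst (1:R) x 1) (is_derive_scale (Num.sqrt pi)^-1 dF').
by rewrite sub0r mulNr.
Qed.

Lemma gtail_le x y : x <= y -> gtail y <= gtail x.
Proof.
move=> xy; rewrite -lerN2.
apply: (@derive_ge0_homo R (fun z => - gtail z) (fun z => (Num.sqrt pi)^-1 * expR (- z ^+ 2)) x y xy) => z _.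
  have := is_deriveN (is_derive_gtail z).
  by rewrite mulNr opprK.
by rewrite mulr_ge0 ?expR_ge0// invr_ge0 sqrtr_ge0.
Qed.

Lemma gtail0 : gtail 0 = 1 / 2.
Proof.
have s0 : Num.sqrt pi != 0 :> R by rewrite gt_eqF// sqrtr_gt0 pi_gt0.
rewrite /gtail /erfc /Rintegral.
have := @integral0y_gauss R; rewrite /gauss_fun => ->/=.
by field.
Qed.

(** The sum of the tails at [x] and [- x] has derivative 0, hence keeps its value at 0. *)
Lemma gtailN x : gtail (- x) = 1 - gtail x.
Proof.
pose f z : R := gtail z + gtail (- z).
have df (z : R) : is_derive z (1 : R) f 0.
  have dN : is_derive z 1 (fun z : R => - z) (-1).
    exact: is_deriveNid.
  have /= d1 := @is_derive1_comp R gtail (fun z : R => - z) z _ _ (is_derive_gtail _) dN.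
  have := is_deriveD (is_derive_gtail z) d1.
  by rewrite sqrrN mulrN1 subrr.
have /(congr1 (fun z => z - gtail x)) : f x = f 0.
  have h a b : a <= b -> f b = f a.
    move=> ab; apply/subr0_eq.
    by have [c _ ->] := @mean_value R f (fun=> 0) a b ab (fun z _ => df z); rewrite mul0r.
  by case/orP: (le_total 0 x) => /h.
rewrite /f oppr0 gtail0 addrAC subrr add0r => ->.
by rewrite -splitr.
Qed.

Lemma gtail_ge0 x : 0 <= gtail x.
Proof.
rewrite /gtail /erfc !mulr_ge0 ?invr_ge0 ?sqrtr_ge0//.
by apply: Rintegral_ge0 => s _; exact: expR_ge0.
Qed.

Lemma gtail_le1 x : gtail x <= 1.
Proof. by rewrite -subr_ge0 -gtailN gtail_ge0. Qed.

Lemma sqrt_pi_ge1 : 1 <= Num.sqrt pi :> R.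
Proof. by rewrite -{1}sqrtr1 ler_sqrt ?pi_gt0// (le_trans _ (pi_ge2 R))// ler1n. Qed.

(** The density is at most [1 / sqrt pi], which is at most 1. This later turns a bounded miscount of
    eigenvalues into an error O(1 / r). *)
Lemma gtail_lipschitz x y : x <= y -> gtail x - gtail y <= y - x.
Proof.
move=> xy; rewrite -opprB.
have [c _ ->] := mean_value xy (fun z _ => is_derive_gtail z).
rewrite mulNr mulNr opprK ler_piMl ?subr_ge0// mulr_ile1 ?expR_ge0 ?invr_ge0 ?sqrtr_ge0//.
  by rewrite invf_le1 ?sqrt_pi_ge1// (lt_le_trans _ sqrt_pi_ge1).
by rewrite -expR0 ler_expR lerNl oppr0 sqr_ge0.
Qed.

(** On [[x, +oo[] the integrand grows when multiplied by [z / x], and [z * exp (- z ^ 2)] has an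
    explicit primitive. Decay like [1 / x] is enough for errors of order [1 / r]. *)
Lemma gtail_le_inv x : 0 < x -> gtail x <= x^-1.
Proof.
move=> x0.
have sp := sqrt_pi_ge1.
have E : (\int[mu]_(z in `[x, +oo[) (z * expR (- z ^+ 2))%:E = (0 : R)%:E - (- (1 / 2) * expR (- x ^+ 2))%:E)%E.
  have dF (z : R) : is_derive z (1 : R) (fun z : R => - (1 / 2) * expR (- z ^+ 2)) (z * expR (- z ^+ 2)).
    have d2 : is_derive z 1 (fun z : R => - z ^+ 2) (- (2 * z)).
      apply: (is_derive_ext (is_derive_opp (is_derive_pow 2 (is_derive_var z)))) => //=.
      by rewrite expr1 mulr1.
    by apply: (is_derive_ext (is_derive_scale (- (1 / 2)) (is_derive_exp d2))) => //; field.
  apply: (@ge0_continuous_FTC2y R _ (fun z : R => - (1 / 2) * expR (- z ^+ 2))).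
  - by move=> z xz; rewrite mulr_ge0 ?expR_ge0// (le_trans (ltW x0)).
  - apply: continuous_subspaceT => z; apply: cvgM; first exact: cvg_id.
    exact: continuous_gauss_fun.
  - rewrite -(mulr0 (- (1 / 2))); apply: cvgM; first exact: cvg_cst.
    exact: cvg_gauss_fun.
  - by move=> z _; have [] := dF z.
  - apply: cvg_at_right_filter; exact: is_derive_continuous (dF x).
  - by move=> z _; rewrite derive1E; have [] := dF z.
have H : (\int[mu]_(z in `[x, +oo[) (gauss_fun z)%:E <= \int[mu]_(z in `[x, +oo[) (x^-1%:E * (z * expR (- z ^+ 2))%:E))%E.
  apply: ge0_le_integral => //=.
  - by move=> z _; rewrite lee_fin gauss_fun_ge0.
  - by apply/measurable_EFinP/measurable_funTS; exact: measurable_gauss_fun.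
  - apply/measurable_funeM/measurable_EFinP/measurable_funTS/measurable_funM => //.
    exact: measurable_gauss_fun.
  - move=> z; rewrite in_itv/= andbT => xz; rewrite -EFinM lee_fin /gauss_fun mulrA ler_peMl ?expR_ge0//.
    by rewrite mulrC ler_pdivlMr// mul1r.
move: H; rewrite ge0_integralZl//; last 3 first.
  - apply/measurable_EFinP/measurable_funTS/measurable_funM => //.
    exact: measurable_gauss_fun.
  - move=> z; rewrite /= in_itv/= andbT => xz; rewrite lee_fin mulr_ge0 ?expR_ge0// (le_trans (ltW x0))//.
  - by rewrite lee_fin invr_ge0 ltW.
rewrite E -EFinB -EFinM => H.
have G0 : (0 <= \int[mu]_(z in `[x, +oo[) (gauss_fun z)%:E)%E.
  by apply: integral_ge0 => z _; rewrite lee_fin gauss_fun_ge0.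
have H2 : Rintegral mu `[x, +oo[ (@gauss_fun R) <= x^-1 * (0 - - (1 / 2) * expR (- x ^+ 2)).
  rewrite -lee_fin /Rintegral fineK// ge0_fin_numE//.
  by rewrite (le_lt_trans H)// ltry.
have E1 : expR (- x ^+ 2) <= 1 by rewrite -expR0 ler_expR lerNl oppr0 sqr_ge0.
have xi : 0 < x^-1 by rewrite invr_gt0.
have H3 : Rintegral mu `[x, +oo[ (@gauss_fun R) <= x^-1.
  apply: le_trans H2 _; rewrite ler_piMr ?(ltW xi)//; lra.
rewrite /gtail /erfc mulrA mulrA (_ : 1 / 2 * 2 = 1) ?mul1r; last by field.
rewrite -[leRHS]mul1r ler_pM ?invr_ge0 ?sqrtr_ge0//.
  by apply: Rintegral_ge0 => z _; exact: gauss_fun_ge0.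
by rewrite invf_le1// (lt_le_trans _ sp).
Qed.

End erfc.

(** * The incomplete gamma function *)

Section gamma.
Context {R : realType}.
Implicit Types (x y : R) (j n : nat).

(** Multiplied by [exp (- y)], this is the probability that a Poisson variable of mean [y] is at
    most [j]. Tail bounds for the Gamma law thus become Chebyshev bounds for the Poisson law. *)
Definition exp_sum j y : R := \sum_(i < j.+1) y ^+ i / i`!%:R.

(* The distribution function of the Gamma law of shape [j + 1]. *)
Definition gamma_cdf j y : R := 1 - expR (- y) * exp_sum j y.

Lemma exp_sumS j y : exp_sum j.+1 y = exp_sum j y + y ^+ j.+1 / j.+1`!%:R.
Proof. by rewrite /exp_sum big_ord_recr. Qed.

Lemma exp_sum0 y : exp_sum 0 y = 1.
Proof. by rewrite /exp_sum big_ord1 expr0 fact0 divr1. Qed.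

Lemma fact_neq0 j : j`!%:R != 0 :> R.
Proof. by rewrite pnatr_eq0 -lt0n fact_gt0. Qed.

Lemma is_derive_exp_sum j y :
  is_derive y 1 (exp_sum j) (exp_sum j y - y ^+ j / j`!%:R).
Proof.
elim: j => [|j IH].
  apply: (is_derive_ext (is_derive_const y 1)) => [z|]; rewrite exp_sum0//.
  by rewrite expr0 fact0 divr1 subrr.
apply: (is_derive_ext (is_derive_add IH (is_derive_scale (j.+1`!%:R)^-1 (is_derive_pow j.+1 (is_derive_var y))))).
  by move=> z; rewrite exp_sumS mulrC.
rewrite exp_sumS addrK mulr1 /= factS natrM.
by field; rewrite fact_neq0/= nat1r pnatr_eq0.
Qed.

Lemma is_derive_gamma_cdf j y :
  is_derive y 1 (gamma_cdf j) (expR (- y) * (y ^+ j / j`!%:R)).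
Proof.
apply: (is_derive_ext (is_derive_sub (is_derive_const y 1)
  (is_derive_mul (is_derive_exp (is_derive_opp (is_derive_var y))) (is_derive_exp_sum j y)))) => //.
by ring.
Qed.

Lemma gamma_cdf0 j : gamma_cdf j 0 = 0.
Proof.
rewrite /gamma_cdf oppr0 expR0 mul1r.
suff -> : exp_sum j 0 = 1 by rewrite subrr.
elim: j => [|j IH]; first exact: exp_sum0.
by rewrite exp_sumS IH expr0n mul0r addr0.
Qed.

Lemma gamma_cdf_homo j x y : 0 <= x -> x <= y -> gamma_cdf j x <= gamma_cdf j y.
Proof.
move=> x0 xy; apply: (derive_ge0_homo xy (fun z _ => is_derive_gamma_cdf j z)) => z /andP[xz _].
by rewrite mulr_ge0 ?expR_ge0// divr_ge0// exprn_ge0// (le_trans x0).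
Qed.

Lemma gamma_cdf_ge0 j y : 0 <= y -> 0 <= gamma_cdf j y.
Proof. by move=> y0; rewrite -(gamma_cdf0 j) gamma_cdf_homo. Qed.

Lemma exp_sum_ge0 j y : 0 <= y -> 0 <= exp_sum j y.
Proof. by move=> y0; apply: sumr_ge0 => i _; rewrite divr_ge0// exprn_ge0. Qed.

Lemma gamma_cdf_le1 j y : 0 <= y -> gamma_cdf j y <= 1.
Proof. by move=> y0; rewrite gerBl mulr_ge0 ?expR_ge0 ?exp_sum_ge0. Qed.

(* The truncated second moment of the Poisson law about its mean. *)
Lemma poisson_variance n y : \sum_(i < n.+1) (i%:R - y) ^+ 2 * (y ^+ i / i`!%:R) =
  y * exp_sum n y + y ^+ n / n`!%:R * y * (y - 1 - n%:R).
Proof.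
elim: n => [|n IH].
  by rewrite big_ord1 exp_sum0 /= !expr0 !fact0 !divr1; ring.
rewrite big_ord_recr IH exp_sumS /= factS natrM (exprS y n) -natr1.
by field; rewrite fact_neq0/= natr1 pnatr_eq0.
Qed.

(** Once [n] reaches [y - 1] the boundary term of [poisson_variance] is nonpositive, and the
    remaining sum is at most [exp y]. *)
Lemma poisson_variance_le n y : 0 <= y -> y - 1 <= n%:R ->
  expR (- y) * \sum_(i < n.+1) (i%:R - y) ^+ 2 * (y ^+ i / i`!%:R) <= y.
Proof.
move=> y0 yn; rewrite poisson_variance.
have := gamma_cdf_ge0 n y0; rewrite /gamma_cdf subr_ge0 => H.
have E := expR_ge0 (- y).
have t0 : 0 <= y ^+ n / n`!%:R * y by rewrite mulr_ge0// divr_ge0// exprn_ge0.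
have h1 : y ^+ n / n`!%:R * y * (y - 1 - n%:R) <= 0.
  by rewrite mulr_ge0_le0// subr_le0.
have h2 := ler_wpM2l y0 H.
have h3 := mulr_ge0_le0 E h1.
by rewrite mulrDr; lra.
Qed.

(** Chebyshev's inequality for the lower Poisson tail: every [i <= j] is at distance at least
    [y - j] from the mean [y]. *)
Lemma gamma_cdfC_le j y : j%:R < y -> 1 - gamma_cdf j y <= y / (y - j%:R) ^+ 2.
Proof.
move=> jy; have y0 : 0 <= y by rewrite (le_trans _ (ltW jy)).
have d0 : 0 < y - j%:R by rewrite subr_gt0.
rewrite ler_pdivlMr ?exprn_gt0// opprB addrC subrK.
(* The truncation lies beyond [j], so that all terms up to [j] are present, and beyond [y - 1], as
   the variance bound requires. *)
set n := (j + Num.truncn y).+1.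
have yn : y - 1 <= n%:R.
  have /andP[_] := Num.Theory.truncn_itv y0; rewrite /n.
  by move=> /ltW h; rewrite (le_trans _ (le_trans h _))// ?ler_nat ?gerBl// ltnS leq_addl.
apply: le_trans (poisson_variance_le y0 yn).
rewrite -mulrA ler_wpM2l ?expR_ge0// mulr_suml.
have jn1 : (j.+1 <= n.+1)%N by rewrite ltnS /n -addnS leq_addr.
rewrite -(big_mkord xpredT (fun i => (i%:R - y) ^+ 2 * (y ^+ i / i`!%:R))).
rewrite (big_cat_nat (leq0n j.+1) jn1) /=.
rewrite big_mkord ler_wpDr//.
  by rewrite sumr_ge0// => i _; rewrite mulr_ge0 ?sqr_ge0// divr_ge0// exprn_ge0.
apply: ler_sum => i _; rewrite mulrC ler_wpM2r// ?divr_ge0// ?exprn_ge0//.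
rewrite -(sqrrN (i%:R - y)) opprB lerXn2r ?nnegrE ?(ltW d0)//.
  by rewrite (le_trans (ltW d0))// lerD2l lerN2 ler_nat -ltnS.
by rewrite lerD2l lerN2 ler_nat -ltnS.
Qed.

Lemma gamma_cdf_cvg0 y : (fun n => gamma_cdf n y) @ \oo --> (0 : R).
Proof.
have h : (fun n => exp_sum n y) @ \oo --> expR y.
  have -> : (fun n => exp_sum n y) = (fun n => series (exp_coeff y) n.+1).
    by apply/funext => n; rewrite /series/= /exp_sum big_mkord.
  rewrite (cvg_shiftS (series (exp_coeff y))).
  exact: is_cvg_series_exp_coeff.
have -> : 0 = 1 - expR (- y) * expR y :> R by rewrite -expRD addNr expR0 subrr.
by apply: cvgB; [exact: cvg_cst|apply: cvgM => //; exact: cvg_cst].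
Qed.

(** Chebyshev's inequality for the upper Poisson tail. It is applied to the finite block from
    [j + 1] to [n], of mass [gamma_cdf j y - gamma_cdf n y], and then [n] tends to infinity. *)
Lemma gamma_cdf_le j y : 0 <= y -> y < j.+1%:R ->
  gamma_cdf j y <= y / (j.+1%:R - y) ^+ 2.
Proof.
move=> y0 jy.
have d0 : 0 < j.+1%:R - y by rewrite subr_gt0.
set b := y / _ ^+ 2.
have cv : (fun n => b + gamma_cdf n y) @ \oo --> b.
  by rewrite -{2}(addr0 b); apply: cvgD; [exact: cvg_cst|exact: gamma_cdf_cvg0].
rewrite -(cvg_lim (@Rhausdorff R) cv).
apply: limr_ge; first by apply/cvg_ex; exists b.
exists (j + Num.truncn y).+1 => // n /= jn.
have yn : y - 1 <= n%:R.
  have /andP[_] := Num.Theory.truncn_itv y0.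
  move=> /ltW h; rewrite (le_trans _ (le_trans h _)) ?gerBl// ler_nat.
  by rewrite (leq_trans _ jn)// ltnS leq_addl.
rewrite -lerBlDr /b ler_pdivlMr ?exprn_gt0//.
apply: le_trans (poisson_variance_le y0 yn).
have -> : gamma_cdf j y - gamma_cdf n y = expR (- y) * (exp_sum n y - exp_sum j y).
  by rewrite /gamma_cdf; ring.
rewrite -mulrA ler_wpM2l ?expR_ge0//.
have jn1 : (j.+1 <= n.+1)%N by rewrite ltnS (leq_trans _ jn)// -addnS leq_addr.
rewrite /exp_sum -(big_mkord xpredT (fun i => y ^+ i / i`!%:R)) -(big_mkord xpredT (fun i => y ^+ i / i`!%:R)).
rewrite -(big_mkord xpredT (fun i => (i%:R - y) ^+ 2 * (y ^+ i / i`!%:R))).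
rewrite !(big_cat_nat (leq0n j.+1) jn1) /= addrAC subrr add0r.
rewrite ler_wpDl//.
  by rewrite sumr_ge0// => i _; rewrite mulr_ge0 ?sqr_ge0// divr_ge0// exprn_ge0.
rewrite mulr_suml.
apply: ler_sum_nat => i /andP[ji _]; rewrite mulrC ler_wpM2r// ?divr_ge0// ?exprn_ge0//.
have h : j.+1%:R - y <= i%:R - y by rewrite lerD2r ler_nat.
by rewrite lerXn2r ?nnegrE ?(ltW d0)// (le_trans (ltW d0)).
Qed.

End gamma.

(** * Normal approximation of the incomplete gamma function *)

Section comparison.
Context {R : realType}.
Implicit Types (x y J : R).

(* Exponents of the gamma density and of the Gaussian density at [y]. *)
Definition gamma_exponent J y : R := y - J - J * (ln y - ln J).
Definition gauss_exponent J y : R := (J - y) ^+ 2 / (2 * y).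

Lemma is_derive_gamma_exponent J y : 0 < y ->
  is_derive y 1 (gamma_exponent J) (1 - J / y).
Proof.
move=> y0; apply: (is_derive_ext (is_derive_sub
   (is_derive_sub (is_derive_var y) (is_derive_const y J))
   (is_derive_scale J (is_derive_sub (is_derive1_ln y0) (is_derive_const y (ln J)))))) => //.
by rewrite !subr0.
Qed.

(* Integrating from the common zero [J] without distinguishing its sides. *)
Lemma mean_value_from (f df : R -> R) a b J y : a <= J <= b -> a <= y <= b ->
  (forall z, a <= z <= b -> is_derive z 1 f (df z)) ->
  exists c, [/\ a <= c <= b, f y - f J = df c * (y - J), 0 <= (c - J) * (y - J) &
                `|c - J| <= `|y - J|].
Proof.
move=> /andP[aJ Jb] /andP[ay yb] fd.
have [Jy|/ltW yJ] := leP J y.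
  have [z /andP[Jz zy]|c /andP[Jc cy] ->] := mean_value Jy (df := df) (f := f).
    by apply: fd; rewrite (le_trans aJ)// (le_trans zy).
  exists c; split => //; first by rewrite (le_trans aJ)// (le_trans cy).
    by rewrite mulr_ge0// subr_ge0.
  by rewrite !ger0_norm ?subr_ge0// lerD2r.
have [z /andP[Jz zy]|c /andP[yc cJ] E] := mean_value yJ (df := df) (f := f).
  by apply: fd; rewrite (le_trans ay)// (le_trans zy).
exists c; split => //; first by rewrite (le_trans ay)// (le_trans cJ).
- by rewrite -opprB E -mulrN opprB.
- by rewrite mulr_le0// subr_le0.
- by rewrite !ler0_norm ?subr_le0// lerN2 lerD2r.
Qed.

Lemma gamma_exponent_self J : gamma_exponent J J = 0.
Proof. by rewrite /gamma_exponent !subrr mulr0 subrr. Qed.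

Lemma gauss_exponent_ge J y : 0 < J -> 0 < y -> y <= 2 * J ->
  (y - J) ^+ 2 / (4 * J) <= gauss_exponent J y.
Proof.
move=> J0 y0 yJ; rewrite /gauss_exponent -(sqrrN (J - y)) opprB ler_wpM2l ?sqr_ge0//.
rewrite lef_pV2 ?posrE ?mulr_gt0//; lra.
Qed.

(** The difference of the two sides has derivative [(z - J) * (z^-1 - (2 * J)^-1)] up to [2 * J],
    which has the sign of [z - J]; so the difference is smallest at [J], where it is 0. *)
Lemma gamma_exponent_ge J y : 0 < J -> J / 2 <= y -> y <= 2 * J ->
  (y - J) ^+ 2 / (4 * J) <= gamma_exponent J y.
Proof.
move=> J0 Jy yJ.
pose f z := gamma_exponent J z - (4 * J)^-1 * (z - J) ^+ 2.
have [|||c [/andP[c1 c2]]] := @mean_value_from f (fun z => (z - J) * (z^-1 - (2 * J)^-1)) (J / 2) (2 * J) J y.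
- by apply/andP; split; lra.
- by rewrite Jy yJ.
- move=> z /andP[z1 _]; have z0 : 0 < z by lra.
  apply: (is_derive_ext (is_derive_sub (is_derive_gamma_exponent J z0)
    (is_derive_scale (4 * J)^-1 (is_derive_pow 2 (is_derive_sub (is_derive_var z) (is_derive_const z J)))))) => //=.
  by rewrite expr1; field; rewrite !gt_eqF.
rewrite /f gamma_exponent_self !subrr expr0n mulr0 subr0 => E h _.
have : 0 <= (c - J) * (c^-1 - (2 * J)^-1) * (y - J).
  rewrite mulrAC mulr_ge0// subr_ge0 lef_pV2 ?posrE//; lra.
by rewrite -E subr0 subr_ge0 mulrC.
Qed.

(** The difference of the exponents vanishes at [J] and has derivative [(z - J) ^ 2 / (2 * z ^ 2)],
    so it is of third order there. *)
Lemma exponent_diff J y : 0 < J -> J / 2 <= y -> y <= 2 * J ->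
  `|gamma_exponent J y - gauss_exponent J y| <= 2 * `|y - J| ^+ 3 / J ^+ 2.
Proof.
move=> J0 Jy yJ.
pose f z := gamma_exponent J z - gauss_exponent J z.
have [|||c [/andP[c1 c2]]] := @mean_value_from f (fun z => (z - J) ^+ 2 / (2 * z ^+ 2)) (J / 2) (2 * J) J y.
- by apply/andP; split; lra.
- by rewrite Jy yJ.
- move=> z /andP[z1 _]; have z0 : 0 < z by lra.
  have dI : is_derive z 1 (fun z : R => (2 * z)^-1) (- (2 * z) ^- 2 * 2).
    have d2 := is_derive_scale 2 (is_derive_var z).
    have /= := is_deriveV _ d2; rewrite mulr1 => /(_ _)/is_derive_ext; apply => //.
    by rewrite gt_eqF// mulr_gt0.
  apply: (is_derive_ext (is_derive_sub (is_derive_gamma_exponent J z0)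
    (is_derive_mul (is_derive_pow 2 (is_derive_sub (is_derive_const z J) (is_derive_var z))) dI))) => //=.
  by rewrite expr1; field; rewrite gt_eqF.
have c0 : 0 < c by lra.
rewrite [f J]/f gamma_exponent_self /gauss_exponent subrr expr0n mul0r !subr0 /f => -> _ h.
rewrite normrM ger0_norm; last by rewrite divr_ge0 ?sqr_ge0// mulr_ge0 ?sqr_ge0.
rewrite (_ : 2 * `|y - J| ^+ 3 / J ^+ 2 = 2 * `|y - J| ^+ 2 / J ^+ 2 * `|y - J|); last by ring.
rewrite ler_wpM2r// -[(c - J) ^+ 2]real_normK ?num_real//.
have h2 : `|c - J| ^+ 2 <= `|y - J| ^+ 2 by rewrite lerXn2r ?nnegrE.
rewrite ler_pdivrMr ?mulr_gt0 ?exprn_gt0// mulrAC ler_pdivlMr ?exprn_gt0//.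
have h3 : J ^+ 2 <= 4 * c ^+ 2 by nra.
have := sqr_ge0 `|c - J|; have := sqr_ge0 J; nra.
Qed.

End comparison.

Section local_comparison.
Context {R : realType}.
Implicit Types (x y J : R) (j : nat).

Lemma dist_expRN_le (m a b : R) : m <= a -> m <= b ->
  `|expR (- a) - expR (- b)| <= `|a - b| * expR (- m).
Proof.
wlog ab : a b / a <= b => [H ma mb|ma mb].
  have [ab|/ltW ba] := leP a b; first exact: H.
  by rewrite distrC (distrC a) H.
rewrite ger0_norm ?subr_ge0 ?ler_expR ?lerN2// ler0_norm ?subr_le0// opprB.
have -> : expR (- b) = expR (- a) * expR (- (b - a)) by rewrite -expRD; congr expR; ring.
rewrite -[X in X - _]mulr1 -mulrBr mulrC.
apply: ler_pM; rewrite ?expR_ge0 ?ler_expR ?lerN2//.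
  by rewrite subr_ge0 -expR0 ler_expR lerNl oppr0 subr_ge0.
have := expR_ge1Dx (- (b - a)); lra.
Qed.

Lemma derive_norm_le (f g df dg : R -> R) a b : a <= b ->
  (forall x, a <= x <= b -> is_derive x 1 f (df x)) ->
  (forall x, a <= x <= b -> is_derive x 1 g (dg x)) ->
  (forall x, a <= x <= b -> `|df x| <= dg x) -> `|f b - f a| <= g b - g a.
Proof.
move=> ab fd gd fg.
have h1 := @derive_ge0_homo R (fun z => g z - f z) (fun z => dg z - df z) a b ab
  (fun z zab => is_derive_sub (gd z zab) (fd z zab)).
have h2 := @derive_ge0_homo R (fun z => g z + f z) (fun z => dg z + df z) a b ab
  (fun z zab => is_derive_add (gd z zab) (fd z zab)).
have {}h1 : g a - f a <= g b - f b.
  by apply: h1 => z /fg; rewrite ler_norml => /andP[_]; rewrite subr_ge0.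
have {}h2 : g a + f a <= g b + f b.
  by apply: h2 => z /fg; rewrite ler_norml => /andP[+ _]; lra.
by rewrite ler_norml; apply/andP; split; lra.
Qed.

(** The width depends on [y] and not on [J]: in the application [y] is a fixed multiple of [r ^ 2]
    while the index [J] is arbitrary. This is what puts the factor [y + J] into the derivative. *)
Definition gauss_cdf J y : R := gtail ((J - y) / Num.sqrt (2 * y)).

Lemma is_derive_gauss_cdf J y : 0 < y -> is_derive y 1 (gauss_cdf J)
  ((Num.sqrt pi)^-1 * expR (- gauss_exponent J y) * ((y + J) / Num.sqrt (2 * y) ^+ 3)).
Proof.
move=> y0; have y20 : 0 < 2 * y by rewrite mulr_gt0.
have q0 : Num.sqrt (2 * y) != 0 by rewrite gt_eqF// sqrtr_gt0.
have q2 : Num.sqrt (2 * y) ^+ 2 = 2 * y by rewrite sqr_sqrtr// ltW.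
have ds : is_derive y 1 (fun z : R => Num.sqrt (2 * z)) ((2 * Num.sqrt (2 * y))^-1 * (2 * 1)).
  exact: is_derive_compose (is_derive1_sqrt y20) (is_derive_scale 2 (is_derive_var y)).
have dI : is_derive y 1 (fun z : R => (Num.sqrt (2 * z))^-1)
    (- (Num.sqrt (2 * y)) ^- 2 * ((2 * Num.sqrt (2 * y))^-1 * (2 * 1))).
  exact: is_deriveV.
have du := is_derive_mul (is_derive_sub (is_derive_const y J) (is_derive_var y)) dI.
apply: (is_derive_ext (is_derive_compose (is_derive_gtail _) du)) => //.
have -> : ((J - y) / Num.sqrt (2 * y)) ^+ 2 = gauss_exponent J y.
  by rewrite exprMn exprVn q2.
have yE : y = Num.sqrt (2 * y) ^+ 2 / 2 by rewrite q2; field.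
rewrite mulNr mulNr -mulrN; congr (_ * _).
move: (Num.sqrt (2 * y)) q0 yE => q q0 ->.
by field.
Qed.

Section fixed_shape.
Variables (j : nat) (J s : R).
Hypotheses (jJ : J = j%:R) (J0 : 0 < J) (s0 : 0 < s) (s2 : s ^+ 2 = 2 * J).
(** The Gamma density at [J] divided by the derivative of [gauss_cdf J] there, which is
    [(sqrt pi * s)^-1]. *)
Let c : R := Num.sqrt pi * s * (expR (- J) * (J ^+ j / j`!%:R)).

Let p1 := @sqrt_pi_ge1 R.
Let p0 : 0 < Num.sqrt pi :> R. Proof. exact: lt_le_trans p1. Qed.
Let c0 : 0 < c.
Proof. by rewrite !mulr_gt0 ?expR_gt0 ?exprn_gt0 ?invr_gt0 ?ltr0n ?fact_gt0. Qed.

Let D y : R := c^-1 * gamma_cdf j y - gauss_cdf J y.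
Let dD y := (Num.sqrt pi)^-1 * (expR (- gamma_exponent J y) / s -
   expR (- gauss_exponent J y) * ((y + J) / Num.sqrt (2 * y) ^+ 3)).

Let is_derive_D y : 0 < y -> is_derive y 1 D (dD y).
Proof.
move=> y0.
apply: (is_derive_ext (is_derive_sub (is_derive_scale c^-1 (is_derive_gamma_cdf j y))
  (is_derive_gauss_cdf J y0))) => //.
rewrite /dD mulrBr [X in _ = _ - X]mulrA; congr (_ - _).
have powE (z : R) : 0 < z -> z ^+ j = expR (J * ln z).
  by move=> z0; rewrite jJ expRM_natl lnK.
rewrite /c !powE// /gamma_exponent !invfM !invrK -!expRN.
rewrite (_ : - (y - J - J * (ln y - ln J)) = (- y + J * ln y) + (- - J + - (J * ln J))); last by ring.
rewrite expRD [expR (- y + _)]expRD [expR (_ + - (_ * ln J))]expRD.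
by field; rewrite fact_neq0 !gt_eqF.
Qed.

Let w y := y - J.

(** Two errors occur. The cubic difference of the exponents gives [|w| ^ 3 / s ^ 5], and half of the
    Gaussian factor absorbs [w ^ 2 / J]. The prefactors differ by a term linear in [w]. The
    surviving weight times [|w|] has an explicit primitive. *)
Let dD_le y : J / 2 <= y -> y <= 2 * J ->
  `|dD y| <= 88 * `|w y| / s ^+ 3 * expR (- (w y ^+ 2 / (8 * J))).
Proof.
have hJ := J0; have hs := s0; have hs2 := s2.
move=> Jy yJ; have y0 : 0 < y by lra.
have B1 := gamma_exponent_ge J0 Jy yJ.
have B2 := gauss_exponent_ge J0 y0 yJ.
have B3 := exponent_diff J0 Jy yJ.
have B4 := dist_expRN_le B1 B2.
set A := gamma_exponent J y in B1 B3 B4 *.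
set B := gauss_exponent J y in B2 B3 B4 *.
set e := expR (- (w y ^+ 2 / (8 * J))).
set m := (y - J) ^+ 2 / (4 * J) in B1 B2 B4.
have e0 : 0 <= e by exact: expR_ge0.
have eE : expR (- m) = e * e by rewrite -expRD; congr expR; rewrite /m /w; field; rewrite gt_eqF.
have e1 : e <= 1.
  by rewrite -expR0 ler_expR lerNl oppr0 divr_ge0 ?sqr_ge0// mulr_ge0// ltW.
(* This is [X * exp (- X / 8) <= 8], from [1 + X / 8 <= exp (X / 8)]. *)
have we : w y ^+ 2 / J * e <= 8.
  have := expR_ge1Dx (w y ^+ 2 / (8 * J)).
  have -> : w y ^+ 2 / (8 * J) = w y ^+ 2 / J / 8 by field; rewrite gt_eqF.
  set X := w y ^+ 2 / J => h.
  have -> : e = (expR (X / 8))^-1.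
    by rewrite /e -expRN; congr expR; rewrite /X; field; rewrite gt_eqF.
  rewrite ler_pdivrMr ?expR_gt0//; lra.
have absJ : 0 <= `|w y| / s ^+ 3 by rewrite divr_ge0// exprn_ge0// ltW.
have part1 : `|expR (- A) - expR (- B)| / s <= 32 * (`|w y| / s ^+ 3) * e.
  apply: (@le_trans _ _ (2 * `|y - J| ^+ 3 / J ^+ 2 * (e * e) / s)).
    rewrite ler_wpM2r ?invr_ge0 ?(ltW s0)// (le_trans B4)// eE ler_wpM2r// mulr_ge0//.
  have -> : 2 * `|y - J| ^+ 3 / J ^+ 2 * (e * e) / s = 4 * (`|w y| / s ^+ 3) * e * (w y ^+ 2 / J * e).
    rewrite -[w y ^+ 2]real_normK ?num_real// -/(w y).
    have -> : J = s ^+ 2 / 2 by rewrite s2; field.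
    by field; rewrite gt_eqF.
  rewrite [leRHS](_ : _ = 4 * (`|w y| / s ^+ 3) * e * 8); last by ring.
  by rewrite ler_wpM2l// mulr_ge0// mulr_ge0.
have part2 : expR (- B) * `|s^-1 - (y + J) / Num.sqrt (2 * y) ^+ 3| <= 56 * (`|w y| / s ^+ 3) * e.
  have eB : expR (- B) <= e.
    rewrite ler_expR lerN2 (le_trans _ B2)// /m ler_wpM2l ?sqr_ge0// lef_pV2 ?posrE ?mulr_gt0//.
    by rewrite ler_wpM2r ?(ltW J0)// ler_nat.
  rewrite mulrC ler_pM ?expR_ge0//.
  set q := Num.sqrt (2 * y).
  have q0 : 0 < q by rewrite sqrtr_gt0 mulr_gt0.
  have q2 : q ^+ 2 = 2 * y by rewrite sqr_sqrtr// mulr_ge0// ltW.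
  have qs : s <= 2 * q by rewrite -(@ler_pXn2r _ 2%N)// ?nnegrE ?(ltW s0) ?mulr_ge0 ?(ltW q0)// exprMn s2 q2; lra.
  have sq : q <= 2 * s by rewrite -(@ler_pXn2r _ 2%N)// ?nnegrE ?(ltW q0) ?mulr_ge0 ?(ltW s0)// exprMn s2 q2; lra.
  (* Writing [y = q ^ 2 / 2] and [J = s ^ 2 / 2] makes the mismatch of the prefactors a rational
     function with the factor [q - s]. *)
  have -> : s^-1 - (y + J) / q ^+ 3 = (q - s) * ((2 * q ^+ 2 + q * s + s ^+ 2) / (2 * s * q ^+ 3)).
    have -> : y = q ^+ 2 / 2 by rewrite q2; field.
    have -> : J = s ^+ 2 / 2 by rewrite s2; field.
    by field; rewrite !gt_eqF.
  have E1 : `|q - s| <= 2 * `|w y| / s.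
    rewrite ler_pdivlMr// -(gtr0_norm s0) -normrM (gtr0_norm s0).
    apply: (@le_trans _ _ `|(q - s) * (q + s)|).
      rewrite !normrM ler_wpM2l// !ger0_norm ?addr_ge0 ?(ltW s0) ?(ltW q0)//; lra.
    have -> : (q - s) * (q + s) = 2 * w y by rewrite -subr_sqr q2 s2 /w; ring.
    by rewrite normrM ger0_norm.
  have E2 : (2 * q ^+ 2 + q * s + s ^+ 2) / (2 * s * q ^+ 3) <= 28 / s ^+ 2.
    rewrite ler_pdivrMr ?mulr_gt0 ?exprn_gt0// mulrAC ler_pdivlMr ?exprn_gt0//.
    have F1 : 2 * q ^+ 2 + q * s + s ^+ 2 <= 7 * s ^+ 2 by rewrite q2 s2; nra.
    have F2 : s ^+ 3 <= 8 * q ^+ 3.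
      by rewrite (_ : 8 = 2 ^+ 3) -?exprMn ?lerXn2r ?nnegrE ?mulr_ge0 ?(ltW s0) ?(ltW q0)//; ring.
    apply: (@le_trans _ _ (7 * s ^+ 2 * s ^+ 2)); first by rewrite ler_wpM2r ?sqr_ge0.
    have -> : 7 * s ^+ 2 * s ^+ 2 = 7 * s * s ^+ 3 by ring.
    have -> : 28 * (2 * s * q ^+ 3) = 7 * s * (8 * q ^+ 3) by ring.
    by rewrite ler_wpM2l// mulr_ge0// ltW.
  rewrite normrM [leRHS](_ : _ = 2 * `|w y| / s * (28 / s ^+ 2)); last by field; rewrite gt_eqF.
  have Q0 : 0 <= (2 * q ^+ 2 + q * s + s ^+ 2) / (2 * s * q ^+ 3).
    by rewrite divr_ge0 ?addr_ge0 ?mulr_ge0 ?exprn_ge0 ?(ltW s0) ?(ltW q0).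
  by rewrite ler_pM// ger0_norm.
rewrite /dD normrM ger0_norm ?invr_ge0 ?(ltW p0)//.
apply: (@le_trans _ _ (1 * `|expR (- A) / s - expR (- B) * ((y + J) / Num.sqrt (2 * y) ^+ 3)|)).
  by rewrite ler_wpM2r// invf_le1.
rewrite mul1r (_ : _ - _ = (expR (- A) - expR (- B)) / s +
  expR (- B) * (s^-1 - (y + J) / Num.sqrt (2 * y) ^+ 3)); last by field; rewrite !gt_eqF// sqrtr_gt0 mulr_gt0.
apply: le_trans (ler_normD _ _) _.
rewrite !normrM (ger0_norm (expR_ge0 _)) (@ger0_norm _ s^-1) ?invr_ge0 ?(ltW s0)//.
rewrite [leRHS](_ : _ = 32 * (`|w y| / s ^+ 3) * e + 56 * (`|w y| / s ^+ 3) * e).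
  exact: lerD.
by ring.
Qed.

Lemma D_osc y : J / 2 <= y -> y <= 2 * J -> `|D y - D J| <= 176 / s.
Proof.
have hJ := J0; have hs := s0; have hs2 := s2.
move=> Jy yJ.
(* Up to sign, the derivative of this bump is the bound of [dD_le], so the oscillation on either
   side of [J] is at most its height. *)
pose H (z : R) : R := 176 / s * expR (- (w z ^+ 2 / (8 * J))).
have dH (z : R) : is_derive z (1 : R) H (- (88 * w z / s ^+ 3 * expR (- (w z ^+ 2 / (8 * J))))).
  apply: (is_derive_ext (is_derive_scale (176 / s) (is_derive_exp (is_derive_opp
    (is_derive_mul (is_derive_pow 2 (is_derive_sub (is_derive_var z) (is_derive_const z J)))
      (is_derive_const z (8 * J)^-1)))))) => //=.
  rewrite expr1 /w; have -> : J = s ^+ 2 / 2 by rewrite s2; field.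
  by field; rewrite gt_eqF.
have H0 z : 0 <= H z by rewrite mulr_ge0 ?expR_ge0// divr_ge0// ltW.
have HJ : H J = 176 / s by rewrite /H /w subrr expr0n mul0r oppr0 expR0 mulr1.
have [yj|/ltW jy] := leP y J.
  rewrite distrC -HJ; apply: le_trans (_ : H J - H y <= _); last by rewrite gerBl.
  have := @derive_norm_le D H dD _ y J yj; apply; first last.
  - move=> z /andP[yz zj]; rewrite (le_trans (dD_le _ _)) //; [lra|lra|].
    by rewrite ler0_norm ?/w ?subr_le0// mulrN !mulNr.
  - by move=> z /andP[yz zj]; apply: is_derive_D; lra.
rewrite -HJ; apply: le_trans (_ : - H y - - H J <= _); last by rewrite opprK gerDr oppr_le0.
have := @derive_norm_le D (fun z => - H z) dD _ J y jy; apply; first last.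
- move=> z /andP[yz zj]; rewrite opprK (le_trans (dD_le _ _)) //; [lra|lra|].
  by rewrite ger0_norm// /w subr_ge0.
- by move=> z /andP[yz zj]; apply: is_derive_D; lra.
Qed.
End fixed_shape.

(* Dividing by [c] makes the two densities agree at [y = j], so that Stirling's
   formula is not needed; [c] is compared with 1 by evaluating both distribution
   functions in their tails. *)
Lemma gamma_gauss_osc j : (0 < j)%N -> exists2 c : R, 0 < c &
  forall y, j%:R / 2 <= y -> y <= 2 * j%:R ->
  `|(c^-1 * gamma_cdf j y - gauss_cdf j%:R y) -
    (c^-1 * gamma_cdf j j%:R - gauss_cdf j%:R j%:R)| <= 176 / Num.sqrt j%:R.
Proof.
move=> j0; have J0 : 0 < j%:R :> R by rewrite ltr0n.
have s0 : 0 < Num.sqrt (2 * j%:R) :> R by rewrite sqrtr_gt0 mulr_gt0.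
have s2 : Num.sqrt (2 * j%:R) ^+ 2 = 2 * j%:R :> R by rewrite sqr_sqrtr// mulr_ge0.
eexists; last first.
  move=> y jy yj; apply: le_trans (D_osc (erefl _) J0 s0 s2 jy yj) _.
  have h : Num.sqrt j%:R <= Num.sqrt (2 * j%:R) :> R by rewrite ler_wsqrtr//; lra.
  by rewrite ler_wpM2l// lef_pV2// posrE sqrtr_gt0.
by rewrite !mulr_gt0 ?expR_gt0 ?exprn_gt0 ?invr_gt0 ?ltr0n ?fact_gt0 ?(lt_le_trans _ (@sqrt_pi_ge1 R)).
Qed.

End local_comparison.

(** * Berry-Esseen estimate for the Gamma law, uniform in the shape *)

Section uniform_comparison.
Context {R : realType}.
Implicit Types (x y J : R) (j : nat).

Lemma gauss_cdf_ge0 J y : 0 <= gauss_cdf J y. Proof. exact: gtail_ge0. Qed.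

Lemma gauss_cdf_le1 J y : gauss_cdf J y <= 1. Proof. exact: gtail_le1. Qed.

Lemma gauss_cdf_le J y : 0 < y -> y < J -> gauss_cdf J y <= Num.sqrt (2 * y) / (J - y).
Proof.
move=> y0 yJ; have q0 : 0 < Num.sqrt (2 * y) by rewrite sqrtr_gt0 mulr_gt0.
have d0 : 0 < J - y by rewrite subr_gt0.
by rewrite (le_trans (gtail_le_inv _)) ?divr_gt0// invf_div.
Qed.

Lemma gauss_cdfC_le J y : J < y -> 0 < y -> 1 - gauss_cdf J y <= Num.sqrt (2 * y) / (y - J).
Proof.
move=> Jy y0; have q0 : 0 < Num.sqrt (2 * y) by rewrite sqrtr_gt0 mulr_gt0.
have d0 : 0 < y - J by rewrite subr_gt0.
by rewrite /gauss_cdf -gtailN -mulNr opprB (le_trans (gtail_le_inv _)) ?divr_gt0// invf_div.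
Qed.

(** Here [u] is [1 / sqrt j], [k] the inverse of the unknown ratio of the densities, [d] the scaled
    difference at [y = j]; the pairs [p, g], then [a, ga] and [b, gb] are the Gamma and Gaussian
    values at [y], at [j / 2] and at [2 j]. Since [b - a] and [gb - ga] are both within [4 u] of 1,
    comparing the endpoints forces [k * (b - a)] to be near 1. *)
Lemma normalized_comparison (k u p g a ga b gb d : R) : 0 < k -> 0 < u -> u <= 1 ->
  0 <= p <= 1 -> 0 <= g <= 1 -> 0 <= a -> a <= b -> b <= 1 -> 0 <= ga -> gb <= 1 ->
  1 - b <= 2 * u -> a <= 2 * u -> 1 - gb <= 2 * u -> ga <= 2 * u ->
  - (176 * u) <= (k * p - g) - d <= 176 * u ->
  - (176 * u) <= (k * a - ga) - d <= 176 * u ->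
  - (176 * u) <= (k * b - gb) - d <= 176 * u -> - (1428 * u) <= p - g <= 1428 * u.
Proof.
move=> k0 u0 u1 /andP[p0 p1] /andP[g0 g1] a0 ab b1 ga0 gb1 psi1 psi2 G1 G2
  /andP[y1 y2] /andP[z1 z2] /andP[w1 w2].
have kX1 : k * (b - a) - 1 <= 356 * u by lra.
have kX2 : - (356 * u) <= k * (b - a) - 1 by lra.
have d1 : (k * p - g) - (k * a - ga) <= 352 * u by lra.
have d2 : - (352 * u) <= (k * p - g) - (k * a - ga) by lra.
have X0 : 0 <= b - a by lra.
have X1 : b - a <= 1 by lra.
have X2 : 1 - (b - a) <= 4 * u by lra.
(* Multiplying by [b - a] makes [k] occur only through [k * (b - a)], which is under control. *)
have E : (b - a) * (k * p - g) = k * (b - a) * a - (b - a) * ga + (b - a) * ((k * p - g) - (k * a - ga)) by ring.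
have F : p - g = - ((k * (b - a) - 1) * p) + (b - a) * (k * p - g) - (1 - (b - a)) * g by ring.
have ka : 0 <= k * (b - a) * a by rewrite mulr_ge0// mulr_ge0// ltW.
rewrite F E; move: ((k * p - g) - (k * a - ga)) d1 d2 => e d1 d2.
have kX : 0 <= k * (b - a) by rewrite mulr_ge0// ltW.
have X3 : 0 <= 1 - (b - a) by lra.
move: (k * (b - a)) kX kX1 kX2 ka => K K0 kX1 kX2 ka.
move: (b - a) X0 X1 X2 X3 => X X0 X1 X2 X3.
clear - u0 u1 p0 p1 g0 g1 a0 ga0 psi2 G2 kX1 kX2 d1 d2 X0 X1 X2 X3 K0 ka.
(* Since [u <= 1], the factor [K] is at most 357. The bounds 714, 352, 2, 356 and 4 of this block
   add up to 1428. *)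
have ka2 : K * a <= 714 * u by nra.
have f1 : X * e <= 352 * u by clear - d1 d2 u0 X0 X1; nra.
have f2 : - (352 * u) <= X * e by clear - d1 d2 u0 X0 X1; nra.
have f3 : 0 <= X * ga by rewrite mulr_ge0.
have f4 : X * ga <= 2 * u by clear - ga0 G2 X0 X1; nra.
have q1 : (K - 1) * p <= 356 * u by clear - p0 p1 kX1 kX2 u0; nra.
have q2 : - (356 * u) <= (K - 1) * p by clear - p0 p1 kX1 kX2 u0; nra.
have r1 : 0 <= (1 - X) * g by rewrite mulr_ge0.
have r2 : (1 - X) * g <= 4 * u by clear - g0 g1 X2 X3; nra.
by apply/andP; split; lra.
Qed.

Lemma berry_esseen_center j y : (0 < j)%N -> j%:R / 2 <= y -> y <= 2 * j%:R ->
  `|gamma_cdf j y - gauss_cdf j%:R y| <= 1428 / Num.sqrt j%:R.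
Proof.
move=> j0 jy yj; have J0 : 0 < j%:R :> R by rewrite ltr0n.
have J1 : 1 <= j%:R :> R by rewrite ler1n.
have [t t0 Jt] : exists2 t : R, 0 < t & j%:R = t ^+ 2.
  by exists (Num.sqrt j%:R); rewrite ?sqrtr_gt0// sqr_sqrtr// ltW.
have t1 : 1 <= t by rewrite -(@ler_pXn2r _ 2%N) ?nnegrE ?expr1n -?Jt// ltW.
have u0 : 0 < t^-1 by rewrite invr_gt0.
have u1 : t^-1 <= 1 by rewrite invf_le1.
have st : Num.sqrt j%:R = t by rewrite Jt sqrtr_sqr gtr0_norm.
have h1 : 0 <= j%:R / 2 :> R by lra.
have h2 : j%:R / 2 < j.+1%:R :> R by rewrite -[j.+1%:R]natr1; lra.
have h3 : j%:R / 2 <= 2 * j%:R :> R by lra.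
have h4 : j%:R < 2 * j%:R :> R by lra.
have h5 : 0 < j%:R / 2 :> R by lra.
have h6 : j%:R / 2 < j%:R :> R by lra.
have h7 : 0 < 2 * j%:R :> R by lra.
have h8 : 0 <= y by lra.
have [c c0 osc] := @gamma_gauss_osc R j j0.
have ci0 : 0 < c^-1 by rewrite invr_gt0.
rewrite st in osc *.
have := osc _ jy yj; have := osc _ h3 (lexx _); have := osc _ (lexx _) h3.
rewrite !ler_norml => oa ob oy.
apply: (normalized_comparison ci0 u0 u1 _ _ _ _ _ _ _ _ _ _ _ oy oa ob).
- by rewrite gamma_cdf_ge0// gamma_cdf_le1.
- by rewrite gauss_cdf_ge0 gauss_cdf_le1.
- exact: gamma_cdf_ge0.
- exact: gamma_cdf_homo.
- by rewrite gamma_cdf_le1// ltW.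
- exact: gauss_cdf_ge0.
- exact: gauss_cdf_le1.
- apply: (le_trans (gamma_cdfC_le h4)).
  rewrite Jt (_ : 2 * t ^+ 2 - t ^+ 2 = t ^+ 2) ?[leLHS](_ : _ = 2 * t^-1 * t^-1);
    [|by field; rewrite gt_eqF|by ring].
  by rewrite ler_piMr// mulr_ge0// ltW.
- apply: (le_trans (gamma_cdf_le h1 h2)).
  apply: (@le_trans _ _ (j%:R / 2 / (j%:R / 2) ^+ 2)).
    rewrite ler_wpM2l// lef_pV2 ?posrE ?exprn_gt0 ?subr_gt0// lerXn2r ?nnegrE ?subr_ge0 ?(ltW h2)//.
    by rewrite -[j.+1%:R]natr1; clear - J0; lra.
  rewrite Jt [leLHS](_ : _ = 2 * t^-1 * t^-1); last by field; rewrite gt_eqF.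
  by rewrite ler_piMr// mulr_ge0// ltW.
- apply: (le_trans (gauss_cdfC_le h4 h7)).
  rewrite Jt (_ : 2 * (2 * t ^+ 2) = (2 * t) ^+ 2); last by ring.
  rewrite sqrtr_sqr gtr0_norm ?mulr_gt0// (_ : 2 * t ^+ 2 - t ^+ 2 = t ^+ 2); last by ring.
  by rewrite [leLHS](_ : _ = 2 * t^-1)//; field; rewrite gt_eqF.
- apply: (le_trans (gauss_cdf_le h5 h6)).
  rewrite Jt (_ : 2 * (t ^+ 2 / 2) = t ^+ 2); last by field.
  rewrite sqrtr_sqr gtr0_norm// [leLHS](_ : _ = 2 * t^-1)//; field.
  by rewrite (_ : t ^+ 2 * 2 - t ^+ 2 = t ^+ 2) ?expf_neq0 ?gt_eqF//; ring.
Qed.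

(** For [y <= 1] the bound is trivial. If [y > 2 j] or [y < j / 2], both values are within
    [4 / sqrt y] of 1, respectively of 0. In the central range [sqrt y <= 2 * sqrt j], and twice
    1428 is below 3000. *)
Theorem berry_esseen j y : 0 < y ->
  `|gamma_cdf j y - gauss_cdf j%:R y| <= 3000 / Num.sqrt y.
Proof.
move=> y0; have [q q0 yq] : exists2 q : R, 0 < q & y = q ^+ 2.
  by exists (Num.sqrt y); rewrite ?sqrtr_gt0// sqr_sqrtr// ltW.
have sq : Num.sqrt y = q by rewrite yq sqrtr_sqr gtr0_norm.
rewrite sq.
have P0 := gamma_cdf_ge0 j (ltW y0); have P1 := gamma_cdf_le1 j (ltW y0).
have G0 := gauss_cdf_ge0 j%:R y; have G1 := gauss_cdf_le1 j%:R y.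
have i0 : 0 < q^-1 by rewrite invr_gt0.
have s2 : Num.sqrt (2 * y) <= 2 * q.
  have -> : 2 * q = Num.sqrt (4 * y).
    by rewrite yq (_ : 4 * q ^+ 2 = (2 * q) ^+ 2) ?sqrtr_sqr ?gtr0_norm ?mulr_gt0//; ring.
  by rewrite ler_wsqrtr// ler_wpM2r ?ler_nat// ltW.
have [q1|q1] := leP q 1.
  have : 1 <= q^-1 by rewrite invf_ge1.
  clear - P0 P1 G0 G1 => h.
  by rewrite ler_norml; apply/andP; split; lra.
have [jy|yj] := ltP (2 * j%:R) y.
  have jy' : j%:R < y by have : 0 <= j%:R :> R by []; clear - jy; lra.
  have d : y / 2 <= y - j%:R by clear - jy; lra.
  have d0 : 0 < y / 2 by rewrite divr_gt0.
  have H1 : 1 - gamma_cdf j y <= 4 * q^-1.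
    apply: (le_trans (gamma_cdfC_le jy')).
    apply: (@le_trans _ _ (y / (y / 2) ^+ 2)).
      by rewrite ler_wpM2l ?(ltW y0)// lef_pV2 ?posrE ?exprn_gt0 ?subr_gt0// lerXn2r ?nnegrE ?subr_ge0 ?(ltW jy') ?(ltW d0).
    rewrite yq [leLHS](_ : _ = 4 * q^-1 * q^-1); last by field; rewrite gt_eqF.
    by rewrite ler_piMr ?mulr_ge0 ?(ltW i0)// invf_le1// ltW.
  have H2 : 1 - gauss_cdf j%:R y <= 4 * q^-1.
    apply: (le_trans (gauss_cdfC_le jy' y0)).
    apply: (@le_trans _ _ (2 * q / (y / 2))).
      by rewrite ler_pM ?sqrtr_ge0 ?invr_ge0 ?subr_ge0 ?(ltW jy')// lef_pV2 ?posrE ?subr_gt0.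
    by rewrite yq [leLHS](_ : _ = 4 * q^-1)//; field; rewrite gt_eqF.
  clear - P0 P1 G0 G1 H1 H2 i0.
  by rewrite ler_norml; apply/andP; split; lra.
have [yj2|jy2] := ltP y (j%:R / 2).
  have jy : y < j%:R by clear - yj2 y0; lra.
  have d : y <= j%:R - y by clear - yj2; lra.
  have jS : y < j.+1%:R by rewrite (lt_trans jy)// ltr_nat.
  have H1 : gamma_cdf j y <= 4 * q^-1.
    apply: (le_trans (gamma_cdf_le (ltW y0) jS)).
    apply: (@le_trans _ _ (y / y ^+ 2)).
      rewrite ler_wpM2l ?(ltW y0)// lef_pV2 ?posrE ?exprn_gt0 ?subr_gt0// lerXn2r ?nnegrE ?subr_ge0 ?(ltW jS) ?(ltW y0)//.
      by rewrite (le_trans d)// lerD2r ler_nat.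
    rewrite yq [leLHS](_ : _ = q^-1 * q^-1); last by field; rewrite gt_eqF.
    by rewrite ler_wpM2r ?(ltW i0)// (@le_trans _ _ 1) ?ler1n// invf_le1// ltW.
  have H2 : gauss_cdf j%:R y <= 4 * q^-1.
    apply: (le_trans (gauss_cdf_le y0 jy)).
    apply: (@le_trans _ _ (2 * q / y)).
      by rewrite ler_pM ?sqrtr_ge0 ?invr_ge0 ?subr_ge0 ?(ltW jy)// lef_pV2 ?posrE ?subr_gt0.
    rewrite yq [leLHS](_ : _ = 2 * q^-1); last by field; rewrite gt_eqF.
    by rewrite ler_wpM2r ?(ltW i0)// ler_nat.
  clear - P0 P1 G0 G1 H1 H2 i0.
  by rewrite ler_norml; apply/andP; split; lra.
have j0 : (0 < j)%N by rewrite -(ltr0n R); clear - yj y0; lra.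
apply: le_trans (berry_esseen_center j0 jy2 yj) _.
have J0 : 0 < j%:R :> R by rewrite ltr0n.
have : q <= 2 * Num.sqrt j%:R.
  rewrite -[leRHS]gtr0_norm ?mulr_gt0 ?sqrtr_gt0// -sqrtr_sqr -sq ler_wsqrtr// exprMn sqr_sqrtr ?(ltW J0)//.
  by clear - yj J0; lra.
have sj0 : 0 < Num.sqrt j%:R :> R by rewrite sqrtr_gt0.
move: (Num.sqrt j%:R) sj0 => sj sj0 h.
rewrite ler_pdivrMr// mulrAC ler_pdivlMr//; clear - h sj0; lra.
Qed.

End uniform_comparison.

(** * Lebesgue measure of the plane in polar form *)

Section plane_measure.
Context {R : realType}.
Local Notation T := (measurableTypeR R).
Local Notation mu1 := (@lebesgue_measure R).
Local Notation mu2 := (mu1 \x mu1)%E.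
Local Open Scope ereal_scope.

Lemma measurable_addr (a : R) : measurable_fun [set: T] (fun x : T => (x + a)%R : T).
Proof. by apply: measurable_funD => //; exact: measurable_cst. Qed.

Lemma lebesgue_measure_shift (a : R) (A : set R) : measurable (A : set T) ->
  mu1 ((fun x => x + a)%R @^-1` A) = mu1 A.
Proof.
move=> mA.
pose mixin := isMeasurableFun.Build _ _ _ _ _ (measurable_addr a).
pose f : {mfun T >-> T} := HB.pack (fun x : T => (x + a)%R : T) mixin.
have := @lebesgue_measure_unique R (pushforward mu1 f) _ A mA.
move=> /(_ (measurable_addr a)) H; rewrite [RHS]H// => _ [[x y] _ <-] /=.
rewrite -[RHS]/(mu1 ((fun x => x + a)%R @^-1` `]x, y])) (_ : (fun x => x + a)%R @^-1` _ = `](x - a)%R, (y - a)%R]%classic); last first.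
  by apply/seteqP; split => z /=; rewrite !in_itv/= ltrBlDr lerBrDr.
rewrite !lebesgue_measure_itv/= !lte_fin ltrD2r; case: ifP => // _.
by rewrite -!EFinB; congr EFin; ring.
Qed.

Lemma ge0_integral_shift (a : R) (f : R -> \bar R) : measurable_fun [set: T] f ->
  (forall x, 0 <= f x) -> \int[mu1]_x f (x + a)%R = \int[mu1]_x f x.
Proof.
move=> mf f0.
pose mixin := isMeasurableFun.Build _ _ _ _ _ (measurable_addr a).
pose s : {mfun T >-> T} := HB.pack (fun x : T => (x + a)%R : T) mixin.
have := @ge0_integral_pushforward _ _ _ _ R _ (measurable_addr a) mu1 setT f measurableT mf (fun x _ => f0 x).
rewrite preimage_setT => <-.
apply: (@eq_measure_integral _ _ _ _ mu1 _) => [|mf' A mA _]; first exact: measurable_addr.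
exact: lebesgue_measure_shift.
Qed.

Lemma measurable_affine_pair (a b c d : R) : measurable_fun [set: T * T]
  (fun z : T * T => ((a * z.1 + b * z.2)%R, (c * z.1 + d * z.2)%R) : T * T).
Proof.
apply/measurable_fun_pairP; split; apply: measurable_funD;
  apply: measurable_funM => //; exact: measurable_cst.
Qed.

Lemma ge0_integral_shear1 (t : R) (f : T * T -> \bar R) : measurable_fun setT f ->
  (forall z, 0 <= f z) -> \int[mu2]_z f ((z.1 + t * z.2)%R, z.2) = \int[mu2]_z f z.
Proof.
move=> mf f0.
have mg : measurable_fun setT (fun z : T * T => f ((z.1 + t * z.2)%R, z.2)).
  apply: (measurableT_comp mf).
  rewrite (_ : (fun _ => _) = (fun z : T * T => ((1 * z.1 + t * z.2)%R, (0 * z.1 + 1 * z.2)%R) : T * T)).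
    exact: measurable_affine_pair.
  by apply/funext => z; rewrite !mul1r mul0r add0r.
rewrite fubini_tonelli2// fubini_tonelli2//; apply: eq_integral => y _.
rewrite /fubini_G /= (@ge0_integral_shift (t * y)%R (fun x => f (x, y)))//.
exact: measurableT_comp.
Qed.

Lemma ge0_integral_shear2 (t : R) (f : T * T -> \bar R) : measurable_fun setT f ->
  (forall z, 0 <= f z) -> \int[mu2]_z f (z.1, (z.2 + t * z.1)%R) = \int[mu2]_z f z.
Proof.
move=> mf f0.
have mg : measurable_fun setT (fun z : T * T => f (z.1, (z.2 + t * z.1)%R)).
  apply: (measurableT_comp mf).
  rewrite (_ : (fun _ => _) = (fun z : T * T => ((1 * z.1 + 0 * z.2)%R, (t * z.1 + 1 * z.2)%R) : T * T)).
    exact: measurable_affine_pair.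
  by apply/funext => z; rewrite !mul1r mul0r addr0 addrC.
rewrite fubini_tonelli1// fubini_tonelli1//; apply: eq_integral => x _.
rewrite /fubini_F /= (@ge0_integral_shift (t * x)%R (fun y => f (x, y)))//.
exact: measurableT_comp.
Qed.

Definition rot (c s : R) (z : R * R) : R * R :=
  (c * z.1 - s * z.2, s * z.1 + c * z.2)%R.

Lemma measurable_rot c s : measurable_fun [set: T * T] (rot c s : T * T -> T * T).
Proof.
rewrite (_ : rot c s = (fun z : T * T => ((c * z.1 + (- s) * z.2)%R, (s * z.1 + c * z.2)%R) : T * T)).
  exact: measurable_affine_pair.
by apply/funext => z; rewrite mulNr.
Qed.

(* A rotation is a product of three shears. *)
Lemma ge0_integral_rot (c s : R) (f : T * T -> \bar R) :
  (c ^+ 2 + s ^+ 2 = 1)%R -> (1 + c != 0)%R -> measurable_fun setT f ->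
  (forall z, 0 <= f z) -> \int[mu2]_z f (rot c s z) = \int[mu2]_z f z.
Proof.
(* This is the tangent of half the angle, defined for all rotations but the half turn. *)
move=> cs c1 mf f0; set t := (s / (1 + c))%R.
rewrite -(@ge0_integral_shear1 (- t) f mf f0).
have mf1 : measurable_fun setT (fun z : T * T => f ((z.1 + - t * z.2)%R, z.2)).
  apply: (measurableT_comp mf).
  rewrite (_ : (fun _ => _) = (fun z : T * T => ((1 * z.1 + - t * z.2)%R, (0 * z.1 + 1 * z.2)%R) : T * T)).
    exact: measurable_affine_pair.
  by apply/funext => z; rewrite !mul1r mul0r add0r.
rewrite -(@ge0_integral_shear2 s (fun z => f ((z.1 + - t * z.2)%R, z.2)) mf1)//.
have mf2 : measurable_fun setT (fun z : T * T => f ((z.1 + - t * (z.2 + s * z.1))%R, (z.2 + s * z.1)%R)).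
  apply: (measurableT_comp mf).
  rewrite (_ : (fun _ => _) = (fun z : T * T => (((1 - t * s) * z.1 + - t * z.2)%R, (s * z.1 + 1 * z.2)%R) : T * T)).
    exact: measurable_affine_pair.
  by apply/funext => z; congr pair; ring.
rewrite -(@ge0_integral_shear1 (- t) (fun z => f ((z.1 + - t * (z.2 + s * z.1))%R, (z.2 + s * z.1)%R)) mf2)//.
apply: eq_integral => z _ /=; congr f.
have ts : (t * s = 1 - c)%R.
  rewrite /t mulrAC -expr2 (_ : s ^+ 2 = (1 - c) * (1 + c))%R ?mulfK//.
  by rewrite (_ : s ^+ 2 = 1 - c ^+ 2)%R; [ring|rewrite -cs; ring].
have tc : (t * (1 + c) = s)%R by rewrite /t divfK.
have sE : (s * z.1 + (1 - t * s) * z.2 = s * z.1 + c * z.2)%R by rewrite ts; congr (_ + _)%R; congr (_ * _)%R; ring.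
have cE : ((1 - t * s) * z.1 - (t * (1 + (1 - t * s))) * z.2 = c * z.1 - s * z.2)%R.
  have h : (1 - t * s = c)%R by rewrite ts; ring.
  by rewrite h tc.
by rewrite /rot -cE -sE; congr pair; ring.
Qed.

End plane_measure.

Section radial.
Context {R : realType}.
Local Notation T := (measurableTypeR R).
Local Notation mu1 := (@lebesgue_measure R).
Local Notation mu2 := (mu1 \x mu1)%E.
Implicit Types (s a b : R) (z : T * T).

Definition sqnorm (z : R * R) : R := z.1 ^+ 2 + z.2 ^+ 2.

Lemma sqnorm_ge0 z : 0 <= sqnorm z.
Proof. by rewrite addr_ge0 ?sqr_ge0. Qed.

Lemma measurable_sqnorm : measurable_fun [set: T * T] (sqnorm : T * T -> T).
Proof. by apply: measurable_funD; apply: measurable_funX. Qed.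

Lemma measurable_sqnorm_itv (i : interval R) :
  measurable (sqnorm @^-1` [set` i] : set (T * T)).
Proof.
by rewrite -[_ @^-1` _]setTI; apply: measurable_sqnorm.
Qed.

Lemma integral_half_disc s : 0 <= s ->
  (\int[mu1]_(x in `[(- Num.sqrt s)%R, Num.sqrt s]) (2 * Num.sqrt (s - x ^+ 2))%:E = (pi * s)%:E)%E.
Proof.
rewrite le_eqVlt => /predU1P[<-|s0].
  rewrite sqrtr0 oppr0 set_itv1 integral_set1 mulr0//.
have r0 : 0 < Num.sqrt s by rewrite sqrtr_gt0.
have r2 : Num.sqrt s ^+ 2 = s by rewrite sqr_sqrtr// ltW.
move: (Num.sqrt s) r0 r2 => r r0 <- {s s0}.
pose F (t : R) : R := r * sin t.
have dF (t : R) : is_derive t 1 F (r * cos t) by exact: is_derive_scale.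
have F'E : derive1 F = fun t => r * cos t.
  by apply/funext => t; rewrite derive1E; have [] := dF t.
have pi2 : - (pi / 2) <= pi / 2 :> R by have := @pi_gt0 R; lra.
have cF : continuous F by move=> t; exact: is_derive_continuous (dF t).
have cF' : continuous (derive1 F).
  by rewrite F'E => t; apply: cvgM; [exact: cvg_cst|exact: continuous_cos].
have Fpi : F (pi / 2) = r by rewrite /F sin_pihalf mulr1.
have FNpi : F (- (pi / 2)) = - r by rewrite /F sinN sin_pihalf mulrN1.
have := @integration_by_substitution_increasing R F (fun x => 2 * Num.sqrt (r ^+ 2 - x ^+ 2)) _ _ pi2.
rewrite FNpi Fpi => ->; last 6 first.
- by move=> x y xI yI xy; rewrite /F ltr_pM2l// ltr_sin.
- by move=> x _; exact: cF'.
- by apply/cvg_ex; exists (derive1 F (- (pi / 2))); apply: cvg_at_right_filter; exact: cF'.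
- by apply/cvg_ex; exists (derive1 F (pi / 2)); apply: cvg_at_left_filter; exact: cF'.
- split=> [x _||]; first by have [] := dF x.
    by apply: cvg_at_right_filter; exact: cF.
  by apply: cvg_at_left_filter; exact: cF.
- apply: continuous_subspaceT => x; apply: cvgM; first exact: cvg_cst.
  apply: continuous_comp; last exact: sqrt_continuous.
  by apply: cvgB; [exact: cvg_cst|exact: exprn_continuous].
rewrite F'E.
pose H (t : R) : R := r ^+ 2 * (t + sin t * cos t).
have dH (t : R) : is_derive t (1 : R) H (2 * r ^+ 2 * cos t ^+ 2).
  apply: (is_derive_ext (is_derive_scale (r ^+ 2) (is_derive_add (is_derive_var t)
    (is_derive_mul (is_derive_sin t) (is_derive_cos t))))) => //.
  by rewrite (_ : sin t * - sin t = cos t ^+ 2 - 1); [ring|rewrite -(cos2Dsin2 t); ring].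
have cH : continuous H by move=> t; exact: is_derive_continuous (dH t).
rewrite (_ : (\int[_]_(x in _) _)%E = (\int[mu1]_(x in `[(- (pi / 2))%R, (pi / 2)%R]) (2 * r ^+ 2 * cos x ^+ 2)%:E)%E); last first.
  apply: eq_integral => x; rewrite inE/= in_itv/= => xI; congr EFin.
  rewrite !fctE /F exprMn (_ : r ^+ 2 - r ^+ 2 * sin x ^+ 2 = (r * cos x) ^+ 2); last first.
    by rewrite exprMn cos2sin2; ring.
  rewrite sqrtr_sqr ger0_norm; first by ring.
  by rewrite mulr_ge0 ?(ltW r0)// cos_ge0_pihalf.
rewrite (@continuous_FTC2 R _ H).
- by rewrite /H !sinN !cosN sin_pihalf cos_pihalf -EFinB; congr EFin; field.
- by have := @pi_gt0 R; lra.
- apply: continuous_subspaceT => x.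
  exact: (is_derive_continuous (is_derive_scale (2 * r ^+ 2) (is_derive_pow 2 (is_derive_cos x)))).
- split=> [x _||]; first by have [] := dH x.
    by apply: cvg_at_right_filter; exact: cH.
  by apply: cvg_at_left_filter; exact: cH.
- by move=> x _; rewrite derive1E; have [] := dH x.
Qed.

Lemma measure_disc s : 0 <= s -> mu2 (sqnorm @^-1` `]-oo, s]) = (pi * s)%:E.
Proof.
move=> s0.
rewrite -integral_half_disc//.
rewrite [RHS]integral_mkcond.
apply: eq_integral => x _ /=; rewrite patchE.
have [|xs] := boolP (x \in _).
  rewrite inE/= in_itv/= -ler_norml => xs.
  have x2 : x ^+ 2 <= s.
    by rewrite -(sqr_sqrtr s0) -real_normK ?num_real// lerXn2r ?nnegrE ?sqrtr_ge0.
  rewrite (_ : xsection _ _ = `[(- Num.sqrt (s - x ^+ 2))%R, (Num.sqrt (s - x ^+ 2))%R]%classic); last first.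
    apply/seteqP; split => y; rewrite /xsection /= inE/= in_itv/= /sqnorm/= in_itv/= -ler_norml -lerBrDl -sqrtr_sqr ler_sqrt ?subr_ge0//.
  rewrite lebesgue_measure_itv/= lte_fin.
  case: ifPn => [_|]; first by rewrite -EFinB; congr EFin; ring.
  rewrite -leNgt => h; have s1 := sqrtr_ge0 (s - x ^+ 2).
  have -> : Num.sqrt (s - x ^+ 2) = 0 by lra.
  by rewrite mulr0.
rewrite (_ : xsection _ _ = set0) ?measure0//.
rewrite -subset0 => y; rewrite /xsection /= inE/= in_itv/= /sqnorm/= => h.
move/negP: xs; apply; rewrite inE/= in_itv/= -ler_norml -sqrtr_sqr ler_sqrt//.
by rewrite (le_trans _ h)// lerDl sqr_ge0.
Qed.

Lemma measure_annulus a b : 0 <= a -> a <= b ->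
  mu2 (sqnorm @^-1` `]a, b]) = (pi * (b - a))%:E.
Proof.
move=> a0 ab; have b0 := le_trans a0 ab.
have -> : sqnorm @^-1` `]a, b] = sqnorm @^-1` `]-oo, b] `\` sqnorm @^-1` `]-oo, a].
  apply/seteqP; split => z /=; rewrite !in_itv/=.
    by move=> /andP[az zb]; split => //; apply/negP; rewrite -ltNge.
  by move=> [zb /negP]; rewrite -ltNge => ->.
rewrite measureD; [|exact: measurable_sqnorm_itv|exact: measurable_sqnorm_itv|by rewrite [ltLHS]measure_disc// ltry].
have -> : sqnorm @^-1` `]-oo, b] `&` sqnorm @^-1` `]-oo, a] = sqnorm @^-1` `]-oo, a].
  apply/seteqP; split => z /=; rewrite !in_itv/=; first by case.
  by move=> za; split=> //; rewrite (le_trans za).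
by rewrite [X in (X - _)%E]measure_disc// [X in (_ - X)%E]measure_disc// -EFinB mulrBr.
Qed.

Lemma measure_circle a : mu2 (sqnorm @^-1` [set a]) = 0%E.
Proof.
rewrite /product_measure1 /= integral0_eq// => x _ /=.
pose A : set T := xsection (sqnorm @^-1` [set a]) x.
pose B : set T := [set Num.sqrt (a - x ^+ 2)] `|` [set - Num.sqrt (a - x ^+ 2)].
suff h : A `<=` B.
  apply: (@subset_measure0 _ _ _ mu1 A B _ _ h).
  - by apply: measurable_xsection; rewrite -set_itv1; exact: measurable_sqnorm_itv.
  - by apply: measurableU; exact: measurable_set1.
  - apply/eqP; rewrite eq_le measure_ge0 andbT (le_trans (measureU2 _ _ _)) //.
    by rewrite [X in (X + _)%E]lebesgue_measure_set1 [X in (_ + X)%E]lebesgue_measure_set1 adde0.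
move=> y; rewrite /A /B /xsection/= inE/= /sqnorm/= => <-.
rewrite addrAC subrr add0r sqrtr_sqr.
by case: (ger0P y) => _; [left|right; rewrite opprK].
Qed.

End radial.

(** * Integrals of radial functions over annuli *)

Section radial_integral.
Context {R : realType}.
Local Notation T := (measurableTypeR R).
Local Notation mu1 := (@lebesgue_measure R).
Local Notation mu2 := (mu1 \x mu1)%E.
Implicit Types (f h H : R -> R) (s t a b : R) (z : T * T).

(** Over [n] equal steps the quadratic bounds add up to [K * (b - a) ^ 2 / n], and [n] is
    arbitrary. *)
Lemma quadratic_modulus_constant f K a b : a <= b ->
  (forall s t, a <= s -> s <= t -> t <= b -> `|f t - f s| <= K * (t - s) ^+ 2) ->
  f b = f a.
Proof.
move=> ab fK; apply/eqP; rewrite -subr_eq0 -normr_eq0; apply/eqP.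
apply/le_anti; rewrite normr_ge0 andbT.
apply/ler_addgt0Pr => e e0; rewrite add0r.
set d := b - a; have d0 : 0 <= d by rewrite subr_ge0.
set n := (Num.truncn (`|K| * d ^+ 2 / e)).+1.
have n0 : 0 < n%:R :> R by rewrite ltr0n.
pose x i : R := a + d * (i%:R / n%:R).
have -> : f b - f a = \sum_(0 <= i < n) (f (x i.+1) - f (x i)).
  rewrite (telescope_sumr (fun i => f (x i)))//.
  have -> : x n = b by rewrite /x divff ?gt_eqF// mulr1 /d addrC subrK.
  by rewrite /x mul0r mulr0 addr0.
apply: (le_trans (ler_norm_sum _ _ _)).
apply: (@le_trans _ _ (\sum_(0 <= i < n) K * (d / n%:R) ^+ 2)).
  apply: ler_sum_nat => i /andP[_ ni].
  have E : x i.+1 - x i = d / n%:R by rewrite /x -natr1; field; rewrite gt_eqF.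
  rewrite -E; apply: fK.
  - by rewrite /x lerDl mulr_ge0// divr_ge0.
  - by rewrite -subr_ge0 E divr_ge0// ltW.
  - rewrite /x -lerBrDl -/d ler_piMr// ler_pdivrMr// mul1r ler_nat//.
rewrite sumr_const_nat subn0 -[leLHS]mulr_natl.
rewrite [leLHS](_ : _ = K * d ^+ 2 / n%:R); last by field; rewrite gt_eqF.
rewrite ler_pdivrMr// (@le_trans _ _ (`|K| * d ^+ 2))//.
  by rewrite ler_wpM2r ?sqr_ge0// ler_norm.
rewrite -ler_pdivrMl// mulrC.
have q0 : 0 <= `|K| * d ^+ 2 / e by rewrite divr_ge0 ?mulr_ge0 ?sqr_ge0// ltW.
by have /andP[_ /ltW] := Num.Theory.truncn_itv q0.
Qed.

Definition annulus a b : set (T * T) := sqnorm @^-1` `]a, b].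

Lemma measurable_annulus a b : measurable (annulus a b).
Proof. exact: measurable_sqnorm_itv. Qed.

Lemma integrable_annulus h C a b : 0 <= a -> a <= b -> measurable_fun [set: T] (h : T -> T) ->
  (forall s, a <= s <= b -> `|h s| <= C) ->
  mu2.-integrable (annulus a b) (EFin \o (h \o sqnorm)).
Proof.
move=> a0 ab mh hC; apply: measurable_bounded_integrable.
- exact: measurable_annulus.
- by rewrite [ltLHS]measure_annulus// ltry.
- apply: (measurable_funS measurableT) => //.
  exact: measurableT_comp mh measurable_sqnorm.
- exists C; split; first exact: num_real.
  move=> M CM z; rewrite /annulus/= in_itv/= => /andP[az zb].
  by rewrite (le_trans (hC _ _))//; [rewrite (ltW az)|exact: ltW].
Qed.

(** In the squared radius, area is [pi] times length. Both the integral over [annulus a t] and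
    [pi * H t] therefore grow by [pi * h s * (t - s)] up to a quadratic error, and their difference
    is constant by [quadratic_modulus_constant]. *)
Lemma Rintegral_annulus h H L a b : 0 <= a -> a <= b -> measurable_fun [set: T] (h : T -> T) ->
  (forall s, a <= s <= b -> is_derive s 1 H (h s)) ->
  (forall s t, a <= s <= b -> a <= t <= b -> `|h t - h s| <= L * `|t - s|) ->
  Rintegral mu2 (annulus a b) (fun z => h (sqnorm z)) = pi * (H b - H a).
Proof.
move=> a0 ab mh dH hL.
pose I s t := Rintegral mu2 (annulus s t) (fun z => h (sqnorm z)).
pose C := `|h a| + `|L| * (b - a).
have hC s : a <= s <= b -> `|h s| <= C.
  move=> /andP[as_ sb]; rewrite -[h s](subrK (h a)) (le_trans (ler_normD _ _))// addrC lerD2l.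
  rewrite (le_trans (hL _ _ _ _)) ?lexx ?ab ?as_ ?sb// ger0_norm ?subr_ge0//.
  by rewrite (le_trans (ler_wpM2r _ (ler_norm L))) ?subr_ge0// ler_wpM2l// lerD2r.
have int s t : a <= s -> s <= t -> t <= b ->
    mu2.-integrable (annulus s t) (EFin \o (h \o sqnorm)).
  move=> as_ st tb; apply: (@integrable_annulus h C); rewrite ?(le_trans a0)// => u /andP[su ut].
  by apply: hC; rewrite (le_trans as_)// (le_trans ut).
have cst s t c : 0 <= s -> s <= t -> mu2.-integrable (annulus s t) (EFin \o (cst c : T * T -> R)).
  move=> s0 st; apply: (@integrable_annulus (cst c) `|c|) => //.
have addI s t : a <= s -> s <= t -> t <= b -> I a t = I a s + I s t.
  move=> as_ st tb; rewrite /I.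
  have -> : annulus a t = annulus a s `|` annulus s t.
    apply/seteqP; split => z; rewrite /annulus/= !in_itv/=.
      move=> /andP[az zt]; have [zs|sz] := leP (sqnorm z) s; [left|right].
        by rewrite az.
      by rewrite zt.
    move=> [/andP[az zs]|/andP[sz zt]]; first by rewrite az (le_trans zs).
    by rewrite zt (le_lt_trans as_).
  rewrite Rintegral_setU//; [exact: measurable_annulus|exact: measurable_annulus| |].
    have -> : annulus a s `|` annulus s t = annulus a t.
      apply/seteqP; split => z; rewrite /annulus/= !in_itv/=.
        move=> [/andP[az zs]|/andP[sz zt]]; first by rewrite az (le_trans zs).
        by rewrite zt (le_lt_trans as_).
      move=> /andP[az zt]; have [zs|sz] := leP (sqnorm z) s; [left|right].
        by rewrite az.
      by rewrite zt.
    by apply: int => //; rewrite (le_trans as_).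
  apply/disj_setPS => z; rewrite /annulus/= !in_itv/= => -[/andP[_ zs] /andP[sz _]].
  by move: sz; rewrite ltNge zs.
have boundI s t : a <= s -> s <= t -> t <= b ->
    `|I s t - pi * (h s * (t - s))| <= pi * (`|L| * (t - s) ^+ 2).
  move=> as_ st tb; have s0 := le_trans a0 as_.
  have near_h z : annulus s t z -> `|h (sqnorm z) - h s| <= `|L| * (t - s).
    rewrite /annulus/= in_itv/= => /andP[/ltW sz zt].
    rewrite (le_trans (hL _ _ _ _))//.
    - by rewrite as_ (le_trans st).
    - by rewrite (le_trans as_)// (le_trans zt).
    - rewrite ger0_norm ?subr_ge0// (le_trans (ler_wpM2r _ (ler_norm L))) ?subr_ge0//.
      by rewrite ler_wpM2l// lerD2r.
  have up := @le_Rintegral _ _ _ mu2 (annulus s t) _ _ (measurable_annulus s t) (int s t as_ st tb)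
    (cst s t (h s + `|L| * (t - s)) s0 st).
  have lo := @le_Rintegral _ _ _ mu2 (annulus s t) _ _ (measurable_annulus s t)
    (cst s t (h s - `|L| * (t - s)) s0 st) (int s t as_ st tb).
  rewrite !Rintegral_cst ?[X in fine X]measure_annulus//= in up lo; [|exact: measurable_annulus..].
  have {}up : I s t <= (h s + `|L| * (t - s)) * (pi * (t - s)).
    by apply: up => z /near_h; rewrite ler_norml => /andP[_]; rewrite lerBlDl.
  have {}lo : (h s - `|L| * (t - s)) * (pi * (t - s)) <= I s t.
    by apply: lo => z /near_h; rewrite ler_norml => /andP[+ _]; rewrite lerBrDl.
  rewrite ler_norml; apply/andP; split.
    rewrite -lerBlDr; apply: le_trans lo; rewrite le_eqVlt; apply/orP; left; apply/eqP; ring.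
  rewrite lerBlDr; apply: (le_trans up); rewrite le_eqVlt; apply/orP; left; apply/eqP; ring.
have boundH s t : a <= s -> s <= t -> t <= b ->
    `|H t - H s - h s * (t - s)| <= `|L| * (t - s) ^+ 2.
  move=> as_ st tb.
  have [z /andP[sz zt]|c /andP[sc ct] ->] := mean_value st (f := H) (df := h).
    by apply: dH; rewrite (le_trans as_)// (le_trans zt).
  rewrite -mulrBl normrM (ger0_norm (_ : 0 <= t - s)) ?subr_ge0// expr2 mulrA ler_wpM2r ?subr_ge0//.
  rewrite (le_trans (hL _ _ _ _))//.
  - by rewrite as_ (le_trans st).
  - by rewrite (le_trans as_)// (le_trans ct).
  - rewrite ger0_norm ?subr_ge0// (le_trans (ler_wpM2r _ (ler_norm L))) ?subr_ge0//.
    by rewrite ler_wpM2l// lerD2r.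
have I0 : I a a = 0.
  rewrite /I (_ : annulus a a = set0) ?Rintegral_set0// -subset0 => z.
  by rewrite /annulus/= in_itv/= => /andP[/lt_le_trans h1 /h1]; rewrite ltxx.
suff E : I a b - pi * H b = I a a - pi * H a.
  by move: E; rewrite I0 sub0r => /(canRL (subrK _)) E; rewrite -/(I a b) E; ring.
apply: (@quadratic_modulus_constant (fun s => I a s - pi * H s) (2 * (pi * `|L|)) a b ab).
move=> s t as_ st tb; rewrite (addI s t)//.
rewrite (_ : _ - _ = (I s t - pi * (h s * (t - s))) - pi * (H t - H s - h s * (t - s))); last by ring.
rewrite (le_trans (ler_normB _ _))//.
rewrite [leRHS](_ : _ = pi * (`|L| * (t - s) ^+ 2) + pi * (`|L| * (t - s) ^+ 2)); last by ring.
rewrite lerD//; first exact: boundI.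
by rewrite normrM (ger0_norm (pi_ge0 R)) ler_wpM2l ?pi_ge0// boundH.
Qed.

Lemma poisson_term_itv k (y : R) : 0 <= y -> 0 <= expR (- y) * (y ^+ k / k`!%:R) <= 1.
Proof.
move=> y0; rewrite mulr_ge0 ?expR_ge0 ?divr_ge0 ?exprn_ge0//=.
have := gamma_cdf_ge0 k y0; rewrite subr_ge0; apply: le_trans.
by rewrite ler_wpM2l ?expR_ge0// /exp_sum big_ord_recr/= lerDr sumr_ge0// => i _; rewrite divr_ge0 ?exprn_ge0.
Qed.

Definition radial_density k s : R := expR (- (pi * s)) * ((pi * s) ^+ k / k`!%:R).

(** The derivative is [pi] times the difference of two consecutive Poisson probabilities, both in
    [[0, 1]]. *)
Lemma radial_density_lipschitz k s t : 0 <= s -> 0 <= t ->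
  `|radial_density k t - radial_density k s| <= pi * `|t - s|.
Proof.
wlog st : s t / s <= t => [h s0 t0|s0 t0].
  have [|/ltW] := leP s t; first by move=> ?; apply: h.
  by move=> ts; rewrite distrC (distrC t); apply: h.
have dr (u : R) : is_derive u 1 (radial_density k)
   (pi * (expR (- (pi * u)) * (k%:R * (pi * u) ^+ k.-1 / k`!%:R) - radial_density k u)).
  apply: (is_derive_ext (is_derive_mul
     (is_derive_exp (is_derive_opp (is_derive_scale pi (is_derive_var u))))
     (is_derive_mul (is_derive_pow k (is_derive_scale pi (is_derive_var u))) (is_derive_const u (k`!%:R)^-1)))) => //.
  by rewrite /radial_density; ring.
have [c /andP[sc ct] ->] := mean_value st (fun u _ => dr u).
rewrite normrM ler_wpM2r// normrM (ger0_norm (pi_ge0 R)) ler_piMr ?pi_ge0//.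
have c0 : 0 <= pi * c by rewrite mulr_ge0 ?pi_ge0 ?(le_trans s0).
have /andP[p0 p1] := poisson_term_itv k c0; rewrite /radial_density.
have /andP[q0 q1] : 0 <= expR (- (pi * c)) * (k%:R * (pi * c) ^+ k.-1 / k`!%:R) <= 1.
  case: k {dr p0 p1} => [|k]; first by rewrite !mul0r mulr0 lexx ler01.
  rewrite /= (_ : k.+1%:R * _ / _ = (pi * c) ^+ k / k`!%:R) ?poisson_term_itv//.
  by rewrite factS natrM; field; rewrite fact_neq0/= nat1r pnatr_eq0.
by rewrite ler_norml; apply/andP; split; lra.
Qed.

Lemma measurable_radial_density k : measurable_fun [set: T] (radial_density k : T -> T).
Proof.
apply: measurable_funM.
  by apply: measurableT_comp => //; apply: measurableT_comp => //; exact: measurable_funM.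
apply: measurable_funM; last exact: measurable_cst.
by apply: measurable_funX; exact: measurable_funM.
Qed.

Lemma Rintegral_radial_density k a b : 0 <= a -> a <= b ->
  Rintegral mu2 (annulus a b) (fun z => radial_density k (sqnorm z)) =
  gamma_cdf k (pi * b) - gamma_cdf k (pi * a).
Proof.
move=> a0 ab.
have p0 : pi != 0 :> R by rewrite gt_eqF// pi_gt0.
have d s : is_derive s 1 (fun s => pi^-1 * gamma_cdf k (pi * s)) (radial_density k s).
  apply: (is_derive_ext (is_derive_scale pi^-1
    (is_derive_compose (is_derive_gamma_cdf k (pi * s)) (is_derive_scale pi (is_derive_var s))))) => //.
  by rewrite mulr1 mulrCA mulVf// mulr1.
have := @Rintegral_annulus _ _ pi a b a0 ab (measurable_radial_density k) (fun s _ => d s).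
rewrite mulrBr !mulrA divff// !mul1r; apply.
by move=> s t /andP[as_ _] /andP[at_ _]; apply: radial_density_lipschitz; rewrite (le_trans a0).
Qed.

End radial_integral.

Local Notation Re := (@complex.Re _).
Local Notation Im := (@complex.Im _).
Local Notation normc := (@ComplexField.Normc.normc _).

(** * Complex exponentials and generating functions *)

Section complex_numbers.
Context {R : realType}.
Implicit Types (x y z : R[i]) (a b : R).

Lemma ReM x y : Re (x * y) = Re x * Re y - Im x * Im y.
Proof. by case: x y => [? ?] [? ?]. Qed.

Lemma ImM x y : Im (x * y) = Re x * Im y + Im x * Re y.
Proof. by case: x y => [? ?] [? ?]. Qed.

Lemma ReD x y : Re (x + y) = Re x + Re y.
Proof. by case: x y => [? ?] [? ?]. Qed.

Lemma ImD x y : Im (x + y) = Im x + Im y.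
Proof. by case: x y => [? ?] [? ?]. Qed.

Lemma ReN x : Re (- x) = - Re x. Proof. by case: x. Qed.

Lemma ImN x : Im (- x) = - Im x. Proof. by case: x. Qed.

Lemma complexP x y : Re x = Re y -> Im x = Im y -> x = y.
Proof. by case: x y => [? ?] [? ?] /= -> ->. Qed.

Lemma normc_ge0 x : 0 <= normc x.
Proof. by case: x => a b; exact: sqrtr_ge0. Qed.

Lemma sqr_normcE x : normc x ^+ 2 = Re x ^+ 2 + Im x ^+ 2.
Proof. by case: x => a b; rewrite sqr_sqrtr// addr_ge0 ?sqr_ge0. Qed.

Lemma Re_le_normc x : `|Re x| <= normc x.
Proof.
by case: x => a b /=; rewrite -sqrtr_sqr ler_wsqrtr// lerDl sqr_ge0.
Qed.

Lemma Im_le_normc x : `|Im x| <= normc x.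
Proof.
by case: x => a b /=; rewrite -sqrtr_sqr ler_wsqrtr// lerDr sqr_ge0.
Qed.

Lemma normc_le_ReIm x : normc x <= `|Re x| + `|Im x|.
Proof.
rewrite -(@ler_pXn2r _ 2%N) ?nnegrE ?normc_ge0 ?addr_ge0// sqr_normcE.
rewrite sqrrD !real_normK ?num_real// lerD2r lerDl mulrn_wge0// mulr_ge0//.
Qed.

Lemma normc_real a : normc (a%:C)%C = `|a|.
Proof. by rewrite /= expr0n /= addr0 sqrtr_sqr. Qed.

Lemma normcX x n : normc (x ^+ n) = normc x ^+ n.
Proof.
elim: n => [|n IH]; first by rewrite !expr0 ComplexField.Normc.normc1.
by rewrite !exprS ComplexField.Normc.normcM IH.
Qed.

Lemma normc_conj x : normc (conjc x) = normc x.
Proof. by case: x => a b /=; rewrite sqrrN. Qed.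

Lemma normcB_le x y : normc (x - y) <= normc x + normc y.
Proof. by rewrite -(normcN y); exact: le_normcD. Qed.

Lemma normc_sum_le (I : Type) (r : seq I) (F : I -> R[i]) :
  normc (\sum_(i <- r) F i) <= \sum_(i <- r) normc (F i).
Proof.
elim/big_rec2: _ => [|i a x _ h]; first by rewrite ComplexField.Normc.normc0.
by rewrite (le_trans (le_normcD _ _))// lerD2l.
Qed.

Lemma cisD a b : cis (a + b) = cis a * cis b.
Proof.
by apply: complexP; rewrite ?ReM ?ImM /= ?cosD ?sinD; [|rewrite addrC].
Qed.

Lemma cis0 : cis 0 = 1 :> R[i].
Proof. by rewrite /cis cos0 sin0. Qed.

Lemma cisX a n : cis a ^+ n = cis (n%:R * a).
Proof.
elim: n => [|n IH]; first by rewrite expr0 mul0r cis0.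
by rewrite exprS IH -cisD -nat1r mulrDl mul1r.
Qed.

Lemma normc_cis a : normc (cis a) = 1.
Proof. by rewrite /= cos2Dsin2 sqrtr1. Qed.

Lemma conjc_cis a : conjc (cis a) = cis (- a).
Proof. by rewrite /cis cosN sinN. Qed.

Definition cexp z : R[i] := (expR (Re z))%:C%C * cis (Im z).

Lemma cexpD x y : cexp (x + y) = cexp x * cexp y.
Proof. by rewrite /cexp ReD ImD expRD cisD rmorphM; ring. Qed.

Lemma cexp0 : cexp 0 = 1.
Proof. by rewrite /cexp /= expR0 cis0 mulr1. Qed.

Lemma cexpN x : cexp (- x) * cexp x = 1.
Proof. by rewrite -cexpD addNr cexp0. Qed.

Lemma normc_cexp x : normc (cexp x) = expR (Re x).
Proof. by rewrite ComplexField.Normc.normcM normc_cis mulr1 normc_real gtr0_norm ?expR_gt0. Qed.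

Definition is_cderive (f : R -> R[i]) (s : R) (d : R[i]) : Prop :=
  is_derive s 1 (fun u => Re (f u)) (Re d) /\ is_derive s 1 (fun u => Im (f u)) (Im d).

Lemma is_cderive_ext f g s d e : is_cderive f s d -> (forall u, f u = g u) -> d = e ->
  is_cderive g s e.
Proof. by move=> fd fg <-; rewrite (_ : g = f)//; apply/funext. Qed.

Lemma is_cderive_const c s : is_cderive (fun=> c) s 0.
Proof. by split; exact: is_derive_const. Qed.

Lemma is_cderive_add f g s d e : is_cderive f s d -> is_cderive g s e ->
  is_cderive (fun u => f u + g u) s (d + e).
Proof.
move=> [f1 f2] [g1 g2]; split.
  by apply: (is_derive_ext (is_derive_add f1 g1)) => [u|]; rewrite ReD.
by apply: (is_derive_ext (is_derive_add f2 g2)) => [u|]; rewrite ImD.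
Qed.

Lemma is_cderive_mul f g s d e : is_cderive f s d -> is_cderive g s e ->
  is_cderive (fun u => f u * g u) s (d * g s + f s * e).
Proof.
move=> [f1 f2] [g1 g2]; split.
  apply: (is_derive_ext (is_derive_sub (is_derive_mul f1 g1) (is_derive_mul f2 g2))) => [u|].
    by rewrite ReM.
  by rewrite ReD !ReM; ring.
apply: (is_derive_ext (is_derive_add (is_derive_mul f1 g2) (is_derive_mul f2 g1))) => [u|].
  by rewrite ImM.
by rewrite ImD !ImM; ring.
Qed.

Lemma is_cderive_real (f : R -> R) (s d : R) : is_derive s 1 f d ->
  is_cderive (fun u => (f u)%:C%C) s (d%:C)%C.
Proof. by move=> fd; split => //=; exact: is_derive_const. Qed.

Lemma is_cderive_cexp f s d : is_cderive f s d ->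
  is_cderive (fun u => cexp (f u)) s (cexp (f s) * d).
Proof.
move=> [f1 f2].
have e := is_cderive_real (is_derive_exp f1).
have c : is_cderive (fun u => cis (Im (f u))) s (cis (Im (f s)) * Complex 0 (Im d)).
  split; rewrite ?ReM ?ImM /= ?mulr0 ?sub0r ?addr0 -?mulNr.
    exact: (is_derive_compose (is_derive_cos (Im (f s))) f2).
  exact: (is_derive_compose (is_derive_sin (Im (f s))) f2).
apply: (is_cderive_ext (is_cderive_mul e c)) => //.
by rewrite /cexp; apply: complexP; rewrite !(ReD, ImD, ReM, ImM) /=; ring.
Qed.

(* The mean value inequality, applied to the two components separately. *)
Lemma cmean_value (f df : R -> R[i]) (M : R) : (forall s : R, 0 <= s <= 1 -> is_cderive f s (df s)) ->
  (forall s : R, 0 <= s <= 1 -> normc (df s) <= M) -> normc (f 1 - f 0) <= 2 * M.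
Proof.
move=> fd fM; have h (g dg : R -> R) : (forall s : R, 0 <= s <= 1 -> is_derive s 1 g (dg s)) ->
    (forall s : R, 0 <= s <= 1 -> `|dg s| <= M) -> `|g 1 - g 0| <= M.
  move=> gd gM; have [c cI ->] := mean_value ler01 gd.
  by rewrite subr0 mulr1 gM.
rewrite (le_trans (normc_le_ReIm _))// mulr_natl mulr2n lerD//.
  rewrite ReD ReN; apply: (h (fun s => Re (f s)) (fun s => Re (df s))) => s sI.
    by have [] := fd s sI.
  by rewrite (le_trans (Re_le_normc _))// fM.
rewrite ImD ImN; apply: (h (fun s => Im (f s)) (fun s => Im (df s))) => s sI.
  by have [] := fd s sI.
by rewrite (le_trans (Im_le_normc _))// fM.
Qed.

End complex_numbers.

(** * Truncated generating functions *)

Section generating_function.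

(* [(c_n, c_(n-1))] for the Taylor coefficients [c_n] of [exp (a s + b s^2 / 2)],
   where [c_(-1) = 0]. *)
Fixpoint gen_pair (K : fieldType) (a b : K) (n : nat) : K * K :=
  if n is m.+1 then
    let c := gen_pair a b m in ((a * c.1 + b * c.2) / m.+1%:R, c.1)
  else (1, 0).

Definition gen_coef (K : fieldType) (a b : K) n := (gen_pair a b n).1.
Definition gen_prev (K : fieldType) (a b : K) n := (gen_pair a b n).2.

Lemma gen_coef0 (K : fieldType) (a b : K) : gen_coef a b 0 = 1. Proof. by []. Qed.

Lemma gen_prevS (K : fieldType) (a b : K) n : gen_prev a b n.+1 = gen_coef a b n.
Proof. by []. Qed.

Lemma gen_coefS (K : numFieldType) (a b : K) n :
  n.+1%:R * gen_coef a b n.+1 = a * gen_coef a b n + b * gen_prev a b n.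
Proof. by rewrite {1}/gen_coef /= mulrC divfK// pnatr_eq0. Qed.

Lemma gen_coef_scale (K : fieldType) (a b z : K) n :
  gen_coef (a * z) (b * z ^+ 2) n = gen_coef a b n * z ^+ n.
Proof.
suff [] : gen_coef (a * z) (b * z ^+ 2) n = gen_coef a b n * z ^+ n /\
  z * gen_prev (a * z) (b * z ^+ 2) n = gen_prev a b n * z ^+ n by [].
elim: n => [|n [IH1 IH2]]; first by rewrite /gen_coef /gen_prev /= expr0 mulr1 mulr0 mul0r.
rewrite !gen_prevS IH1 [z ^+ n.+1]exprS; split; last by ring.
rewrite /gen_coef /= -!/(gen_coef _ _ _) -!/(gen_prev _ _ _) IH1.
rewrite (_ : b * z ^+ 2 * _ = b * z * (z * gen_prev (a * z) (b * z ^+ 2) n)); last by ring.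
by rewrite IH2; ring.
Qed.

Lemma gen_coef_morph (K L : fieldType) (f : {rmorphism K -> L}) (a b : K) n :
  gen_coef (f a) (f b) n = f (gen_coef a b n).
Proof.
suff : gen_pair (f a) (f b) n = (f (gen_coef a b n), f (gen_prev a b n)) by move=> E; rewrite {1}/gen_coef E.
elim: n => [|n IH]; first by rewrite /= /gen_coef /gen_prev /= rmorph1 rmorph0.
by rewrite /= IH /gen_coef /gen_prev /= fmorph_div rmorphD !rmorphM rmorph_nat.
Qed.

Context {R : realType}.
Implicit Types (al be : R[i]) (a b s r : R).

Lemma gen_pair_ge0 a b n : 0 <= a -> 0 <= b ->
  0 <= gen_coef a b n /\ 0 <= gen_prev a b n.
Proof.
move=> a0 b0; elim: n => [|n [IH1 IH2]]; first by split.
split; last by rewrite gen_prevS.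
by rewrite /gen_coef /= divr_ge0// addr_ge0// mulr_ge0.
Qed.

Lemma gen_pair_normc al be n :
  normc (gen_coef al be n) <= gen_coef (normc al) (normc be) n /\
  normc (gen_prev al be n) <= gen_prev (normc al) (normc be) n.
Proof.
elim: n => [|n [IH1 IH2]].
  by rewrite /gen_coef /gen_prev /= !(expr0n, expr1n, addr0, sqrtr1, sqrtr0).
split; last by rewrite !gen_prevS.
rewrite /gen_coef /= ComplexField.Normc.normcM ComplexField.Normc.normcV.
have -> : normc (n.+1%:R : R[i]) = n.+1%:R.
  by rewrite -[n.+1%:R in LHS](rmorph_nat (real_complex R)) normc_real ger0_norm.
rewrite ler_wpM2r ?invr_ge0// (le_trans (le_normcD _ _))// !ComplexField.Normc.normcM.
by rewrite lerD// ler_wpM2l ?normc_ge0.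
Qed.

(** By the recurrence, the partial sum solves [f' = (a + b * s) * f] up to the boundary terms left
    by the truncation. *)
Lemma is_derive_gen_sum a b N s :
  is_derive s 1 (fun u => \sum_(k < N) gen_coef a b k * u ^+ k)
    ((a + b * s) * (\sum_(k < N) gen_coef a b k * s ^+ k)
     - (N%:R * gen_coef a b N * s ^+ N.-1 + b * gen_prev a b N * s ^+ N)).
Proof.
elim: N => [|N IH].
  apply: (is_derive_ext (is_derive_const s 0)) => [u|]; rewrite !big_ord0//.
  by rewrite mulr0 !mul0r mulr0 mul0r addr0 subr0.
apply: (is_derive_ext (is_derive_add IH (is_derive_scale (gen_coef a b N) (is_derive_pow N (is_derive_var s))))).
  by move=> u; rewrite big_ord_recr.
rewrite big_ord_recr gen_coefS gen_prevS mulr1 /= [s ^+ N.+1]exprS.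
by ring.
Qed.

(** Divided by [exp (a * s + b * s ^ 2 / 2)], the partial sum decreases from its value 1 at [s = 0],
    the boundary terms being nonnegative. So the partial sum, and each of its terms, is at most the
    exponential. *)
Lemma gen_coef_bound a b r k : 0 <= a -> 0 <= b -> 0 < r ->
  gen_coef a b k * r ^+ k <= expR (a * r + b * r ^+ 2 / 2).
Proof.
move=> a0 b0 r0.
pose W s := (\sum_(j < k.+1) gen_coef a b j * s ^+ j) * expR (- (a * s + b / 2 * s ^+ 2)).
have dW (s : R) : is_derive s 1 (fun s => - W s) (expR (- (a * s + b / 2 * s ^+ 2)) *
    (k.+1%:R * gen_coef a b k.+1 * s ^+ k + b * gen_coef a b k * s ^+ k.+1)).
  apply: (is_derive_ext (is_derive_opp (is_derive_mul (is_derive_gen_sum a b k.+1 s) (is_derive_exp (is_derive_opp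
    (is_derive_add (is_derive_scale a (is_derive_var s)) (is_derive_scale (b / 2) (is_derive_pow 2 (is_derive_var s))))))))) => //.
  by rewrite /= gen_prevS expr1; field.
have : - W 0 <= - W r.
  apply: (derive_ge0_homo (ltW r0) (fun s _ => dW s)) => s /andP[s0 _].
  have [c0 _] := gen_pair_ge0 k.+1 a0 b0; have [c1 _] := gen_pair_ge0 k a0 b0.
  have e0 := exprn_ge0 k s0; have e1 := exprn_ge0 k.+1 s0.
  move: (gen_coef a b k.+1) (gen_coef a b k) (s ^+ k) (s ^+ k.+1) c0 c1 e0 e1 => p q u w p0 q0 u0 w0.
  by rewrite mulr_ge0 ?expR_ge0// addr_ge0// mulr_ge0// mulr_ge0.
rewrite lerN2 /W expr0n /= !mulr0 addr0 oppr0 expR0 mulr1.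
have -> : \sum_(j < k.+1) gen_coef a b j * 0 ^+ j = 1.
  by rewrite big_ord_recl big1 ?addr0 ?expr0 ?mulr1// => i _; rewrite lift0 expr0n mulr0.
rewrite expRN ler_pdivrMr ?expR_gt0// mul1r => h.
rewrite (_ : b * r ^+ 2 / 2 = b / 2 * r ^+ 2); last by ring.
apply: le_trans h; rewrite big_ord_recr /= lerDr sumr_ge0// => i _.
have [c0 _] := gen_pair_ge0 i a0 b0.
by rewrite mulr_ge0// exprn_ge0// ltW.
Qed.

Lemma is_cderive_gen_sum al be N s :
  is_cderive (fun u => \sum_(k < N) gen_coef al be k * (u%:C)%C ^+ k) s
    ((al + be * (s%:C)%C) * (\sum_(k < N) gen_coef al be k * (s%:C)%C ^+ k)
     - (N%:R * gen_coef al be N * (s%:C)%C ^+ N.-1 + be * gen_prev al be N * (s%:C)%C ^+ N)).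
Proof.
elim: N => [|N IH].
  apply: (is_cderive_ext (is_cderive_const 0 s)) => [u|]; rewrite !big_ord0//.
  by rewrite mulr0 !mul0r mulr0 mul0r addr0 subr0.
apply: (is_cderive_ext (is_cderive_add IH (is_cderive_mul (is_cderive_const (gen_coef al be N) s)
   (is_cderive_real (is_derive_pow N (is_derive_var s)))))).
  by move=> u; rewrite big_ord_recr /= rmorphXn.
rewrite big_ord_recr gen_coefS gen_prevS mulr1 /= [_ ^+ N.+1]exprS mul0r add0r.
have -> : ((N%:R * s ^+ N.-1)%:C)%C = N%:R * (s%:C)%C ^+ N.-1 by rewrite rmorphM rmorphXn rmorph_nat.
by ring.
Qed.

(** Divided by the full exponential, the partial sum [W] has a derivative made of the boundary terms
    only. By [gen_coef_bound] at radius 4 they are of size [N * 4 ^- N], hence at most a multiple of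
    [2 ^- N]; integrating from 0 to 1 gives the remainder. *)
Lemma gen_sum_remainder al be N :
  normc (cexp (al + be / 2) - \sum_(k < N) gen_coef al be k) <=
  2^-1 ^+ N * (2 * (1 + 4 * normc be) * expR (6 * normc al + 9 * normc be)).
Proof.
set a := normc al; set b := normc be.
have a0 : 0 <= a by exact: normc_ge0. have b0 : 0 <= b by exact: normc_ge0.
pose v (s : R) : R[i] := - (al * (s%:C)%C + be / 2 * (s%:C)%C ^+ 2).
pose W s := (\sum_(k < N) gen_coef al be k * (s%:C)%C ^+ k) * cexp (v s).
pose Y s := N%:R * gen_coef al be N * (s%:C)%C ^+ N.-1 + be * gen_prev al be N * (s%:C)%C ^+ N.
have dv s : is_cderive v s (- (al + be * (s%:C)%C)).
  apply: (is_cderive_ext (is_cderive_add (is_cderive_mul (is_cderive_const (- al) s) (is_cderive_real (is_derive_var s)))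
    (is_cderive_mul (is_cderive_const (- (be / 2)) s) (is_cderive_real (is_derive_pow 2 (is_derive_var s)))))).
    by move=> u; rewrite /v /= rmorphXn; ring.
  rewrite /= expr1 mulr1; have -> : ((2 * s)%:C)%C = 2 * (s%:C)%C by rewrite rmorphM rmorph_nat.
  by rewrite rmorph1; field.
have dW s : is_cderive W s (- (Y s * cexp (v s))).
  apply: (is_cderive_ext (is_cderive_mul (is_cderive_gen_sum al be N s) (is_cderive_cexp (dv s)))) => //.
  by rewrite /Y; ring.
have nv s : 0 <= s <= 1 -> `|Re (v s)| <= a + b / 2.
  move=> /andP[s0 s1]; rewrite (le_trans (Re_le_normc _))// /v normcN (le_trans (le_normcD _ _))//.
  rewrite ComplexField.Normc.normcM [normc (be / 2 * _)]ComplexField.Normc.normcM normcX normc_real ger0_norm//.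
  rewrite [normc (be / 2)]ComplexField.Normc.normcM -/a -/b.
  have -> : normc (2^-1 : R[i]) = 2^-1.
    rewrite ComplexField.Normc.normcV; congr (_^-1).
    by rewrite -[2 in LHS](rmorph_nat (real_complex R)) normc_real ger0_norm.
  rewrite lerD// ?ler_piMr ?divr_ge0 ?expr_le1//.
have fourN : (0 : R) < 4 ^+ N by rewrite exprn_gt0.
have YM s : 0 <= s <= 1 -> normc (Y s) <= 2^-1 ^+ N * ((1 + 4 * b) * expR (4 * a + 8 * b)).
  move=> /andP[s0 s1]; rewrite /Y (le_trans (le_normcD _ _))//.
  rewrite !ComplexField.Normc.normcM !normcX normc_real ger0_norm// -/b.
  have -> : normc (N%:R : R[i]) = N%:R.
    by rewrite -[N%:R in LHS](rmorph_nat (real_complex R)) normc_real ger0_norm.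
  have [g1 g2] := gen_pair_normc al be N; rewrite -/a -/b in g1 g2.
  have cb k : gen_coef a b k <= 4^-1 ^+ k * expR (4 * a + 8 * b).
    have := @gen_coef_bound a b 4 k a0 b0 (ltr0Sn _ _).
    rewrite (_ : a * 4 + b * 4 ^+ 2 / 2 = 4 * a + 8 * b); last by field.
    by rewrite -ler_pdivlMr ?exprn_gt0// mulrC exprVn.
  have e0 : 0 <= expR (4 * a + 8 * b) by exact: expR_ge0.
  have pb : gen_prev a b N <= 4 * (4^-1 ^+ N * expR (4 * a + 8 * b)).
    case: N {W Y dW fourN g1 g2} => [|n]; first by rewrite expr0 mul1r mulr_ge0.
    by rewrite gen_prevS exprS !mulrA divff// mul1r cb.
  have h1 : (N%:R : R) * 4^-1 ^+ N <= 2^-1 ^+ N.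
    rewrite (_ : 4^-1 = 2^-1 * 2^-1); last by field.
    rewrite exprMn mulrA ler_piMl ?exprn_ge0 ?invr_ge0// exprVn ler_pdivrMr ?exprn_gt0// mul1r.
    by rewrite -natrX ler_nat ltnW// ltn_expl.
  have h2 : 4^-1 ^+ N <= 2^-1 ^+ N :> R.
    by rewrite lerXn2r ?nnegrE ?invr_ge0// lef_pV2 ?posrE// ler_nat.
  rewrite mulrDl mulrDr; apply: lerD.
    apply: (@le_trans _ _ (N%:R * (4^-1 ^+ N * expR (4 * a + 8 * b)) * 1)).
      apply: ler_pM; rewrite ?mulr_ge0 ?normc_ge0 ?exprn_ge0 ?exprn_ile1//.
      by rewrite ler_wpM2l// (le_trans g1).
    by rewrite mulr1 mul1r mulrA ler_wpM2r.
  apply: (@le_trans _ _ (b * (4 * (4^-1 ^+ N * expR (4 * a + 8 * b))) * 1)).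
    apply: ler_pM; rewrite ?mulr_ge0 ?normc_ge0 ?exprn_ge0 ?exprn_ile1//.
    by rewrite ler_wpM2l// (le_trans g2).
  rewrite mulr1 (_ : b * _ = 4^-1 ^+ N * (4 * b * expR (4 * a + 8 * b))); last by ring.
  by rewrite ler_wpM2r ?mulr_ge0.
set c := al + be / 2.
have v1 : v 1 = - c by rewrite /v /c rmorph1 expr1n !mulr1.
have ec : expR (Re c) <= expR (a + b / 2).
  rewrite ler_expR -(opprK c) -v1 ReN (le_trans (ler_norm _))// normrN nv// ler01 lexx//.
have [N0|N0] := posnP N.
  rewrite N0 big_ord0 subr0 normc_cexp expr0 mul1r (le_trans ec)//.
  rewrite -[leLHS]mul1r ler_pM ?expR_ge0//; last by rewrite ler_expR; lra.
  by rewrite -[leLHS]mulr1 ler_pM ?ler1n// lerDl mulr_ge0.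
have W0 : W 0 = 1.
  rewrite /W -(prednK N0) big_ord_recl big1 => [|i _]; last by rewrite lift0 rmorph0 expr0n mulr0.
  by rewrite addr0 expr0 mulr1 /v rmorph0 expr0n /= !mulr0 addr0 oppr0 cexp0 mulr1.
have W1 : W 1 = (\sum_(k < N) gen_coef al be k) * cexp (- c).
  by rewrite /W v1; congr (_ * _); apply: eq_bigr => i _; rewrite rmorph1 expr1n mulr1.
have -> : cexp c - \sum_(k < N) gen_coef al be k = - (cexp c * (W 1 - W 0)).
  by rewrite W0 W1 mulrBr mulr1 mulrCA (mulrC (cexp c)) cexpN mulr1 opprB.
rewrite normcN ComplexField.Normc.normcM normc_cexp.
have MV : normc (W 1 - W 0) <= 2 * (2^-1 ^+ N * ((1 + 4 * b) * expR (4 * a + 8 * b)) * expR (a + b / 2)).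
  apply: (cmean_value (fun s _ => dW s)) => s sI.
  rewrite normcN ComplexField.Normc.normcM normc_cexp ler_pM ?normc_ge0 ?expR_ge0 ?YM//.
  by rewrite ler_expR (le_trans (ler_norm _))// nv.
apply: (@le_trans _ _ (expR (a + b / 2) * (2 * (2^-1 ^+ N * ((1 + 4 * b) * expR (4 * a + 8 * b)) * expR (a + b / 2))))).
  by rewrite ler_pM ?expR_ge0 ?normc_ge0.
(* One factor [exp (a + b / 2)] undoes the division by the exponential, the other bounds it along
   the path, and [4 * a + 8 * b] is the exponent at radius 4. *)
have -> : expR (6 * a + 9 * b) = expR (a + b / 2) * expR (a + b / 2) * expR (4 * a + 8 * b).
  by rewrite -!expRD; congr expR; field.
by rewrite le_eqVlt; apply/orP; left; apply/eqP; ring.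
Qed.

End generating_function.

(** * Complex integrals and the inner product *)

Section complex_integral.
Context {R : realType} (d : measure_display) (T : measurableType d).
Variables (mu : {measure set T -> \bar R}) (D : set T).
Hypothesis mD : measurable D.
Implicit Types (f g : T -> R[i]) (c : R[i]) (G : T -> R).

Definition cmeasurable f : Prop :=
  measurable_fun D (fun t => Re (f t)) /\ measurable_fun D (fun t => Im (f t)).

Definition cintegrable f : Prop :=
  mu.-integrable D (EFin \o (fun t => Re (f t))) /\
  mu.-integrable D (EFin \o (fun t => Im (f t))).

Lemma cmeasurable_eq f g : f =1 g -> cmeasurable f -> cmeasurable g.
Proof. by move=> fg; rewrite (_ : f = g)//; apply/funext. Qed.

Lemma cmeasurable_cst c : cmeasurable (fun=> c).
Proof. by split; exact: measurable_cst. Qed.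

Lemma cmeasurable_real G : measurable_fun D G -> cmeasurable (fun t => (G t)%:C%C).
Proof. by move=> mG; split => //=; exact: measurable_cst. Qed.

Lemma cmeasurableD f g : cmeasurable f -> cmeasurable g -> cmeasurable (fun t => f t + g t).
Proof.
move=> [f1 f2] [g1 g2]; split.
  by under eq_fun do rewrite ReD; exact: measurable_funD.
by under eq_fun do rewrite ImD; exact: measurable_funD.
Qed.

Lemma cmeasurableM f g : cmeasurable f -> cmeasurable g -> cmeasurable (fun t => f t * g t).
Proof.
move=> [f1 f2] [g1 g2]; split.
  by under eq_fun do rewrite ReM; apply: measurable_funB; exact: measurable_funM.
by under eq_fun do rewrite ImM; apply: measurable_funD; exact: measurable_funM.
Qed.

Lemma cmeasurable_conj f : cmeasurable f -> cmeasurable (fun t => conjc (f t)).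
Proof.
move=> [f1 f2]; split.
  by rewrite (_ : (fun _ => _) = (fun t => Re (f t)))//; apply/funext => t; case: (f t).
rewrite (_ : (fun _ => _) = (fun t => - Im (f t))); last by apply/funext => t; case: (f t).
exact: measurable_funN.
Qed.

Lemma cmeasurableX f n : cmeasurable f -> cmeasurable (fun t => f t ^+ n).
Proof.
move=> mf; elim: n => [|n IH].
  by apply: cmeasurable_eq (cmeasurable_cst 1) => t; rewrite expr0.
by apply: cmeasurable_eq (cmeasurableM mf IH) => t; rewrite exprS.
Qed.

Lemma cmeasurable_sum n (F : 'I_n -> T -> R[i]) : (forall i, cmeasurable (F i)) ->
  cmeasurable (fun t => \sum_(i < n) F i t).
Proof.
elim: n F => [|n IH] F mF.
  by apply: cmeasurable_eq (cmeasurable_cst 0) => t; rewrite big_ord0.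
by apply: cmeasurable_eq (cmeasurableD (mF ord0) (IH _ (fun i => mF (lift ord0 i)))) => t;
  rewrite big_ord_recl.
Qed.

Lemma measurable_normc f : cmeasurable f -> measurable_fun D (fun t => normc (f t)).
Proof.
move=> [f1 f2].
rewrite (_ : (fun _ => _) = (fun t => Num.sqrt (Re (f t) ^+ 2 + Im (f t) ^+ 2))); last first.
  by apply/funext => t; case: (f t).
apply: (measurableT_comp (continuous_measurable_fun (@sqrt_continuous R))).
by apply: measurable_funD; exact: measurable_funX.
Qed.

Lemma cintegrable_measurable f : cintegrable f -> cmeasurable f.
Proof.
by move=> [/integrableP[/measurable_EFinP f1 _] /integrableP[/measurable_EFinP f2 _]]; split.
Qed.

Lemma integrable_le (f : T -> R) G : measurable_fun D f -> mu.-integrable D (EFin \o G) ->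
  (forall t, D t -> `|f t| <= G t) -> mu.-integrable D (EFin \o f).
Proof.
move=> mf iG fG; apply: (le_integrable mD _ _ iG); first exact/measurable_EFinP.
by move=> t Dt /=; rewrite lee_fin (le_trans (fG t Dt))// ler_norm.
Qed.

Lemma cintegrable_le f G : cmeasurable f -> mu.-integrable D (EFin \o G) ->
  (forall t, D t -> normc (f t) <= G t) -> cintegrable f.
Proof.
move=> [f1 f2] iG fG; split; apply: (integrable_le _ iG) => // t Dt.
  by rewrite (le_trans (Re_le_normc _))// fG.
by rewrite (le_trans (Im_le_normc _))// fG.
Qed.

Lemma cintegrableD f g : cintegrable f -> cintegrable g -> cintegrable (fun t => f t + g t).
Proof.
move=> [f1 f2] [g1 g2]; split.
  have := integrableD mD f1 g1; apply: eq_integrable => // t _.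
  by rewrite /= ReD.
have := integrableD mD f2 g2; apply: eq_integrable => // t _.
by rewrite /= ImD.
Qed.

Lemma cintegrableZl c f : cintegrable f -> cintegrable (fun t => c * f t).
Proof.
move=> [f1 f2]; split.
  have := integrableB mD (integrableZl mD (Re c) f1) (integrableZl mD (Im c) f2).
  by apply: eq_integrable => // t _; rewrite /= ReM EFinB !EFinM.
have := integrableD mD (integrableZl mD (Re c) f2) (integrableZl mD (Im c) f1).
by apply: eq_integrable => // t _; rewrite /= ImM EFinD !EFinM.
Qed.

Lemma cintegrable0 : cintegrable (fun=> 0).
Proof. by split; exact: integrable0. Qed.

Lemma cintegrable_eq f g : f =1 g -> cintegrable f -> cintegrable g.
Proof. by move=> fg; rewrite (_ : f = g)//; apply/funext. Qed.

Lemma cintegrable_sum n (F : 'I_n -> T -> R[i]) : (forall i, cintegrable (F i)) ->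
  cintegrable (fun t => \sum_(i < n) F i t).
Proof.
elim: n F => [|n IH] F mF.
  by apply: cintegrable_eq cintegrable0 => t; rewrite big_ord0.
by apply: cintegrable_eq (cintegrableD (mF ord0) (IH _ (fun i => mF (lift ord0 i)))) => t;
  rewrite big_ord_recl.
Qed.

Lemma eq_cintegral f g : (forall t, D t -> f t = g t) -> cintegral mu D f = cintegral mu D g.
Proof.
move=> fg; rewrite /cintegral; congr Complex; apply: eq_Rintegral => t; rewrite inE => Dt;
  by rewrite fg.
Qed.

Lemma cintegralD f g : cintegrable f -> cintegrable g ->
  cintegral mu D (fun t => f t + g t) = cintegral mu D f + cintegral mu D g.
Proof.
move=> [f1 f2] [g1 g2]; apply: complexP; rewrite ?ReD ?ImD /= -RintegralD//;
  by apply: eq_Rintegral => t _; rewrite ?ReD ?ImD.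
Qed.

Lemma cintegralZl c f : cintegrable f ->
  cintegral mu D (fun t => c * f t) = c * cintegral mu D f.
Proof.
move=> [f1 f2].
have Z1 k := integrableZl mD k f1. have Z2 k := integrableZl mD k f2.
apply: complexP.
  rewrite ReM /= -!RintegralZl// -RintegralB//; [|exact: Z1|exact: Z2].
  by apply: eq_Rintegral => t _; rewrite ReM.
rewrite ImM /= -!RintegralZl// -RintegralD//; [|exact: Z2|exact: Z1].
by apply: eq_Rintegral => t _; rewrite ImM.
Qed.

Lemma cintegral0 : cintegral mu D (fun=> 0) = 0.
Proof. by apply: complexP; rewrite /= /Rintegral integral0. Qed.

Lemma cintegral_sum n (F : 'I_n -> T -> R[i]) : (forall i, cintegrable (F i)) ->
  cintegral mu D (fun t => \sum_(i < n) F i t) = \sum_(i < n) cintegral mu D (F i).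
Proof.
elim: n F => [|n IH] F iF.
  by rewrite [RHS]big_ord0 -[RHS]cintegral0; apply: eq_cintegral => t _; rewrite big_ord0.
rewrite big_ord_recl -IH//; rewrite -cintegralD//; last by apply: cintegrable_sum.
by apply: eq_cintegral => t _; rewrite big_ord_recl.
Qed.

Lemma cintegral_conj f : cintegrable f ->
  cintegral mu D (fun t => conjc (f t)) = conjc (cintegral mu D f).
Proof.
move=> [f1 f2]; apply: complexP => /=.
  by apply: eq_Rintegral => t _; case: (f t).
rewrite -[RHS]mulN1r -RintegralZl//; apply: eq_Rintegral => t _.
by rewrite mulN1r; case: (f t).
Qed.

(** The factor 2 comes from bounding the real and the imaginary parts separately. *)
Lemma normc_cintegral_le f G : cmeasurable f -> mu.-integrable D (EFin \o G) ->
  (forall t, D t -> normc (f t) <= G t) ->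
  normc (cintegral mu D f) <= 2 * Rintegral mu D G.
Proof.
move=> mf iG fG; have [f1 f2] := cintegrable_le mf iG fG.
rewrite (le_trans (normc_le_ReIm _))// mulr_natl mulr2n lerD//=.
  rewrite (le_trans (le_normr_Rintegral _ _))//; apply: le_Rintegral => //.
    exact: (integrable_norm f1).
  by move=> t Dt; rewrite (le_trans (Re_le_normc _))// fG.
rewrite (le_trans (le_normr_Rintegral _ _))//; apply: le_Rintegral => //.
  exact: (integrable_norm f2).
by move=> t Dt; rewrite (le_trans (Im_le_normc _))// fG.
Qed.

End complex_integral.

Section inner_product.
Context {R : realType}.
Local Notation T := (measurableTypeR R).
Local Notation mu := (@lebesgue_measure R).
Implicit Types (f g h : R -> R[i]) (c : R[i]) (G : R -> R).
Local Notation cmeas := (@cmeasurable R _ T setT).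
Local Notation cint := (@cintegrable R _ T mu setT).

Lemma L2P f : L2 f <-> cmeas f /\ mu.-integrable setT (EFin \o (fun t => normc (f t) ^+ 2)).
Proof.
split=> [[f1 f2 i]|[[f1 f2] /integrableP[m i]]].
  have mf : cmeas f by split.
  split=> //; apply/integrableP; split.
    by apply/measurable_EFinP; apply: measurable_funX; exact: measurable_normc.
  apply: le_lt_trans i; apply: ge0_le_integral => //.
  - by apply: measurableT_comp => //; apply/measurable_EFinP; apply: measurable_funX; exact: measurable_normc.
  - by apply/measurable_EFinP; apply: measurable_funX; exact: measurable_normc.
  - by move=> t _; rewrite /= ger0_norm ?sqr_ge0.
split=> //; apply: le_lt_trans i; apply: ge0_le_integral => //.
- by move=> t _; rewrite lee_fin sqr_ge0.
- exact: measurableT_comp.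
- by move=> t _; rewrite /= ger0_norm ?sqr_ge0.
Qed.

Lemma L2_measurable f : L2 f -> cmeas f. Proof. by move=> /L2P[]. Qed.

Lemma L2_le f G : cmeas f -> mu.-integrable setT (EFin \o (fun t => G t ^+ 2)) ->
  (forall t, normc (f t) <= G t) -> L2 f.
Proof.
move=> mf iG fG; apply/L2P; split => //.
apply: (integrable_le _ _ iG) => //.
  by apply: measurable_funX; exact: measurable_normc.
move=> t _; rewrite ger0_norm ?sqr_ge0// lerXn2r ?nnegrE ?normc_ge0//.
by rewrite (le_trans (normc_ge0 _) (fG t)).
Qed.

Lemma L2D f g : L2 f -> L2 g -> L2 (fun t => f t + g t).
Proof.
move=> /L2P[mf jf] /L2P[mg jg]; apply/L2P; split; first exact: cmeasurableD.
have := integrableZl measurableT 2 (integrableD measurableT jf jg).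
move=> iG; apply: (@integrable_le _ _ _ mu setT measurableT _ (fun t => 2 * (normc (f t) ^+ 2 + normc (g t) ^+ 2)) _ iG).
  by apply: measurable_funX; apply: measurable_normc; exact: cmeasurableD.
move=> t _; rewrite ger0_norm ?sqr_ge0//.
have h : normc (f t + g t) ^+ 2 <= (normc (f t) + normc (g t)) ^+ 2.
  by rewrite lerXn2r ?nnegrE ?addr_ge0 ?normc_ge0 ?le_normcD.
apply: (le_trans h); have := sqr_ge0 (normc (f t) - normc (g t)).
by move: (normc _) (normc _) => x y; nra.
Qed.

Lemma L2Z c f : L2 f -> L2 (fun t => c * f t).
Proof.
move=> /L2P[mf jf]; apply/L2P; split; first by apply: cmeasurableM => //; exact: cmeasurable_cst.
have := integrableZl measurableT (normc c ^+ 2) jf.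
by apply: eq_integrable => // t _ /=; rewrite ComplexField.Normc.normcM exprMn.
Qed.

Lemma L2_0 : L2 (fun=> 0 : R[i]).
Proof.
apply: (@L2_le _ (fun=> 0)); first exact: cmeasurable_cst.
  by rewrite (_ : _ \o _ = cst 0%E); [exact: integrable0|apply/funext => t /=; rewrite expr0n].
by move=> t; rewrite ComplexField.Normc.normc0.
Qed.

Lemma L2_sum n (F : 'I_n -> R -> R[i]) : (forall i, L2 (F i)) -> L2 (fun t => \sum_(i < n) F i t).
Proof.
elim: n F => [|n IH] F iF.
  by under eq_fun do rewrite big_ord0; exact: L2_0.
under eq_fun do rewrite big_ord_recl.
by apply: L2D => //; apply: IH.
Qed.

Lemma L2_integrableM f h : L2 f -> L2 h ->
  mu.-integrable setT (EFin \o (fun t => normc (f t) * normc (h t))).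
Proof.
move=> /L2P[mf jf] /L2P[mh jh].
have := integrableD measurableT jf jh.
move=> iG; apply: (@integrable_le _ _ _ mu setT measurableT _ (fun t => normc (f t) ^+ 2 + normc (h t) ^+ 2) _ iG).
  by apply: measurable_funM; exact: measurable_normc.
move=> t _; rewrite ger0_norm ?mulr_ge0 ?normc_ge0//.
have := sqr_ge0 (normc (f t) - normc (h t)); have := normc_ge0 (f t); have := normc_ge0 (h t).
by move: (normc (f t)) (normc (h t)) => x y; nra.
Qed.

Lemma L2_cintegrable f h : L2 f -> L2 h -> cint (fun t => f t * conjc (h t)).
Proof.
move=> Lf Lh; apply: (cintegrable_le _ _ (L2_integrableM Lf Lh)) => //.
  by apply: cmeasurableM; [|apply: cmeasurable_conj]; exact: L2_measurable.
by move=> t _; rewrite ComplexField.Normc.normcM normc_conj.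
Qed.

Lemma innerC f h : L2 f -> L2 h -> inner f h = conjc (inner h f).
Proof.
move=> Lf Lh; rewrite /inner -cintegral_conj//; last exact: L2_cintegrable.
by apply: eq_cintegral => t _; rewrite rmorphM /= conjcK mulrC.
Qed.

Lemma innerDl f g h : L2 f -> L2 g -> L2 h ->
  inner (fun t => f t + g t) h = inner f h + inner g h.
Proof.
move=> Lf Lg Lh; rewrite /inner -cintegralD//; [|exact: L2_cintegrable..].
by apply: eq_cintegral => t _; rewrite mulrDl.
Qed.

Lemma innerZl c f h : L2 f -> L2 h -> inner (fun t => c * f t) h = c * inner f h.
Proof.
move=> Lf Lh; rewrite /inner -cintegralZl//; last exact: L2_cintegrable.
by apply: eq_cintegral => t _; rewrite mulrA.
Qed.

Lemma inner_suml n (F : 'I_n -> R -> R[i]) h : (forall i, L2 (F i)) -> L2 h ->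
  inner (fun t => \sum_(i < n) F i t) h = \sum_(i < n) inner (F i) h.
Proof.
move=> LF Lh; rewrite /inner -cintegral_sum//; last by move=> i; exact: L2_cintegrable.
by apply: eq_cintegral => t _; rewrite mulr_suml.
Qed.

Lemma innerDr f g h : L2 f -> L2 g -> L2 h ->
  inner f (fun t => g t + h t) = inner f g + inner f h.
Proof.
move=> Lf Lg Lh; rewrite innerC ?innerDl//; last exact: L2D.
by rewrite rmorphD /= (innerC Lf Lg) (innerC Lf Lh).
Qed.

Lemma innerZr c f h : L2 f -> L2 h -> inner f (fun t => c * h t) = conjc c * inner f h.
Proof.
move=> Lf Lh; rewrite innerC ?innerZl//; last exact: L2Z.
by rewrite rmorphM /= (innerC Lf Lh).
Qed.

Lemma inner_sumr n (F : 'I_n -> R -> R[i]) h : (forall i, L2 (F i)) -> L2 h ->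
  inner h (fun t => \sum_(i < n) F i t) = \sum_(i < n) inner h (F i).
Proof.
move=> LF Lh; rewrite innerC ?inner_suml//; last exact: L2_sum.
by rewrite rmorph_sum; apply: eq_bigr => i _; rewrite /= (innerC Lh (LF i)).
Qed.

Lemma inner_le f h (G : R -> R) : cmeas f -> L2 h ->
  mu.-integrable setT (EFin \o G) -> (forall t, normc (f t) * normc (h t) <= G t) ->
  normc (inner f h) <= 2 * Rintegral mu setT G.
Proof.
move=> mf Lh iG fG; apply: normc_cintegral_le => //.
  by apply: cmeasurableM => //; apply: cmeasurable_conj; exact: L2_measurable.
by move=> t _; rewrite ComplexField.Normc.normcM normc_conj.
Qed.

Lemma ae_inner f g h : L2 f -> L2 g -> L2 h -> {ae mu, forall t, f t = g t} ->
  inner f h = inner g h.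
Proof.
move=> Lf Lg Lh fg; rewrite /inner /cintegral /Rintegral.
have [/integrableP[f1 _] /integrableP[f2 _]] := L2_cintegrable Lf Lh.
have [/integrableP[g1 _] /integrableP[g2 _]] := L2_cintegrable Lg Lh.
congr Complex; congr fine; apply: ae_eq_integral => //.
  by apply: negligibleS fg => t /=; apply: contra_not => -> _.
by apply: negligibleS fg => t /=; apply: contra_not => -> _.
Qed.

Lemma inner_self_eq0 f : L2 f -> inner f f = 0 -> {ae mu, forall t, f t = 0}.
Proof.
move=> /L2P[mf jf] /(congr1 (fun z => Re z)) /=.
have -> : Rintegral mu setT (fun t => Re (f t * conjc (f t))) = Rintegral mu setT (fun t => normc (f t) ^+ 2).
  by apply: eq_Rintegral => t _; rewrite ReM sqr_normcE; case: (f t) => a b /=; ring.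
rewrite /Rintegral => h.
have m2 : measurable_fun [set: T] (EFin \o (fun t => normc (f t) ^+ 2)).
  by apply/measurable_EFinP; apply: measurable_funX; exact: measurable_normc.
have h0 : (\int[mu]_t (normc (f t) ^+ 2)%:E = 0)%E.
  by rewrite -(fineK (integrable_fin_num measurableT jf)) /= h.
have /(ae_eq_integral_abs _ measurableT m2) : (\int[mu]_t `|(normc (f t) ^+ 2)%:E| = 0)%E.
  by rewrite -h0; apply: eq_integral => t _; rewrite /= ger0_norm ?sqr_ge0.
apply: negligibleS => t /=; apply: contra_not => /(_ Logic.I) /eqP; rewrite eqe sqrf_eq0 => /eqP.
exact: ComplexField.Normc.eq0_normc.
Qed.

End inner_product.

(** * Hermite functions *)

Section gaussian_system.
Context {R : realType}.
Local Notation T := (measurableTypeR R).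
Local Notation mu := (@lebesgue_measure R).
Local Notation cmeas := (@cmeasurable R _ T setT).
Implicit Types (t x y b : R) (z : R[i]) (k N : nat).

Definition gwin t : R := 2 `^ (4^-1) * expR (- (pi * t ^+ 2)).

Definition hermite k t : R := gwin t * gen_coef (2 * pi * t) (- pi) k.

(* The Taylor expansion of [bargmann z t] in [z] has coefficients [hermite k t]. *)
Definition bargmann z t : R[i] :=
  (gwin t)%:C%C * cexp ((2 * pi * t)%:C%C * z + (- pi)%:C%C * z ^+ 2 / 2).

Lemma gwin_gt0 t : 0 < gwin t.
Proof. by rewrite mulr_gt0 ?expR_gt0// powR_gt0. Qed.

Lemma gwin_sqr t : gwin t ^+ 2 = Num.sqrt 2 * expR (- (2 * pi * t ^+ 2)).
Proof.
rewrite exprMn -expRM_natl; congr (_ * expR _); last by ring.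
rewrite -powR_mulrn ?powR_ge0// -powRrM -powR12_sqrt//; congr (_ `^ _).
by field.
Qed.

Lemma bargmann_remainder z t N :
  normc (bargmann z t - \sum_(k < N) z ^+ k * (hermite k t)%:C%C) <=
  2^-1 ^+ N * (2 * (1 + 4 * pi * normc z ^+ 2) * expR (9 * pi * normc z ^+ 2)) *
  (gwin t * expR (12 * pi * normc z * `|t|)).
Proof.
set al := (2 * pi * t)%:C%C * z; set be := (- pi)%:C%C * z ^+ 2.
have -> : \sum_(k < N) z ^+ k * (hermite k t)%:C%C = (gwin t)%:C%C * \sum_(k < N) gen_coef al be k.
  rewrite mulr_sumr; apply: eq_bigr => k _.
  by rewrite /hermite rmorphM gen_coef_scale gen_coef_morph /=; ring.
rewrite -mulrBr ComplexField.Normc.normcM normc_real gtr0_norm ?gwin_gt0//.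
rewrite [leRHS](_ : _ = gwin t * (2^-1 ^+ N * (2 * (1 + 4 * normc be) * expR (6 * normc al + 9 * normc be)))).
  by rewrite ler_wpM2l ?(ltW (gwin_gt0 _))// gen_sum_remainder.
have -> : normc be = pi * normc z ^+ 2.
  by rewrite ComplexField.Normc.normcM normcX normc_real normrN ger0_norm ?pi_ge0.
have -> : normc al = 2 * pi * `|t| * normc z.
  by rewrite ComplexField.Normc.normcM normc_real normrM ger0_norm ?mulr_ge0 ?pi_ge0.
by rewrite expRD (_ : 6 * _ = 12 * pi * normc z * `|t|); [rewrite (_ : 9 * (pi * _) = 9 * pi * normc z ^+ 2); ring|ring].
Qed.

Lemma tfshift_gauss (w : R * R) t : tfshift w (@gauss_window R) t =
  ((expR (- (pi / 2 * (w.1 ^+ 2 + w.2 ^+ 2))))%:C%C * cis (pi * w.1 * w.2)) * bargmann (Complex w.1 w.2) t.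
Proof.
case: w => x y; rewrite /tfshift /gauss_window /bargmann.
pose A := 2 * pi * t * x - pi / 2 * (x ^+ 2 - y ^+ 2).
pose B := 2 * pi * t * y - pi * x * y.
have -> : (2 * pi * t)%:C%C * Complex (x, y).1 (x, y).2 + (- pi)%:C%C * Complex (x, y).1 (x, y).2 ^+ 2 / 2 = Complex A B.
  have -> : (2 : R[i])^-1 = Complex 2^-1 0 by rewrite -[2](rmorph_nat (real_complex R)) -fmorphV.
  by rewrite /A /B; apply: complexP; rewrite !(ReD, ImD, ReM, ImM) /=; field.
rewrite /cexp /=.
have -> : (2 `^ 4^-1 * expR (- (pi * (t - x) ^+ 2)))%:C%C =
   (gwin t)%:C%C * ((expR (- (pi / 2 * (x ^+ 2 + y ^+ 2))))%:C%C * (expR A)%:C%C).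
  rewrite -!rmorphM; congr (_%:C)%C; rewrite /gwin.
  have -> : - (pi * (t - x) ^+ 2) = - (pi * t ^+ 2) + (- (pi / 2 * (x ^+ 2 + y ^+ 2)) + A) by rewrite /A; field.
  by rewrite !expRD; ring.
have -> : cis (2 * pi * y * t) = cis (pi * x * y) * cis B.
  by rewrite -cisD; congr cis; rewrite /B; ring.
by ring.
Qed.

Lemma cmeasurable_derivable (f df : R -> R[i]) : (forall s, is_cderive f s (df s)) -> cmeas f.
Proof.
move=> fd; split; apply: continuous_measurable_fun => s; have [d1 d2] := fd s.
  exact: is_derive_continuous d1.
exact: is_derive_continuous d2.
Qed.

Lemma measurable_gwin : measurable_fun [set: T] (gwin : T -> T).
Proof.
apply: measurable_funM; first exact: measurable_cst.
apply: measurableT_comp => //; apply: measurable_funN.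
by apply: measurable_funM; [exact: measurable_cst|exact: measurable_funX].
Qed.

Lemma measurable_gen_coef k : measurable_fun [set: T] ((fun t => gen_coef (2 * pi * t) (- pi) k) : T -> T).
Proof.
suff [] : measurable_fun [set: T] ((fun t => gen_coef (2 * pi * t) (- pi) k) : T -> T) /\
  measurable_fun [set: T] ((fun t => gen_prev (2 * pi * t) (- pi) k) : T -> T) by [].
elim: k => [|k [IH1 IH2]]; first by split; exact: measurable_cst.
split=> //; rewrite /gen_coef /=; apply: measurable_funM; last exact: measurable_cst.
apply: measurable_funD; last by apply: measurable_funM => //; exact: measurable_cst.
by apply: measurable_funM => //; apply: measurable_funM => //; exact: measurable_cst.
Qed.

Lemma cmeasurable_hermite k : cmeas (fun t => (hermite k t)%:C%C).
Proof.
apply: cmeasurable_real; apply: measurable_funM; first exact: measurable_gwin.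
exact: measurable_gen_coef.
Qed.

Lemma cmeasurable_bargmann z : cmeas (bargmann z).
Proof.
apply: cmeasurableM.
  by apply: cmeasurable_real; exact: measurable_gwin.
pose c0 : R[i] := (2 * pi)%:C%C * z; pose c1 : R[i] := (- pi)%:C%C * z ^+ 2 / 2.
apply: (@cmeasurable_derivable _ (fun t => cexp ((2 * pi * t)%:C%C * z + c1) * (c0 * 1 + 0))) => s.
have h := is_cderive_cexp (is_cderive_add (is_cderive_mul (is_cderive_const c0 s) (is_cderive_real (is_derive_var s))) (is_cderive_const c1 s)).
apply: (is_cderive_ext h) => [u|].
  by congr cexp; rewrite /c0 /c1 [(2 * pi * u)%:C%C]rmorphM; ring.
by rewrite /c0 [(2 * pi * s)%:C%C]rmorphM mul0r add0r; congr (cexp _ * _); ring.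
Qed.

(** Uniformly for [z] in a disc, [bargmann z] and the remainders of its expansion are bounded by
    multiples of one such function. *)
Definition dominant b t : R := gwin t * expR (b * `|t|).

Lemma dominant_ge0 b t : 0 <= dominant b t.
Proof. by rewrite mulr_ge0 ?expR_ge0// ltW// gwin_gt0. Qed.

Lemma measurable_dominant b : measurable_fun [set: T] (dominant b : T -> T).
Proof.
apply: measurable_funM; first exact: measurable_gwin.
apply: measurableT_comp => //; apply: measurable_funM; first exact: measurable_cst.
exact: normr_measurable.
Qed.

(** From [2 * b * |t| <= b ^ 2 + t ^ 2] and [2 * pi >= 2], the square is below a multiple of
    [exp (- t ^ 2)]. *)
Lemma integrable_dominant_sqr b : mu.-integrable setT (EFin \o (fun t => dominant b t ^+ 2)).
Proof.
have iG := integrableZl measurableT (Num.sqrt 2 * expR (b ^+ 2)) (@integrableT_gauss R).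
apply: (@integrable_le _ _ _ mu setT measurableT _ (fun t => Num.sqrt 2 * expR (b ^+ 2) * gauss_fun t) _ iG).
  by apply: measurable_funX; exact: measurable_dominant.
move=> t _; rewrite ger0_norm ?sqr_ge0// /dominant exprMn gwin_sqr -expRM_natl -!mulrA ler_wpM2l ?sqrtr_ge0//.
rewrite /gauss_fun -!expRD ler_expR -(real_normK (num_real t)).
have := sqr_ge0 (b - `|t|); have := sqr_ge0 `|t|; have := @pi_ge2 R.
by move: (`|t|) => u; nra.
Qed.

Lemma L2_dominant b : L2 (fun t => (dominant b t)%:C%C).
Proof.
apply: (L2_le _ (integrable_dominant_sqr b)).
  by apply: cmeasurable_real; exact: measurable_dominant.
by move=> t; rewrite normc_real ger0_norm ?dominant_ge0.
Qed.

Lemma L2_dominated (f : R -> R[i]) c b : cmeas f ->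
  (forall t, normc (f t) <= c * dominant b t) -> L2 f.
Proof.
move=> mf fd; apply: (@L2_le _ _ (fun t => c * dominant b t)) => //.
have := integrableZl measurableT (c ^+ 2) (integrable_dominant_sqr b).
by apply: eq_integrable => // t _; rewrite /comp [(c * _) ^+ 2]exprMn EFinM.
Qed.

Lemma L2_hermite k : L2 (fun t => (hermite k t)%:C%C).
Proof.
apply: (@L2_dominated _ (expR (pi / 2)) (2 * pi)); first exact: cmeasurable_hermite.
move=> t; rewrite normc_real normrM gtr0_norm ?gwin_gt0// /dominant [leRHS]mulrCA ler_wpM2l ?(ltW (gwin_gt0 _))//.
have [+ _] := gen_pair_normc ((2 * pi * t)%:C%C) ((- pi)%:C%C) k.
have -> : normc ((- pi)%:C%C : R[i]) = pi by rewrite normc_real normrN ger0_norm ?pi_ge0.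
have -> : normc ((2 * pi * t)%:C%C : R[i]) = 2 * pi * `|t|.
  by rewrite normc_real normrM (ger0_norm (_ : 0 <= 2 * pi)) ?mulr_ge0 ?pi_ge0.
rewrite gen_coef_morph normc_real => /le_trans; apply.
have h := @gen_coef_bound R (2 * pi * `|t|) pi 1 k _ (pi_ge0 R) ltr01.
rewrite !expr1n !mulr1 in h; rewrite -expRD addrC; apply: h.
by rewrite !mulr_ge0 ?pi_ge0.
Qed.

Lemma L2_bargmann z : L2 (bargmann z).
Proof.
apply: (@L2_dominated _ (expR (pi * normc z ^+ 2 / 2)) (2 * pi * normc z)); first exact: cmeasurable_bargmann.
move=> t; rewrite ComplexField.Normc.normcM normc_real gtr0_norm ?gwin_gt0// normc_cexp /dominant [leRHS]mulrCA ler_wpM2l ?(ltW (gwin_gt0 _))//.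
rewrite -expRD ler_expR (le_trans (ler_norm _))// (le_trans (Re_le_normc _))// (le_trans (le_normcD _ _))// addrC.
rewrite ComplexField.Normc.normcM [normc (_ * z ^+ 2)]ComplexField.Normc.normcM normcX !ComplexField.Normc.normcM !normc_real normrN.
have -> : normc (2^-1 : R[i]) = 2^-1.
  rewrite ComplexField.Normc.normcV; congr (_^-1).
  by rewrite -[2 in LHS](rmorph_nat (real_complex R)) normc_real ger0_norm.
rewrite !normrM (ger0_norm (pi_ge0 R)) (ger0_norm (ler0n R 2)).
by rewrite lerD// mulrAC.
Qed.

(** The uniform geometric rate serves twice: to compare coefficients of power series, and to
    integrate the expansion term by term over a bounded set. The conjugates appear because [inner]
    is antilinear in its second argument. *)
Lemma inner_bargmann_remainder (f : R -> R[i]) b : L2 f -> 0 <= b ->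
  exists K : R, 0 <= K /\ forall z N, normc z <= b ->
  normc (inner f (bargmann z) - \sum_(k < N) conjc z ^+ k * inner f (fun t => (hermite k t)%:C%C)) <=
  2^-1 ^+ N * K.
Proof.
move=> Lf b0.
pose c := 2 * (1 + 4 * pi * b ^+ 2) * expR (9 * pi * b ^+ 2).
have c0 : 0 <= c by rewrite !mulr_ge0 ?expR_ge0// addr_ge0// !mulr_ge0 ?pi_ge0 ?sqr_ge0.
have iG : mu.-integrable setT (EFin \o (fun t => normc (f t) * dominant (12 * pi * b) t)).
  apply: eq_integrable (L2_integrableM Lf (L2_dominant (12 * pi * b))) => // t _.
  by rewrite /comp normc_real ger0_norm ?dominant_ge0.
exists (2 * (c * Rintegral mu setT (fun t => normc (f t) * dominant (12 * pi * b) t))).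
split.
  apply: mulr_ge0 => //; apply: mulr_ge0 => //; apply: Rintegral_ge0 => t _.
  by rewrite mulr_ge0 ?normc_ge0 ?dominant_ge0.
move=> z N zb.
have LS : L2 (fun t => \sum_(k < N) z ^+ k * (hermite k t)%:C%C).
  by apply: L2_sum => k; apply: L2Z; exact: L2_hermite.
have LM : L2 (fun t => (-1) * \sum_(k < N) z ^+ k * (hermite k t)%:C%C) by exact: L2Z.
have -> : inner f (bargmann z) - \sum_(k < N) conjc z ^+ k * inner f (fun t => (hermite k t)%:C%C) =
  inner f (fun t => bargmann z t + (-1) * \sum_(k < N) z ^+ k * (hermite k t)%:C%C).
  rewrite innerDr//; last exact: L2_bargmann.
  rewrite innerZr// rmorphN rmorph1 mulN1r; congr (_ - _).
  rewrite inner_sumr//; last by move=> k; apply: L2Z; exact: L2_hermite.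
  by apply: eq_bigr => k _; rewrite innerZr ?rmorphXn//; exact: L2_hermite.
rewrite (le_trans (inner_le (G := fun t => (2^-1 ^+ N * c) * (normc (f t) * dominant (12 * pi * b) t)) _ _ _ _))//.
- exact: L2_measurable.
- by apply: L2D => //; exact: L2_bargmann.
- have := integrableZl measurableT (2^-1 ^+ N * c) iG.
  by apply: eq_integrable => // t _ /=; rewrite EFinM.
- move=> t; rewrite mulrCA ler_wpM2l ?normc_ge0// mulN1r (le_trans (bargmann_remainder _ _ _))//.
  have z2 : normc z ^+ 2 <= b ^+ 2 by rewrite lerXn2r ?nnegrE ?normc_ge0.
  apply: ler_pM.
  - rewrite mulr_ge0 ?exprn_ge0 ?invr_ge0// mulr_ge0 ?expR_ge0// mulr_ge0// addr_ge0//.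
    by rewrite mulr_ge0 ?sqr_ge0// mulr_ge0 ?pi_ge0.
  - by rewrite mulr_ge0 ?expR_ge0// ltW// gwin_gt0.
  - rewrite ler_wpM2l ?exprn_ge0 ?invr_ge0// /c.
    have q0 : 0 <= 4 * pi :> R by rewrite mulr_ge0 ?pi_ge0.
    have q1 : 0 <= 9 * pi :> R by rewrite mulr_ge0 ?pi_ge0.
    apply: ler_pM; rewrite ?expR_ge0//.
    + by rewrite mulr_ge0// addr_ge0// mulr_ge0// sqr_ge0.
    + by rewrite ler_wpM2l// lerD2l ler_wpM2l.
    + by rewrite ler_expR ler_wpM2l.
  - rewrite /dominant ler_wpM2l ?(ltW (gwin_gt0 _))// ler_expR ler_wpM2r// ler_wpM2l// mulr_ge0 ?pi_ge0//.
- rewrite RintegralZl// le_eqVlt; apply/orP; left; apply/eqP; ring.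
Qed.

End gaussian_system.

Lemma cintegral_real {R : realType} (d : measure_display) (T : measurableType d)
  (mu : {measure set T -> \bar R}) (D : set T) (G : T -> R) : measurable D ->
  cintegral mu D (fun t => ((G t)%:C)%C) = ((Rintegral mu D G)%:C)%C.
Proof. by move=> mD; rewrite /cintegral /= Rintegral_cst// mul0r. Qed.

Lemma cexp_real {R : realType} (a : R) : cexp (a%:C)%C = ((expR a)%:C)%C.
Proof. by rewrite /cexp [Im _]/= [Re _]/= cis0 mulr1. Qed.

(** * Orthogonality of the Hermite functions *)

Section orthogonality.
Context {R : realType}.
Local Notation T := (measurableTypeR R).
Local Notation mu := (@lebesgue_measure R).
Implicit Types (t x y b : R) (z : R[i]) (k N : nat).

Lemma half_pow_lt (K e : R) : 0 < e -> exists N0, forall N, (N0 <= N)%N -> 2^-1 ^+ N * K < e.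
Proof.
move=> e0; exists (Num.truncn (`|K| / e)).+1 => N N0N.
apply: (@le_lt_trans _ _ (2^-1 ^+ N * `|K|)).
  by rewrite ler_wpM2l ?ler_norm// exprn_ge0// invr_ge0.
rewrite exprVn ltr_pdivrMl ?exprn_gt0// mulrC -ltr_pdivrMl// mulrC.
have q0 : 0 <= `|K| / e by rewrite divr_ge0// ltW.
have /andP[_ h] := Num.Theory.truncn_itv q0.
apply: (lt_le_trans h); rewrite -natrX ler_nat.
by rewrite (leq_trans N0N)// ltnW// ltn_expl.
Qed.

(** Consecutive sums at [x = 1] show that the coefficients decay like [2 ^- k]. If [d n] were the
    first nonzero one, then for a small [x] the term [x ^ n * d n] would outweigh the rest of the
    series, whereas long partial sums tend to 0. *)
Lemma geometric_uniqueness (d : nat -> R[i]) K :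
  (forall x N, 0 <= x <= 1 -> normc (\sum_(k < N) (x%:C)%C ^+ k * d k) <= 2^-1 ^+ N * K) ->
  forall k, d k = 0.
Proof.
move=> dK.
have K0 : 0 <= K.
  have := dK 0 0%N; rewrite lexx ler01 big_ord0 ComplexField.Normc.normc0 expr0 mul1r.
  exact.
have dle N : normc (d N) <= 2^-1 ^+ N * (2 * K).
  have -> : d N = \sum_(k < N.+1) (1%:C)%C ^+ k * d k - \sum_(k < N) (1%:C)%C ^+ k * d k.
    by rewrite big_ord_recr /= rmorph1 expr1n mul1r addrAC subrr add0r.
  have I1 : 0 <= (1 : R) <= 1 by rewrite ler01 lexx.
  rewrite (le_trans (normcB_le _ _))// (le_trans (lerD (dK _ _ I1) (dK _ _ I1)))//.
  rewrite exprS; have := exprn_ge0 N (_ : 0 <= 2^-1 :> R); rewrite invr_ge0 => /(_ (ler0n _ _)).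
  by move: (2^-1 ^+ N) => u u0; have := mulr_ge0 u0 K0; lra.
have half N : \sum_(k < N) (2^-1 : R) ^+ k <= 2.
  have h : \sum_(k < N) (2^-1 : R) ^+ k = 2 - 2 * 2^-1 ^+ N.
    elim: N => [|N IH]; first by rewrite big_ord0 expr0; ring.
    by rewrite big_ord_recr /= IH exprS; field.
  by rewrite h gerBl mulr_ge0// exprn_ge0// invr_ge0.
elim/ltn_ind => n IH; apply/eqP/negPn/negP => dn.
set a := normc (d n).
have a0 : 0 < a.
  rewrite lt_neqAle normc_ge0 andbT; apply/eqP => h.
  by move/eqP: dn; apply; apply: ComplexField.Normc.eq0_normc.
(* Small enough that the terms after [n] amount to at most half of [x ^ n * a]. *)
pose x : R := a / (a + 8 * K).
have D0 : 0 < a + 8 * K by rewrite ltr_wpDr ?mulr_ge0.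
have x0 : 0 < x by rewrite divr_gt0.
have x1 : x <= 1 by rewrite ler_pdivrMr// mul1r lerDl mulr_ge0.
have xK : x * (4 * K) <= a / 2.
  rewrite /x mulrAC ler_pdivrMr//; have : 0 <= a * K by rewrite mulr_ge0// ltW.
  have := sqr_ge0 a; rewrite expr2; lra.
have [N0 HN] := @half_pow_lt K (x ^+ n * (a / 2)) (mulr_gt0 (exprn_gt0 _ x0) (divr_gt0 a0 (ltr0n _ 2))).
have {HN} := HN (n.+1 + N0)%N (leq_addl _ _).
apply/negP; rewrite -leNgt.
have xI : 0 <= x <= 1 by rewrite ltW.
rewrite (le_trans _ (dK x (n.+1 + N0)%N xI))//.
rewrite big_split_ord /= big_ord_recr /= big1 ?add0r => [|i _]; last by rewrite IH ?mulr0.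
set t := \sum_(i < N0) _.
have tle : normc t <= x ^+ n * (a / 2).
  apply: (@le_trans _ _ (x ^+ n * (x * (4 * K)))); last by rewrite ler_wpM2l// exprn_ge0// ltW.
  rewrite (le_trans (normc_sum_le _ _))//.
  apply: (@le_trans _ _ (\sum_(i < N0) x ^+ n.+1 * ((2 * K) * 2^-1 ^+ i))).
    apply: ler_sum => i _; rewrite ComplexField.Normc.normcM normcX normc_real (ger0_norm (ltW x0)).
    rewrite ler_pM ?exprn_ge0 ?normc_ge0 ?(ltW x0)//.
      by rewrite ler_wiXn2l ?leq_addr// ltW.
    rewrite (le_trans (dle _))// mulrC ler_wpM2l ?mulr_ge0//.
    by rewrite ler_wiXn2l ?invr_ge0 ?leq_addl// invf_le1// ler1n.
  rewrite -mulr_sumr -mulr_sumr exprSr -mulrA ler_wpM2l ?exprn_ge0 ?(ltW x0)//.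
  rewrite ler_wpM2l ?(ltW x0)// (_ : 4 * K = 2 * K * 2); last by ring.
  by rewrite ler_wpM2l ?mulr_ge0.
have main : normc ((x%:C)%C ^+ n * d n) = x ^+ n * a.
  by rewrite ComplexField.Normc.normcM normcX normc_real ger0_norm// ltW.
have := normcB_le ((x%:C)%C ^+ n * d n + t) t; rewrite addrK main.
by move: tle; rewrite mulrA; lra.
Qed.

(** With this standard deviation the normal density is a translate of the squared window. *)
Let sigma : R := (2 * Num.sqrt pi)^-1.

Let normal_pdf_sigma m t :
  normal_pdf m sigma t = Num.sqrt 2 * expR (- (2 * pi * (t - m) ^+ 2)).
Proof.
have p0 : pi != 0 :> R by rewrite gt_eqF// pi_gt0.
have sigma0 : sigma != 0 by rewrite invr_eq0 mulf_neq0 ?pnatr_eq0// gt_eqF// sqrtr_gt0 pi_gt0.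
have s2 : sigma ^+ 2 = (4 * pi)^-1.
  by rewrite /sigma exprVn exprMn sqr_sqrtr ?pi_ge0//; congr (_^-1); ring.
rewrite normal_pdfE// /normal_peak /normal_fun s2; congr (_ * expR _).
  rewrite (_ : (4 * pi)^-1 * pi *+ 2 = 2^-1); last first.
    by rewrite invfM -mulrA mulVf// mulr1 [4^-1 *+ 2]mulr2n; field.
  by rewrite sqrtrV ?invrK.
have -> : (4 * pi)^-1 *+ 2 = (2 * pi)^-1 :> R.
  by rewrite [(4 * pi)^-1 *+ 2]mulr2n !invfM -mulrDl; congr (_ * _); field.
by rewrite invrK; ring.
Qed.

Lemma integrable_normal m :
  mu.-integrable setT (EFin \o (fun t => Num.sqrt 2 * expR (- (2 * pi * (t - m) ^+ 2)))).
Proof.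
have := @integrable_normal_pdf R m sigma.
by apply: eq_integrable => // t _; rewrite /comp normal_pdf_sigma.
Qed.

Lemma Rintegral_normal m : Rintegral mu setT (fun t => Num.sqrt 2 * expR (- (2 * pi * (t - m) ^+ 2))) = 1.
Proof.
rewrite /Rintegral (_ : (\int[mu]_x _)%E = 1%E)//.
rewrite -[RHS](@integral_normal_pdf R m sigma).
by apply: eq_integral => t _; rewrite normal_pdf_sigma.
Qed.

(** Completing the square leaves [exp (pi * x * y)] times a normal density of mean [(x + y) / 2].
    Real arguments are enough, because the coefficients are recovered from values on [[0, 1]]. *)
Lemma inner_bargmann_real x y :
  inner (bargmann (x%:C)%C) (bargmann (y%:C)%C) = ((expR (pi * x * y))%:C)%C.
Proof.
have bE u t : bargmann (u%:C)%C t = ((gwin t * expR (2 * pi * t * u - pi * u ^+ 2 / 2))%:C)%C.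
  rewrite /bargmann (_ : _ + _ = ((2 * pi * t * u - pi * u ^+ 2 / 2)%:C)%C); last first.
    rewrite rmorphB /= rmorphM /= (rmorphM _ _ (2^-1)) fmorphV rmorph_nat (rmorphM _ pi) rmorphXn rmorphN /=.
    by ring.
  by rewrite /cexp [Im _]/= [Re _]/= cis0 mulr1 -rmorphM.
rewrite /inner (@eq_cintegral _ _ _ mu setT _ (fun t => ((gwin t * expR (2 * pi * t * x - pi * x ^+ 2 / 2) *
   (gwin t * expR (2 * pi * t * y - pi * y ^+ 2 / 2)))%:C)%C)); last first.
  by move=> t _; rewrite !bE conjc_real -rmorphM.
rewrite cintegral_real//; congr (_%:C)%C.
have := RintegralZl (expR (pi * x * y)) measurableT (integrable_normal ((x + y) / 2)).
rewrite Rintegral_normal mulr1 => <-.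
apply: eq_Rintegral => t _.
rewrite [LHS](_ : _ = gwin t ^+ 2 * (expR (2 * pi * t * x - pi * x ^+ 2 / 2) * expR (2 * pi * t * y - pi * y ^+ 2 / 2))); last by ring.
have E : expR (- (2 * pi * t ^+ 2)) * (expR (2 * pi * t * x - pi * x ^+ 2 / 2) * expR (2 * pi * t * y - pi * y ^+ 2 / 2)) =
    expR (pi * x * y) * expR (- (2 * pi * (t - (x + y) / 2) ^+ 2)).
  by rewrite -!expRD; congr expR; field.
by rewrite gwin_sqr -[LHS]mulrA E mulrCA.
Qed.

(** Both sides are the [k]-th coefficient of [exp (pi * x * y)] as a power series in [y], one
    through the expansion of [bargmann y], the other through the exponential series, which is the
    generating function with [b = 0]. *)
Lemma inner_hermite_bargmann k x : 0 <= x <= 1 ->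
  inner (fun t => ((hermite k t)%:C)%C) (bargmann (x%:C)%C) = (((pi * x) ^+ k / k`!%:R)%:C)%C.
Proof.
move=> x01.
have Lb := L2_bargmann (x%:C)%C.
have [K [K0 HK]] := inner_bargmann_remainder Lb ler01.
pose C := 2 * (1 + 4 * 0) * expR (6 * pi + 9 * 0) : R.
rewrite innerC//; [|exact: L2_hermite].
pose d j := inner (bargmann (x%:C)%C) (fun t => ((hermite j t)%:C)%C) - (((pi * x) ^+ j / j`!%:R)%:C)%C.
suff -> : inner (bargmann (x%:C)%C) (fun t => ((hermite k t)%:C)%C) = (((pi * x) ^+ k / k`!%:R)%:C)%C.
  by rewrite conjc_real.
apply/subr0_eq; rewrite -/(d k).
apply: (@geometric_uniqueness d (K + C)) => y N /andP[y0 y1].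
have yn : normc (y%:C)%C <= 1 by rewrite normc_real ger0_norm.
have {HK} h1 := HK (y%:C)%C N yn.
have := @gen_sum_remainder R ((pi * x * y)%:C)%C 0 N.
have -> : \sum_(j < N) gen_coef ((pi * x * y)%:C)%C 0 j = \sum_(j < N) (y%:C)%C ^+ j * (((pi * x) ^+ j / j`!%:R)%:C)%C.
  apply: eq_bigr => j _; rewrite -(rmorph0 (real_complex R)) gen_coef_morph -rmorphXn -rmorphM /=.
  congr (_%:C)%C; elim: (j : nat) => [|m IH]; first by rewrite gen_coef0 !expr0 fact0 divr1 mulr1.
  rewrite /gen_coef /= -/(gen_coef _ _ _) IH mul0r addr0 factS natrM !exprS.
  by field; rewrite fact_neq0/= nat1r pnatr_eq0.
rewrite mul0r addr0 cexp_real.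
rewrite inner_bargmann_real in h1.
rewrite normc_real ComplexField.Normc.normc0 => h2.
have {}h2 : normc ((expR (pi * x * y))%:C%C - \sum_(j < N) (y%:C)%C ^+ j * (((pi * x) ^+ j / j`!%:R)%:C)%C) <= 2^-1 ^+ N * C.
  apply: (le_trans h2); rewrite ler_wpM2l ?exprn_ge0 ?invr_ge0// /C ler_wpM2l//.
  case/andP: x01 => x0 x1.
  rewrite ler_expR !mulr0 !addr0 ler_wpM2l// ger0_norm ?mulr_ge0 ?pi_ge0//.
  by rewrite -mulrA ler_piMr ?pi_ge0// mulr_ile1.
have -> : \sum_(j < N) (y%:C)%C ^+ j * d j =
  ((expR (pi * x * y))%:C%C - \sum_(j < N) (y%:C)%C ^+ j * (((pi * x) ^+ j / j`!%:R)%:C)%C) -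
  ((expR (pi * x * y))%:C%C - \sum_(j < N) (y%:C)%C ^+ j * inner (bargmann (x%:C)%C) (fun t => ((hermite j t)%:C)%C)).
  rewrite opprB addrC addrA subrK -sumrB; apply: eq_bigr => j _.
  by rewrite /d mulrBr.
apply: (le_trans (normcB_le _ _)); rewrite mulrDr [leLHS]addrC.
apply: lerD; last exact: h2.
have E : \sum_(j < N) conjc (y%:C)%C ^+ j * inner (bargmann (x%:C)%C) (fun t => ((hermite j t)%:C)%C) =
  \sum_(j < N) (y%:C)%C ^+ j * inner (bargmann (x%:C)%C) (fun t => ((hermite j t)%:C)%C).
  by apply: eq_bigr => j _; rewrite conjc_real.
by rewrite E in h1.
Qed.

(** As a series in [y], the pairing of the [j]-th Hermite function with [bargmann y] has these inner
    products as coefficients, and it equals the single monomial [(pi * y) ^ j / j!]. *)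
Lemma inner_hermite j k : inner (fun t => ((hermite j t)%:C)%C) (fun t => ((hermite k t)%:C)%C) =
  (if j == k then ((pi ^+ k / k`!%:R)%:C)%C else 0).
Proof.
have Lb := @L2_hermite R j.
have [K [K0 HK]] := inner_bargmann_remainder Lb ler01.
pose c : R := pi ^+ j / j`!%:R.
have c0 : 0 <= c by rewrite divr_ge0// exprn_ge0// pi_ge0.
pose d i := inner (fun t => ((hermite j t)%:C)%C) (fun t => ((hermite i t)%:C)%C) - (if j == i then (c%:C)%C else 0).
suff /subr0_eq -> : d k = 0 by case: eqP => // <-.
(* The summand [2 ^ j * c] pays for the truncations [N <= j], which do not yet contain the
   monomial. *)
apply: (@geometric_uniqueness d (K + 2 ^+ j * c)) => y N /andP[y0 y1].
have yn : normc (y%:C)%C <= 1 by rewrite normc_real ger0_norm.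
have {HK} h1 := HK (y%:C)%C N yn.
rewrite inner_hermite_bargmann ?y0// conjc_real in h1.
pose S := \sum_(i < N) (y%:C)%C ^+ i * inner (fun t => ((hermite j t)%:C)%C) (fun t => ((hermite i t)%:C)%C).
have SE : \sum_(i < N) (y%:C)%C ^+ i * d i = S - (if (j < N)%N then (y%:C)%C ^+ j * (c%:C)%C else 0).
  rewrite /d; under eq_bigr do rewrite mulrBr.
  rewrite sumrB; congr (_ - _); case: ifPn => jN.
    rewrite (bigD1 (Ordinal jN))//= eqxx big1 ?addr0// => i ij.
    by rewrite ifN ?mulr0//; apply: contra ij => /eqP e; apply/eqP/val_inj.
  rewrite big1// => i _; rewrite ifN ?mulr0//; apply: contra jN => /eqP ->.
  exact: ltn_ord.
rewrite SE mulrDr.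
have E : (((pi * y) ^+ j / j`!%:R)%:C)%C = (y%:C)%C ^+ j * (c%:C)%C.
  by rewrite -rmorphXn -rmorphM /=; congr (_%:C)%C; rewrite /c exprMn; ring.
rewrite E -/S in h1.
have hc : 0 <= 2^-1 ^+ N * (2 ^+ j * c) by rewrite mulr_ge0 ?exprn_ge0 ?invr_ge0// mulr_ge0// exprn_ge0.
case: ifPn => [jN|]; first by rewrite -normcN opprB (le_trans h1)// lerDl.
rewrite -leqNgt => Nj; rewrite subr0.
rewrite (_ : S = (y%:C)%C ^+ j * (c%:C)%C - ((y%:C)%C ^+ j * (c%:C)%C - S)); last by ring.
apply: (le_trans (normcB_le _ _)); rewrite [leLHS]addrC; apply: lerD; first exact: h1.
rewrite ComplexField.Normc.normcM normcX !normc_real !ger0_norm// [leRHS]mulrA.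
rewrite ler_wpM2r// (@le_trans _ _ 1) ?exprn_ile1//.
by rewrite exprVn ler_pdivlMl ?exprn_gt0// mulr1 ler_weXn2l// ler1n.
Qed.

End orthogonality.

(** * Localization operators of radial sets *)

Section rotation_moments.
Context {R : realType}.
Local Notation T := (measurableTypeR R).
Local Notation mu1 := (@lebesgue_measure R).
Local Notation mu2 := (mu1 \x mu1)%E.
Implicit Types (z : T * T) (j k : nat).

(** The rotation is applied twice because [ge0_integral_rot] excludes the half turn, which is
    exactly the angle needed for monomials with [|j - k| = 1]. *)
Lemma Rintegral_rot_odd (c s : R) (G : T * T -> R) : c ^+ 2 + s ^+ 2 = 1 -> 1 + c != 0 ->
  measurable_fun setT G -> (forall z, G (rot c s (rot c s z)) = - G z) ->
  Rintegral mu2 setT G = 0.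
Proof.
move=> cs c1 mG Godd; rewrite /Rintegral integralE.
have mP : measurable_fun setT ((EFin \o G)^\+)%E.
  by apply: measurable_funepos; exact/measurable_EFinP.
have -> : (\int[mu2]_z ((EFin \o G)^\-) z = \int[mu2]_z ((EFin \o G)^\+) z)%E.
  rewrite -(ge0_integral_rot cs c1 mP)//.
  rewrite -(@ge0_integral_rot _ c s (fun z => ((EFin \o G)^\+)%E (rot c s z)) cs c1); last 2 first.
  - by apply: (measurableT_comp mP); exact: measurable_rot.
  - by move=> z; exact: funepos_ge0.
  apply: eq_integral => z _; rewrite funeposE funenegE /= Godd.
  by rewrite EFinN.
set I := (\int[mu2]_z ((EFin \o G)^\+) z)%E; rewrite -[X in (X - _)%E]/I.
by case: I => [r| |]//=; rewrite subrr.
Qed.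

(** The plane is read as the complex line in order to express rotations as multiplication by
    [cis]. *)
Definition zc (z : R * R) : R[i] := Complex z.1 z.2.

Lemma zc_rot (th : R) z : zc (rot (cos th) (sin th) z) = cis th * zc z.
Proof. by apply: complexP; rewrite ?ReM ?ImM /=; ring. Qed.

Lemma normc_zc z : normc (zc z) ^+ 2 = sqnorm z.
Proof. by rewrite sqr_normcE. Qed.

Lemma sqnorm_rot (c s : R) z : c ^+ 2 + s ^+ 2 = 1 -> sqnorm (rot c s z) = sqnorm z.
Proof.
move=> cs; rewrite /sqnorm /rot /=.
transitivity ((c ^+ 2 + s ^+ 2) * (z.1 ^+ 2 + z.2 ^+ 2)); first by ring.
by rewrite cs mul1r.
Qed.

Definition monomial j k z : R[i] :=
  ((expR (- (pi * sqnorm z)))%:C)%C * (conjc (zc z) ^+ j * zc z ^+ k).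

Lemma cmeasurable_zc : cmeasurable setT (zc : T * T -> R[i]).
Proof. by split; [exact: measurable_fst|exact: measurable_snd]. Qed.

Lemma cmeasurable_monomial j k : cmeasurable setT (monomial j k : T * T -> R[i]).
Proof.
apply: cmeasurableM.
  apply: cmeasurable_real; apply: measurableT_comp => //; apply: measurable_funN.
  by apply: measurable_funM; [exact: measurable_cst|exact: measurable_sqnorm].
apply: cmeasurableM; last by apply: cmeasurableX; exact: cmeasurable_zc.
by apply: cmeasurableX; apply: cmeasurable_conj; exact: cmeasurable_zc.
Qed.

Lemma conjcM (x y : R[i]) : conjc (x * y) = conjc x * conjc y.
Proof. by apply: complexP; case: x y => [a b] [c d]; rewrite ?ReM ?ImM /=; ring. Qed.

Lemma minn_lt_maxn j k : j != k -> (minn j k < maxn j k)%N.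
Proof.
rewrite neq_ltn => /orP[] h.
  by rewrite (maxn_idPr (ltnW h)) (minn_idPl (ltnW h)).
by rewrite (maxn_idPl (ltnW h)) (minn_idPr (ltnW h)).
Qed.

(** A turn by an angle [phi] multiplies the monomial by [cis ((k - j) * phi)]; two turns by [th]
    give [cis] of [pi] or [- pi]. *)
Lemma monomial_rot j k z : j != k ->
  let th : R := pi / (2 * (maxn j k - minn j k)%:R) in
  monomial j k (rot (cos th) (sin th) (rot (cos th) (sin th) z)) = - monomial j k z.
Proof.
move=> jk; set n := (maxn j k - minn j k)%N => th.
have n0 : (0 < n)%N by rewrite subn_gt0 minn_lt_maxn.
have thn : 2 * n%:R * th = pi by rewrite /th; field; rewrite pnatr_eq0 -lt0n.
rewrite /monomial !zc_rot !sqnorm_rot ?cos2Dsin2// -[RHS]mulrN; congr (_ * _).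
rewrite !conjcM conjc_cis mulrA -cisD [cis th * _]mulrA -cisD !exprMn !cisX.
rewrite (_ : _ * _ = cis (j%:R * (- th - th)) * cis (k%:R * (th + th)) * (conjc (zc z) ^+ j * zc z ^+ k)); last by rewrite addrC; ring.
rewrite -cisD -mulN1r; congr (_ * _).
have cp : cis pi = -1 :> R[i] by apply: complexP; rewrite /= ?cospi ?sinpi ?oppr0.
have cn : cis (- pi) = -1 :> R[i] by rewrite -conjc_cis cp rmorphN rmorph1.
case: (ltngtP j k) => jk'; last by rewrite jk' eqxx in jk.
  have nE : n%:R = k%:R - j%:R :> R.
    by rewrite /n (maxn_idPr (ltnW jk')) (minn_idPl (ltnW jk')) natrB// ltnW.
  by rewrite -cp; congr cis; rewrite -[RHS]thn nE; ring.
have nE : n%:R = j%:R - k%:R :> R.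
  by rewrite /n (maxn_idPl (ltnW jk')) (minn_idPr (ltnW jk')) natrB// ltnW.
by rewrite -cn; congr cis; rewrite -[in RHS]thn nE; ring.
Qed.

Section radial_set.
Variables (Om : set (T * T)) (b : R).
Hypotheses (mO : measurable Om) (Ofin : (mu2 Om < +oo)%E) (b0 : 0 <= b).
Hypothesis Ob : forall z, Om z -> normc (zc z) <= b.
Hypothesis Orot : forall (c s : R) z, c ^+ 2 + s ^+ 2 = 1 -> Om (rot c s z) <-> Om z.

Definition moment k : R :=
  Rintegral mu2 Om (fun z => expR (- (pi * sqnorm z)) * sqnorm z ^+ k).

Lemma integrable_cst_radial (c : R) : mu2.-integrable Om (EFin \o (fun=> c)).
Proof.
apply: measurable_bounded_integrable => //.
exists `|c|; split; first exact: num_real.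
by move=> M cM z _; exact: ltW.
Qed.

Lemma cintegrable_monomial j k : cintegrable mu2 Om (monomial j k).
Proof.
apply: (@cintegrable_le _ _ _ mu2 Om mO _ (fun=> b ^+ (j + k))).
- have [m1 m2] := cmeasurable_monomial j k.
  by split; apply: measurable_funTS.
- exact: integrable_cst_radial.
- move=> z /Ob zb; rewrite /monomial !ComplexField.Normc.normcM !normcX normc_conj normc_real.
  rewrite (ger0_norm (expR_ge0 _)) -exprD -[leRHS]mul1r; apply: ler_pM.
  - exact: expR_ge0.
  - by apply: exprn_ge0; exact: normc_ge0.
  - by rewrite -expR0 ler_expR lerNl oppr0 mulr_ge0 ?pi_ge0 ?sqnorm_ge0.
  - by rewrite lerXn2r ?nnegrE ?normc_ge0.
Qed.

Lemma cintegral_monomial j k : cintegral mu2 Om (monomial j k) = if j == k then ((moment k)%:C)%C else 0.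
Proof.
case: eqP => [->|/eqP jk].
  rewrite -cintegral_real//; apply: eq_cintegral => z _.
  rewrite /monomial rmorphM rmorphXn /= -exprMn; congr (_ * (_ ^+ _)).
  by apply: complexP; rewrite ?ReM ?ImM /= /sqnorm; ring.
set th : R := pi / (2 * (maxn j k - minn j k)%:R).
have n1 : 1 <= (maxn j k - minn j k)%:R :> R.
  by rewrite ler1n subn_gt0 minn_lt_maxn.
have c0 : 0 <= cos th.
  have p0 := @pi_gt0 R.
  apply: cos_ge0_pihalf; apply/andP; split.
    by rewrite (@le_trans _ _ 0)// ?oppr_le0 ?divr_ge0 ?mulr_ge0 ?(ltW p0)// (le_trans ler01).
  rewrite /th ler_pM2l// lef_pV2 ?posrE ?mulr_gt0// ?(lt_le_trans ltr01 n1)//.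
  by rewrite -{1}[2]mulr1 ler_wpM2l.
have c1 : 1 + cos th != 0 by rewrite gt_eqF// ltr_wpDr.
have [m1 m2] := cmeasurable_monomial j k.
have odd (G : T * T -> R) : measurable_fun setT G ->
    (forall z, G (rot (cos th) (sin th) (rot (cos th) (sin th) z)) = - G z) ->
    Rintegral mu2 Om G = 0.
  move=> mG Godd; rewrite Rintegral_mkcond.
  apply: (@Rintegral_rot_odd (cos th) (sin th)) => //; first exact: cos2Dsin2.
    by apply/(measurable_restrictT _ mO); exact: measurable_funTS.
  move=> z; rewrite !patchE.
  have -> : (rot (cos th) (sin th) (rot (cos th) (sin th) z) \in Om) = (z \in Om).
    have OR w : Om (rot (cos th) (sin th) w) <-> Om w := Orot w (cos2Dsin2 th).
    apply/idP/idP => /set_mem h; apply/mem_set.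
      exact: (proj1 (OR _) (proj1 (OR _) h)).
    exact: (proj2 (OR _) (proj2 (OR _) h)).
  (* Off [Om] the restriction has the default value [point], which is 0 and so its own opposite. *)
  by case: ifP => _; [exact: Godd|rewrite -[point]/(0 : R) oppr0].
apply: complexP; rewrite /cintegral /=; apply: odd => // z.
  by rewrite monomial_rot// ReN.
by rewrite monomial_rot// ImN.
Qed.

End radial_set.
End rotation_moments.

(** * Diagonalisation of the localization operator of a radial set *)

Section radial_operator.
Context {R : realType}.
Local Notation T := (measurableTypeR R).
Local Notation mu1 := (@lebesgue_measure R).
Local Notation mu2 := (mu1 \x mu1)%E.
Implicit Types (z : T * T) (j k N : nat) (f h : R -> R[i]).

Lemma half_pow_eq0 (x : R[i]) K N0 :
  (forall N, (N0 <= N)%N -> normc x <= 2^-1 ^+ N * K) -> x = 0.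
Proof.
move=> xK; apply: ComplexField.Normc.eq0_normc; apply/eqP; rewrite eq_le normc_ge0 andbT.
rewrite leNgt; apply/negP => x0; have [N1 N1P] := half_pow_lt K x0.
have := N1P _ (leq_maxr N0 N1).
by rewrite ltNge xK// leq_maxl.
Qed.

Definition herm k : R -> R[i] := fun t => ((hermite k t)%:C)%C.

Definition gauss_kernel f h z : R[i] :=
  stft (@gauss_window R) f z * inner (tfshift z (@gauss_window R)) h.

(** The phase [cis (pi * x * y)] enters once and once conjugated, hence cancels, and the two factors
    [exp (- pi / 2 * |z| ^ 2)] combine. *)
Lemma gauss_kernelE f h z : L2 f -> L2 h -> gauss_kernel f h z =
  ((expR (- (pi * sqnorm z)))%:C)%C * (inner f (bargmann (zc z)) * conjc (inner h (bargmann (zc z)))).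
Proof.
move=> Lf Lh; rewrite /gauss_kernel /stft.
set c := ((expR (- (pi / 2 * (z.1 ^+ 2 + z.2 ^+ 2))))%:C)%C * cis (pi * z.1 * z.2).
have -> : tfshift z (@gauss_window R) = (fun t => c * bargmann (zc z) t).
  by apply/funext => t; rewrite tfshift_gauss.
have Lb := @L2_bargmann R (zc z).
rewrite innerZr// innerZl// (innerC Lb Lh) mulrACA; congr (_ * _).
rewrite conjcM conjc_cis mulrACA -cisD addNr cis0 mulr1.
apply: complexP; rewrite ?ReM ?ImM /= ?oppr0 ?mulr0 ?mul0r ?addr0 ?subr0// -expRD.
by congr expR; rewrite /sqnorm; field.
Qed.

Definition kernel_sum f h N z : R[i] :=
  \sum_(j < N) \sum_(k < N) (inner f (herm j) * conjc (inner h (herm k))) * monomial j k z.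

Lemma kernel_sumE f h N z : kernel_sum f h N z =
  ((expR (- (pi * sqnorm z)))%:C)%C *
   ((\sum_(j < N) conjc (zc z) ^+ j * inner f (herm j)) *
    conjc (\sum_(k < N) conjc (zc z) ^+ k * inner h (herm k))).
Proof.
have cX (x : R[i]) n : conjc (x ^+ n) = conjc x ^+ n by exact: rmorphXn.
rewrite rmorph_sum big_distrlr mulr_sumr; apply: eq_bigr => j _.
rewrite mulr_sumr; apply: eq_bigr => k _; rewrite -[GRing.GRing_mul__canonical__Monoid_MulLaw _ _ _]/(_ * conjc _).
have -> : conjc (conjc (zc z) ^+ k * inner h (herm k)) = zc z ^+ k * conjc (inner h (herm k)).
  by rewrite conjcM cX conjcK.
by rewrite /monomial; ring.
Qed.

Lemma cmeasurable_kernel_sum f h N : cmeasurable setT (kernel_sum f h N : T * T -> R[i]).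
Proof.
apply: cmeasurable_sum => // j; apply: cmeasurable_sum => // k.
by apply: cmeasurableM => //; exact: cmeasurable_monomial.
Qed.

(** The remainder estimate at [N = 0] bounds the full coefficients, so one lemma controls both size
    and error of each factor. The 3 is 1 + 2: a partial sum is at most twice the bound of the full
    coefficient. *)
Lemma kernel_remainder f h b : L2 f -> L2 h -> 0 <= b ->
  exists K : R, 0 <= K /\ forall z N, normc (zc z) <= b ->
    normc (gauss_kernel f h z - kernel_sum f h N z) <= 2^-1 ^+ N * K.
Proof.
move=> Lf Lh b0.
have [Kf [Kf0 Hf]] := inner_bargmann_remainder Lf b0.
have [Kh [Kh0 Hh]] := inner_bargmann_remainder Lh b0.
exists (3 * (Kf * Kh)); split; first by apply: mulr_ge0 => //; exact: mulr_ge0.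
move=> z N zb; rewrite gauss_kernelE// kernel_sumE.
have := Hf _ N zb; have := Hf _ 0 zb; have := Hh _ N zb; have := Hh _ 0 zb.
rewrite !big_ord0 !subr0 !expr0 !mul1r.
move: (inner f _) (inner h _) (\sum_(_ < _) _) (\sum_(_ < _) _) => X Y X' Y'.
set q := 2^-1 ^+ N => Y0 Yq X0 Xq.
have q0 : 0 <= q by rewrite exprn_ge0// invr_ge0.
have q1 : q <= 1 by rewrite exprn_ile1// ?invr_ge0// invf_le1// ler1n.
rewrite -mulrBr ComplexField.Normc.normcM normc_real ger0_norm ?expR_ge0//.
rewrite (_ : X * conjc Y - X' * conjc Y' = (X - X') * conjc Y + X' * conjc (Y - Y')); last by rewrite rmorphB /=; ring.
have X'b : normc X' <= Kf + q * Kf.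
  rewrite (_ : X' = X - (X - X')); last by ring.
  by apply: (le_trans (normcB_le _ _)); apply: lerD.
apply: (@le_trans _ _ (1 * (q * Kf * Kh + (Kf + q * Kf) * (q * Kh)))).
  apply: ler_pM => //; rewrite ?expR_ge0 ?normc_ge0//.
    by rewrite -expR0 ler_expR lerNl oppr0 mulr_ge0 ?pi_ge0 ?sqnorm_ge0.
  apply: (le_trans (le_normcD _ _)); apply: lerD; rewrite ComplexField.Normc.normcM normc_conj.
    by apply: ler_pM => //; exact: normc_ge0.
  by apply: ler_pM => //; exact: normc_ge0.
rewrite mul1r.
have hA : 0 <= q * (Kf * Kh) by apply: mulr_ge0 => //; apply: mulr_ge0.
have : q * (q * (Kf * Kh)) <= 1 * (q * (Kf * Kh)) by apply: ler_wpM2r.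
clear -R; move: (Kf) (Kh) => a c; lra.
Qed.

Section radial_set.
Variables (Om : set (T * T)) (b : R).
Hypotheses (mO : measurable Om) (Ofin : (mu2 Om < +oo)%E) (b0 : 0 <= b).
Hypothesis Ob : forall z, Om z -> normc (zc z) <= b.
Hypothesis Orot : forall (c s : R) z, c ^+ 2 + s ^+ 2 = 1 -> Om (rot c s z) <-> Om z.
Local Notation moment := (@moment R Om).

(** The kernel is the pointwise limit on [Om] of the polynomial sums, which are measurable. *)
Lemma cmeasurable_kernel f h : L2 f -> L2 h -> cmeasurable Om (gauss_kernel f h).
Proof.
move=> Lf Lh; have [K [K0 HK]] := kernel_remainder Lf Lh b0.
have conv (P : R[i] -> R) : (forall x y, P x - P y = P (x - y)) -> (forall x, `|P x| <= normc x) ->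
    (forall N, measurable_fun Om (fun z => P (kernel_sum f h N z))) ->
    measurable_fun Om (fun z => P (gauss_kernel f h z)).
  move=> PB Pn mP.
  apply: (@measurable_fun_cvg _ _ _ Om (fun N z => P (kernel_sum f h N z)) _ mP).
  move=> z Oz; apply/cvgrPdist_lt => e e0.
  have [N0 N0P] := half_pow_lt K e0; near=> N.
  rewrite PB; apply: (le_lt_trans (Pn _)); apply: (le_lt_trans (HK z N (Ob Oz))).
  by apply: N0P; near: N; exact: nbhs_infty_ge.
have mN N := cmeasurable_kernel_sum f h N.
split; apply: conv.
- by move=> x y; rewrite ReD ReN.
- exact: Re_le_normc.
- by move=> N; apply: measurable_funTS; exact: (mN N).1.
- by move=> x y; rewrite ImD ImN.
- exact: Im_le_normc.
- by move=> N; apply: measurable_funTS; exact: (mN N).2.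
Unshelve. all: by end_near.
Qed.

Definition toep f h : R[i] := cintegral mu2 Om (gauss_kernel f h).

Lemma cintegral_kernel_sum f h N : cintegrable mu2 Om (kernel_sum f h N) /\
  cintegral mu2 Om (kernel_sum f h N) =
  \sum_(k < N) ((moment k)%:C)%C * (inner f (herm k) * conjc (inner h (herm k))).
Proof.
have im j k := cintegrable_monomial mO Ofin b0 Ob j k.
have iz j k : cintegrable mu2 Om (fun z => (inner f (herm j) * conjc (inner h (herm k))) * monomial j k z).
  by apply: cintegrableZl.
have is_ (j : 'I_N) : cintegrable mu2 Om (fun z => \sum_(k < N) (inner f (herm j) * conjc (inner h (herm k))) * monomial j k z).
  by apply: cintegrable_sum => // k; exact: iz.
split; first by apply: cintegrable_sum.
rewrite cintegral_sum//; apply: eq_bigr => j _.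
rewrite cintegral_sum//.
rewrite (bigD1 j)// big1 => [|k /andP[_ kj]].
  by rewrite [LHS]addr0 cintegralZl// (cintegral_monomial mO Orot) eqxx mulrC.
rewrite cintegralZl// (cintegral_monomial mO Orot) ifN ?mulr0//.
by rewrite eq_sym.
Qed.

(** Rotation invariance removes the off-diagonal part of the double sum, and the uniform remainder
    is integrated over a set of finite measure. *)
Lemma toep_remainder f h : L2 f -> L2 h -> exists K : R, forall N,
  normc (toep f h - \sum_(k < N) ((moment k)%:C)%C * (inner f (herm k) * conjc (inner h (herm k))))
    <= 2^-1 ^+ N * K.
Proof.
move=> Lf Lh; have [K [K0 HK]] := kernel_remainder Lf Lh b0.
exists (2 * Rintegral mu2 Om (fun=> K)) => N.
have [iN <-] := cintegral_kernel_sum f h N.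
have ic (c : R) := integrable_cst_radial mO Ofin c.
have mk := cmeasurable_kernel Lf Lh.
have mB : cmeasurable Om (fun z => gauss_kernel f h z + - 1 * kernel_sum f h N z).
  apply: cmeasurableD => //; apply: cmeasurableM => //.
  exact: cintegrable_measurable iN.
have le1 z : Om z -> normc (gauss_kernel f h z + - 1 * kernel_sum f h N z) <= 2^-1 ^+ N * K.
  by move=> Oz; rewrite mulN1r; apply: HK; exact: Ob.
have iB := cintegrable_le mO mB (ic _) le1.
have -> : toep f h = cintegral mu2 Om (fun z => gauss_kernel f h z + - 1 * kernel_sum f h N z)
   + cintegral mu2 Om (kernel_sum f h N).
  by rewrite -cintegralD//; apply: eq_cintegral => z _; rewrite mulN1r subrK.
rewrite addrK; apply: (le_trans (normc_cintegral_le mO mB (ic _) le1)).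
rewrite mulrCA ler_pM2l// -RintegralZl//; exact: ic.
Qed.

Definition radial_eig k : R := moment k * (pi ^+ k / k`!%:R).

Lemma L2_herm k : L2 (herm k). Proof. exact: L2_hermite. Qed.

Lemma herm_norm_neq0 k : ((pi ^+ k / k`!%:R : R)%:C)%C != 0.
Proof.
have p0 := @pi_gt0 R.
rewrite fmorph_eq0 mulf_neq0 ?invr_eq0 ?pnatr_eq0 -?lt0n ?fact_gt0//.
by rewrite expf_neq0// gt_eqF.
Qed.

Lemma toepE f h K (c : R[i]) N0 : L2 f -> L2 h ->
  (forall N, (N0 <= N)%N ->
   \sum_(k < N) ((moment k)%:C)%C * (inner f (herm k) * conjc (inner h (herm k))) = c) ->
  K = toep f h -> K = c.
Proof.
move=> Lf Lh E ->; have [K' HK] := toep_remainder Lf Lh.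
apply/eqP; rewrite -subr_eq0; apply/eqP; apply: (@half_pow_eq0 _ K' N0) => N N0N.
by rewrite -(E _ N0N).
Qed.

Lemma toep_herm f k : L2 f -> toep f (herm k) = ((radial_eig k)%:C)%C * inner f (herm k).
Proof.
move=> Lf; apply: (@toepE f (herm k) _ _ k.+1 Lf (L2_herm k)) => // N kN.
rewrite (bigD1 (Ordinal kN))// big1 => [|j /andP[_ jk]].
  rewrite [LHS]addr0 inner_hermite eqxx /radial_eig.
  by rewrite conjc_real rmorphM /=; ring.
have kj : (k == j) = false.
  by apply/negP => /eqP E; move/eqP: jk; apply; apply: val_inj; rewrite /= -E.
by rewrite inner_hermite kj conjc0 !mulr0.
Qed.

Lemma toep_herm_l h k : L2 h -> toep (herm k) h = ((radial_eig k)%:C)%C * inner (herm k) h.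
Proof.
move=> Lh; apply: (@toepE (herm k) h _ _ k.+1 (L2_herm k) Lh) => // N kN.
rewrite (bigD1 (Ordinal kN))// big1 => [|j /andP[_ jk]].
  rewrite [LHS]addr0 inner_hermite eqxx /radial_eig -(innerC (L2_herm k) Lh).
  by rewrite rmorphM /=; ring.
have kj : (k == j) = false.
  by apply/negP => /eqP E; move/eqP: jk; apply; apply: val_inj; rewrite /= -E.
by rewrite inner_hermite kj mul0r mulr0.
Qed.

(** The form sees [h] only through its Hermite coefficients. This is what bounds the positive
    eigenspaces from above. *)
Lemma toep_eq0 f h : L2 f -> L2 h -> (forall k, inner h (herm k) = 0) -> toep f h = 0.
Proof.
move=> Lf Lh h0; apply: (@toepE f h _ _ 0 Lf Lh) => // N _.
by rewrite big1// => k _; rewrite h0 conjc0 !mulr0.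
Qed.

Local Notation E := (eigenspace_of (loc_op (@gauss_window R) Om)).

Lemma eigenspace_herm k : E (radial_eig k) (herm k).
Proof.
split=> [||h Lh]; [exact: L2_herm|exact/L2Z/L2_herm|].
by rewrite innerZl//; [rewrite -toep_herm_l|exact: L2_herm].
Qed.

(** An eigenfunction [f] for [m] has coefficient 0 at each Hermite function with another diagonal
    entry. Subtracting its projection [p] leaves [f'] orthogonal to all Hermite functions, so
    [m * inner f f' = toep f f' = 0]. As [m > 0] and [f'] is also orthogonal to [p], it has norm
    0. *)
Lemma has_dim_eigenspace (m : R) (s : seq nat) : 0 < m -> uniq s ->
  (forall k, radial_eig k = m <-> k \in s) -> has_dim (E m) (size s).
Proof.
move=> m0 us sP.
exists (fun i => herm (nth 0%N s i)); split.
- move=> i; rewrite -(proj2 (sP (nth 0%N s i)) (mem_nth _ _))//; exact: eigenspace_herm.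
- move=> c c0 j.
  have LF (i : 'I_(size s)) : L2 (fun t => c i * herm (nth 0%N s i) t) by apply: L2Z; exact: L2_herm.
  have := ae_inner (L2_sum LF) (@L2_0 R) (L2_herm (nth 0%N s j)) c0.
  rewrite inner_suml//; last exact: L2_herm.
  have -> : inner (fun=> 0) (herm (nth 0%N s j)) = 0.
    by rewrite /inner -[RHS](cintegral0 mu1 setT); apply: eq_cintegral => t _; rewrite mul0r.
  rewrite (bigD1 j)//= big1 => [|i ij].
    rewrite addr0 innerZl; [|exact: L2_herm|exact: L2_herm].
    rewrite inner_hermite eqxx => /eqP; rewrite mulf_eq0 (negbTE (herm_norm_neq0 _)) orbF.
    by move/eqP.
  rewrite innerZl; [|exact: L2_herm|exact: L2_herm].
  have ij' : (i == j :> nat) = false := negbTE ij.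
  by rewrite inner_hermite nth_uniq// ij' mulr0.
- move=> f [Lf _ ef].
  have ef' h : L2 h -> ((m%:C)%C) * inner f h = toep f h by move=> Lh; rewrite -innerZl// ef.
  have f0 k : k \notin s -> inner f (herm k) = 0.
    move=> ks; have := ef' _ (L2_herm k); rewrite toep_herm// => /eqP.
    rewrite -subr_eq0 -mulrBl mulf_eq0 -rmorphB fmorph_eq0 subr_eq0 => /orP[/eqP e|/eqP//].
    by move: ks; rewrite (proj1 (sP k)).
  pose nrm k : R[i] := ((pi ^+ k / k`!%:R : R)%:C)%C.
  pose c (i : 'I_(size s)) := inner f (herm (nth 0%N s i)) / nrm (nth 0%N s i).
  exists c.
  have LF (i : 'I_(size s)) : L2 (fun t => c i * herm (nth 0%N s i) t) by apply: L2Z; exact: L2_herm.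
  pose p t := \sum_(i < size s) c i * herm (nth 0%N s i) t.
  have Lp : L2 p by apply: L2_sum.
  pose f' t := f t + -1 * p t.
  have Lf' : L2 f' by apply: L2D => //; exact: L2Z.
  have f'0 k : inner f' (herm k) = 0.
    have Lk := L2_herm k.
    rewrite innerDl//; last exact: L2Z.
    rewrite innerZl// inner_suml//.
    have [ks|ks] := boolP (k \in s).
      have ik : (index k s < size s)%N by rewrite index_mem.
      rewrite (bigD1 (Ordinal ik))//= big1 => [|i ij].
        rewrite innerZl//; last exact: L2_herm.
        by rewrite /c inner_hermite /= nth_index// eqxx divfK ?herm_norm_neq0// addr0 mulN1r subrr.
      rewrite innerZl//; last exact: L2_herm.
      rewrite inner_hermite ifN ?mulr0//; apply: contra ij => /eqP e.
      by apply/eqP; apply: val_inj; rewrite /= -e index_uniq.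
    rewrite big1 ?f0 ?mulr0 ?addr0// => i _.
    rewrite innerZl//; last exact: L2_herm.
    rewrite inner_hermite ifN ?mulr0//; apply: contra ks => /eqP <-; exact: mem_nth.
  have ff' : inner f f' = 0.
    have := ef' _ Lf'; rewrite toep_eq0// => /eqP; rewrite mulf_eq0 fmorph_eq0 gt_eqF//= => /eqP//.
  have pf' : inner p f' = 0.
    rewrite inner_suml// big1// => i _; rewrite innerZl//; last exact: L2_herm.
    by rewrite (innerC (L2_herm _) Lf') f'0 conjc0 mulr0.
  have : inner f' f' = 0.
    rewrite {1}/f' innerDl//; last exact: L2Z.
    by rewrite innerZl// ff' pf' mulr0 addr0.
  move=> /(inner_self_eq0 Lf'); apply: negligibleS => t /=; apply: contra_not.
  by rewrite /f' mulN1r => /eqP; rewrite subr_eq0 => /eqP.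
Qed.

End radial_set.

(** With more rows than columns, the matrix of coordinates has a nonzero left null vector, which
    would be a linear relation almost everywhere among the independent functions. *)
Lemma has_dim_le (S : set (R -> R[i])) n m : has_dim S n -> has_dim S m -> (n <= m)%N.
Proof.
move=> [F [SF indF _]] [G [_ _ spanG]]; rewrite leqNgt; apply/negP => mn.
have [M0 M0P] := choice (fun i => spanG _ (SF i)).
pose M := \matrix_(i < n, j < m) M0 i j.
have kn0 : kermx M != 0.
  by rewrite -mxrank_eq0 mxrank_ker -lt0n subn_gt0 (leq_ltn_trans (rank_leq_col _)).
have [i ri] : exists i, row i (kermx M) != 0.
  apply/existsP; rewrite -negb_forall; apply: contra kn0 => /forallP h.
  by apply/eqP/row_matrixP => i; rewrite row0; apply/eqP.
set v := row i (kermx M) in ri.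
have vM : v *m M = 0 by apply/sub_kermxP; exact: row_sub.
have v0 : forall l : 'I_n, v 0 l = 0.
  apply: (indF (fun l : 'I_n => v 0 l)).
  have H : {ae mu1, forall t, forall i, F i t = \sum_(j < m) M0 i j * G j t}.
    by apply: filter_forall => k; exact: M0P.
  apply: negligibleS H => t /=; apply: contra_not => H.
  under eq_bigr do rewrite H mulr_sumr.
  rewrite exchange_big /= big1// => k _.
  transitivity ((v *m M) 0 k * G k t); last by rewrite vM mxE mul0r.
  rewrite mxE mulr_suml; apply: eq_bigr => l _; rewrite !mxE; ring.
by case/eqP: ri; apply/rowP => l; rewrite v0 mxE.
Qed.

End radial_operator.

(** * Eigenvalue listings *)

Section listing.
Context {R : realType}.
Variables (A : (R -> R[i]) -> (R -> R[i]) -> Prop) (e : nat -> R).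
Hypothesis e_gt0 : forall k, 0 < e k.
Hypothesis e_cvg0 : forall x : R, 0 < x -> exists N, forall k, (N <= k)%N -> e k < x.
Hypothesis dimE : forall (m : R) (s : seq nat), 0 < m -> uniq s ->
  (forall k, e k = m <-> k \in s) -> has_dim (eigenspace_of A m) (size s).

Lemma max_outside (s : seq nat) : exists k, k \notin s /\ forall j, j \notin s -> e j <= e k.
Proof.
have [k0 k0s] : exists k0, k0 \notin s.
  exists (\max_(i <- s) i).+1; apply/negP => h.
  by have := @leq_bigmax_seq _ s xpredT id _ h isT; rewrite ltnn.
have [N HN] := e_cvg0 (e_gt0 k0).
have k0N : (k0 < N)%N by rewrite ltnNge; apply/negP => /HN; rewrite ltxx.
case: (@arg_maxP _ _ 'I_N (Ordinal k0N) (fun i => val i \notin s) (fun i => e (val i)) k0s) => i is_ imax.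
exists (val i); split=> // j js; case: (ltnP j N) => jN.
  exact: (imax (Ordinal jN)).
by apply: ltW; apply: (lt_le_trans (HN _ jN)); exact: (imax (Ordinal k0N)).
Qed.

(* Greedy rearrangement: repeatedly pick an index carrying the largest remaining value. *)
Lemma decreasing_rearrangement : exists s : nat -> nat,
  [/\ injective s, forall k, exists i, s i = k & forall i j, (i <= j)%N -> e (s j) <= e (s i)].
Proof.
have [f fP] := choice max_outside.
pose used := fix used n := if n is n'.+1 then f (used n') :: used n' else [::].
pose s n := f (used n).
have usedP n j : (j \in used n) <-> exists2 i, (i < n)%N & s i = j.
  elim: n => [|n IH]; first by split=> [//|[]].
  rewrite /= inE; split=> [/orP[/eqP ->|/IH]|[i' ]].
  - by exists n.
  - by case=> i ilt <-; exists i => //; rewrite ltnW.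
  - rewrite ltnS leq_eqVlt => /orP[/eqP -> <-|ilt sj]; first by rewrite eqxx.
    by apply/orP; right; apply/IH; exists i'.
have sinj : injective s.
  have lem i j : (i < j)%N -> s i <> s j.
    by move=> ij E; have [+ _] := fP (used j); rewrite -/(s j) -E => /negP; apply; apply/usedP; exists i.
  move=> i j sij; case: (ltngtP i j) => // h; first by case: (lem _ _ h).
  by case: (lem _ _ h).
exists s; split=> //.
- move=> k; apply: contrapT => nk.
  have kle i : e k <= e (s i).
    by apply: (fP (used i)).2; apply/negP => /usedP[i' _ si']; apply: nk; exists i'.
  have [N HN] := e_cvg0 (e_gt0 k).
  have slt i : (s i < N)%N by rewrite ltnNge; apply/negP => /HN; rewrite ltNge kle.
  have : injective (fun i : 'I_N.+1 => Ordinal (slt i)).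
    by move=> i j /(congr1 val)/= /sinj h; exact: val_inj.
  by move/leq_card; rewrite !card_ord ltnn.
- move=> i j; rewrite leq_eqVlt => /orP[/eqP -> //|ij].
  apply: (fP (used i)).2; apply/negP => /usedP[i' i'i] /sinj E.
  by move: i'i; rewrite E ltnNge ltnW.
Qed.

Lemma value_seq (m : R) : 0 < m -> exists s : seq nat, uniq s /\ forall k, e k = m <-> k \in s.
Proof.
move=> m0; have [N HN] := e_cvg0 m0.
exists [seq k <- iota 0 N | e k == m]; split; first by rewrite filter_uniq// iota_uniq.
move=> k; rewrite mem_filter mem_iota add0n; split=> [E|/andP[/eqP//]].
by rewrite E eqxx /= ltnNge; apply/negP => /HN; rewrite E ltxx.
Qed.

Lemma listing_exists : exists lam, eigenvalue_listing A lam.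
Proof.
have [s [sinj ssurj smono]] := decreasing_rearrangement.
exists (e \o s); split=> //= [i|m m0]; first exact: ltW.
have [q [uq qP]] := value_seq m0.
exists (size q); split; first exact: dimE.
have [t tP] := choice ssurj.
rewrite card_eq_sym; apply/card_set_bijP; exists (fun i => t (nth 0%N q i)); split.
- by move=> i /= iq; rewrite tP; apply/qP; exact: mem_nth.
- move=> i j /set_mem/= iq /set_mem/= jq /(congr1 s); rewrite !tP => /eqP.
  by rewrite nth_uniq// => /eqP.
- move=> i /= /qP siq; exists (index (s i) q); first by rewrite /= index_mem.
  by apply: sinj; rewrite tP nth_index.
Qed.

(** A listing is specified through multiplicities only, so [g] is glued from bijections between the
    level sets of [lam] and [e] at each positive value. *)
Lemma listing_bijection lam : eigenvalue_listing A lam -> exists g : nat -> nat,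
  [/\ forall i, 0 < lam i -> e (g i) = lam i,
      forall i j, 0 < lam i -> 0 < lam j -> g i = g j -> i = j &
      forall k, exists i, lam i = e k /\ g i = k].
Proof.
move=> [_ _ dimL].
have H (m : R) : exists h : nat -> nat, 0 < m -> set_bij [set i | lam i = m] [set k | e k = m] h.
  case: (ltP 0 m) => [m0|_]; last by exists id.
  have [n [En cn]] := dimL _ m0; have [q [uq qP]] := value_seq m0.
  have nE : n = size q.
    by apply/eqP; rewrite eqn_leq !(has_dim_le En (dimE m0 uq qP), has_dim_le (dimE m0 uq qP) En).
  have /card_set_bijP[h hP] : ([set i | lam i = m] #= [set k | e k = m])%card.
    rewrite (card_eq_trans cn)// nE; apply/card_set_bijP; exists (nth 0%N q); split.
    - by move=> i /= iq; apply/qP; exact: mem_nth.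
    - by move=> i j /set_mem/= iq /set_mem/= jq /eqP; rewrite nth_uniq// => /eqP.
    - by move=> k /= /qP kq; exists (index k q); rewrite /= ?index_mem ?nth_index.
  by exists h.
have [h hP] := choice H.
exists (fun i => h (lam i) i); split.
- by move=> i l0; have [F _ _] := hP _ l0; exact: (F i).
- move=> i j li lj E; have [Fi I _] := hP _ li; have [Fj _ _] := hP _ lj.
  have Eij : lam i = lam j by rewrite -(Fi i)// -(Fj j)// E.
  by apply: I; rewrite ?inE//= E Eij.
- move=> k; have [_ _ S] := hP _ (e_gt0 k).
  by have [i /= li hi] := S k erefl; exists i; rewrite li.
Qed.

(** [kth_eigenvalue] picks some listing; since one exists, the pick is a listing. *)
Lemma kth_listing : eigenvalue_listing A (fun k => kth_eigenvalue A k.+1).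
Proof.
have [lam hlam] := listing_exists.
by have := @xgetPex _ (fun=> 0) [set lam | eigenvalue_listing A lam] (ex_intro _ _ hlam).
Qed.

(** Together with [kth_eigenvalue_lt], this replaces the reordering by counting: bounds on the
    number of entries above a level become bounds on the ordered eigenvalue. *)
Lemma kth_eigenvalue_gt k (x : R) : 0 <= x -> x < kth_eigenvalue A k.+1 ->
  exists s : seq nat, [/\ uniq s, size s = k.+1 & forall j, j \in s -> x < e j].
Proof.
move=> x0 xk; have [mono _ _] := kth_listing.
have [g [g1 g2 _]] := listing_bijection kth_listing.
have gt i : (i < k.+1)%N -> x < kth_eigenvalue A i.+1.
  by move=> ik; apply: (lt_le_trans xk); exact: (mono i k).
exists (map g (iota 0 k.+1)); split.
- rewrite map_inj_in_uniq ?iota_uniq// => i j; rewrite !mem_iota !add0n => /andP[_ /gt hi] /andP[_ /gt hj].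
  by apply: g2; exact: le_lt_trans x0 _.
- by rewrite size_map size_iota.
- move=> j /mapP[i' ]; rewrite mem_iota add0n => /andP[_ /gt hi] ->.
  by rewrite g1// (le_lt_trans x0).
Qed.

Lemma kth_eigenvalue_lt k (x : R) (s : seq nat) : kth_eigenvalue A k.+1 < x ->
  uniq s -> (forall j, j \in s -> x <= e j) -> (size s <= k)%N.
Proof.
move=> xk us sx; have [mono _ _] := kth_listing.
have [g [_ _ g3]] := listing_bijection kth_listing.
have [t tP] := choice g3.
have tinj : injective t by move=> i j E; rewrite -(tP i).2 -(tP j).2 E.
rewrite -(size_map t) -(size_iota 0 k); apply: uniq_leq_size; first by rewrite map_inj_uniq.
move=> _ /mapP[j js ->]; rewrite mem_iota add0n /= ltnNge; apply/negP => kt.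
have := sx _ js; rewrite -(tP j).1 leNgt => /negP; apply.
by apply: le_lt_trans xk; exact: (mono k (t j)).
Qed.

End listing.

(** * Counting eigenvalues *)

Section natural_counts.
Context {R : realType}.
Implicit Types (L U : R) (s : seq nat).

(** The condition [L <= U + 1] keeps the bound nonnegative when the interval contains no integer. *)
Lemma count_itv_le L U s : uniq s -> L <= U + 1 ->
  (count (fun j => L <= j%:R <= U) s)%:R <= U - L + 1.
Proof.
move=> us LU; rewrite -size_filter; set q := [seq j <- s | _].
have uq : uniq q by rewrite filter_uniq.
have qP j : j \in q -> L <= j%:R <= U by rewrite mem_filter => /andP[].
case: (pselect (exists j, j \in q)) => [ex|nex]; last first.
  have -> : q = [::] by case: q nex {uq qP} => // j q []; exists j; rewrite inE eqxx.
  by rewrite /=; lra.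
case: (ex_minnP ex) => p pq pmin.
have /andP[Lp pU] := qP _ pq.
have U0 : 0 <= U by apply: le_trans pU.
have /andP[tU _] := Num.Theory.truncn_itv U0.
have ptr : (p <= Num.truncn U)%N by rewrite Num.Theory.truncn_ge_nat.
have : (size q <= size (iota p (Num.truncn U - p).+1))%N.
  apply: uniq_leq_size => // j jq; rewrite mem_iota pmin//= addnS ltnS subnKC//.
  by rewrite Num.Theory.truncn_ge_nat//; have /andP[] := qP _ jq.
rewrite size_iota -(ler_nat R) -natr1 natrB// => h.
by move: h tU Lp; lra.
Qed.

Lemma count_itv_ge L U (M : nat) : 0 <= L -> U < M%:R ->
  U - L - 1 <= (count (fun j => L <= j%:R <= U) (iota 0 M))%:R.
Proof.
move=> L0 UM; case: (ltP U (L + 1)) => LU; first by apply: (@le_trans _ _ 0) => //; lra.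
have U0 : 0 <= U by lra.
have /andP[tU Ut] := Num.Theory.truncn_itv U0.
have /andP[tL Lt] := Num.Theory.truncn_itv L0.
(* Starting after [truncn L] may drop [L] itself when it is an integer; the [- 1] in the bound pays
   for this. *)
set p := (Num.truncn L).+1 in Lt; set q := Num.truncn U in tU Ut.
have pU : p%:R <= U by apply: le_trans LU; rewrite /p -natr1 lerD2r.
have pq : (p <= q)%N by rewrite Num.Theory.truncn_ge_nat.
rewrite -size_filter.
have h : (size (iota p (q - p).+1) <= size [seq j : nat <- iota 0 M | (L <= j%:R <= U)%R])%N.
  apply: uniq_leq_size; first exact: iota_uniq.
  move=> j; rewrite mem_iota addnS ltnS subnKC// => /andP[pj jq].
  have jU : j%:R <= U by apply: le_trans tU; rewrite ler_nat.
  rewrite mem_filter jU andbT mem_iota add0n /= -(ltr_nat R) (le_lt_trans jU UM) andbT.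
  by apply: (le_trans (ltW Lt)); rewrite ler_nat.
move: h; rewrite size_iota -(ler_nat R) -natr1 natrB// => h.
have : p%:R <= L + 1 by rewrite /p -natr1 lerD2r.
by move: h Ut; rewrite -natr1; lra.
Qed.

Lemma count_sum (p : pred nat) s : count p s = (\sum_(j <- s) p j)%N.
Proof. by elim: s => [|j s IH] /=; rewrite ?big_nil// big_cons IH. Qed.

Lemma size_le_sum_count (I : finType) (p : I -> pred nat) s :
  (forall j, j \in s -> exists i, p i j) -> (size s <= \sum_i count (p i) s)%N.
Proof.
move=> h; under eq_bigr do rewrite count_sum.
rewrite exchange_big /= -sum1_size big_seq [leqRHS]big_seq; apply: leq_sum => j /h[i pij].
by rewrite (bigD1 i)//= pij.
Qed.

Lemma sum_count_le_size (I : finType) (p : I -> pred nat) s :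
  (forall i k j, p i j -> p k j -> i = k) ->
  (\sum_i count (p i) s <= size [seq j <- s | [exists i, p i j]])%N.
Proof.
move=> h; under eq_bigr do rewrite count_sum.
rewrite exchange_big /= size_filter count_sum; apply: leq_sum => j _.
case: existsP => [[i pij]|np].
  rewrite (bigD1 i)//= pij big1// => k /negP ki.
  by case E : (p k j) => //; case: ki; rewrite (h _ _ _ E pij).
by rewrite big1// => i _; case E : (p i j) => //; case: np; exists i.
Qed.

End natural_counts.

(** * Counting the diagonal entries of a union of annuli; [a] and [b] stand for [pi] times the
    squared radii *)

Section annuli_counting.
Context {R : realType}.
Variables (n : nat) (a b : 'I_n -> R) (delta B : R).
Hypotheses (delta0 : 0 < delta) (B1 : 1 <= B).
Hypothesis a0 : forall i, a i = 0 \/ delta <= a i.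
Hypothesis ab : forall i, a i + delta <= b i.
Hypothesis bB : forall i, b i <= B.
Hypothesis disj : forall i j, i != j -> b i + delta <= a j \/ b j + delta <= a i.
Implicit Types (r x t : R) (i : 'I_n) (j : nat).

(** A third of the separation: neighbourhoods of width [kappa] of distinct annuli stay disjoint, and
    so do those of the two ends of one annulus. [E] is the resulting Chebyshev constant, [c0] the
    Berry-Esseen constant for endpoints at least [delta]. *)
Let kappa := delta / 3.
Let E := B / kappa ^+ 2.
Let c0 := 3000 / Num.sqrt delta.

Let a_ge0 i : 0 <= a i.
Proof. by case: (a0 i) => [->|]//; apply: le_trans; exact: ltW. Qed.

Let b_ge i : delta <= b i.
Proof. by have := ab i; have := a_ge0 i; lra. Qed.

Let kappa0 : 0 < kappa. Proof. by rewrite divr_gt0. Qed.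

Let E0 : 0 <= E.
Proof. by rewrite divr_ge0 ?sqr_ge0//; have := B1; lra. Qed.

Let chebyshev_bound r t (d : R) : 1 <= r -> 0 <= t -> t <= B -> r ^+ 2 * kappa <= d ->
  r ^+ 2 * t / d ^+ 2 <= E / r.
Proof.
move=> r1 t0 tB rd; have r0 : 0 < r by lra.
have k0 := kappa0; have rk0 : 0 < r ^+ 2 * kappa by rewrite mulr_gt0// exprn_gt0.
apply: (@le_trans _ _ (r ^+ 2 * B / (r ^+ 2 * kappa) ^+ 2)).
  apply: ler_pM; [by rewrite mulr_ge0// sqr_ge0|by rewrite invr_ge0 sqr_ge0| |].
    by rewrite ler_pM2l// exprn_gt0.
  by rewrite lef_pV2 ?posrE ?exprn_gt0 ?(lt_le_trans rk0)// lerXn2r ?nnegrE// ltW// (lt_le_trans rk0).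
have -> : r ^+ 2 * B / (r ^+ 2 * kappa) ^+ 2 = E / r * r^-1.
  by rewrite /E; field; rewrite !gt_eqF.
have Er : 0 <= E / r by apply: divr_ge0; [exact: E0|exact: ltW].
by apply: ler_piMr => //; rewrite invf_le1.
Qed.

Let cdf_far_right r t j : 1 <= r -> 0 <= t -> t <= B -> r ^+ 2 * (t + kappa) <= j%:R ->
  gamma_cdf j (r ^+ 2 * t) <= E / r.
Proof.
move=> r1 t0 tB h; have k0 := kappa0.
have rk0 : 0 < r ^+ 2 * kappa by rewrite mulr_gt0// exprn_gt0//; lra.
have h1 : r ^+ 2 * t + r ^+ 2 * kappa <= j%:R by rewrite -mulrDr.
have h2 : j%:R + 1 = j.+1%:R :> R by rewrite natr1.
apply: le_trans (chebyshev_bound r1 t0 tB (_ : _ <= j.+1%:R - r ^+ 2 * t)); last by lra.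
by apply: gamma_cdf_le; [rewrite mulr_ge0// sqr_ge0|lra].
Qed.

Let cdf_far_left r t j : 1 <= r -> 0 <= t -> t <= B -> j%:R <= r ^+ 2 * (t - kappa) ->
  1 - gamma_cdf j (r ^+ 2 * t) <= E / r.
Proof.
move=> r1 t0 tB h; have k0 := kappa0.
have rk0 : 0 < r ^+ 2 * kappa by rewrite mulr_gt0// exprn_gt0//; lra.
have h1 : j%:R <= r ^+ 2 * t - r ^+ 2 * kappa by rewrite -mulrBr.
apply: le_trans (chebyshev_bound r1 t0 tB (_ : _ <= r ^+ 2 * t - j%:R)); last by lra.
by apply: gamma_cdfC_le; lra.
Qed.

Let c0_ge0 : 0 <= c0.
Proof. by apply: divr_ge0; [exact: ler0n|exact: sqrtr_ge0]. Qed.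

Let cdf_near r t j : 1 <= r -> delta <= t ->
  `|gamma_cdf j (r ^+ 2 * t) - gtail ((j%:R - r ^+ 2 * t) / (r * Num.sqrt (2 * t)))| <= c0 / r.
Proof.
move=> r1 dt; have r0 : 0 < r by lra.
have t0 : 0 < t by apply: lt_le_trans dt.
have y0 : 0 < r ^+ 2 * t by rewrite mulr_gt0// exprn_gt0.
have := berry_esseen j y0; rewrite /gauss_cdf.
have -> : Num.sqrt (2 * (r ^+ 2 * t)) = r * Num.sqrt (2 * t).
  by rewrite mulrCA sqrtrM ?sqr_ge0// sqrtr_sqr gtr0_norm.
move=> h; apply: (le_trans h).
have : (0 : R) <= 3000 := ler0n _ _.
rewrite /c0; move: (3000 : R) => K K0 {h}.
rewrite sqrtrM ?sqr_ge0// sqrtr_sqr gtr0_norm// -[leRHS]mulrA -invfM; apply: ler_wpM2l => //.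
rewrite lef_pV2 ?posrE ?mulr_gt0 ?sqrtr_gt0//.
by rewrite [leRHS]mulrC ler_pM2r// ler_sqrt// ltW.
Qed.

Let cdf_le r t x j : 1 <= r -> delta <= t -> r ^+ 2 * t + x * (r * Num.sqrt (2 * t)) <= j%:R ->
  gamma_cdf j (r ^+ 2 * t) <= gtail x + c0 / r.
Proof.
move=> r1 dt h; have r0 : 0 < r by lra.
have t0 : 0 < t by apply: lt_le_trans dt.
have q0 : 0 < r * Num.sqrt (2 * t) by rewrite mulr_gt0// sqrtr_gt0 mulr_gt0.
have hx : x <= (j%:R - r ^+ 2 * t) / (r * Num.sqrt (2 * t)) by rewrite ler_pdivlMr//; lra.
have := cdf_near j r1 dt; have := gtail_le hx; rewrite ler_norml.
move: (gtail _) (gamma_cdf _ _) (gtail _) (c0 / r) => u v w z; lra.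
Qed.

Let cdf_ge r t x j : 1 <= r -> delta <= t -> j%:R <= r ^+ 2 * t + x * (r * Num.sqrt (2 * t)) ->
  gtail x - c0 / r <= gamma_cdf j (r ^+ 2 * t).
Proof.
move=> r1 dt h; have r0 : 0 < r by lra.
have t0 : 0 < t by apply: lt_le_trans dt.
have q0 : 0 < r * Num.sqrt (2 * t) by rewrite mulr_gt0// sqrtr_gt0 mulr_gt0.
have hx : (j%:R - r ^+ 2 * t) / (r * Num.sqrt (2 * t)) <= x by rewrite ler_pdivrMr//; lra.
have := cdf_near j r1 dt; have := gtail_le hx; rewrite ler_norml.
move: (gtail _) (gamma_cdf _ _) (gtail _) (c0 / r) => u v w z; lra.
Qed.

Definition annuli_term r j i : R := gamma_cdf j (r ^+ 2 * b i) - gamma_cdf j (r ^+ 2 * a i).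
Definition annuli_eig r j : R := \sum_(i < n) annuli_term r j i.

Let ra0 r i : 0 <= r ^+ 2 * a i. Proof. by rewrite mulr_ge0// sqr_ge0. Qed.
Let b0 i : 0 <= b i. Proof. by apply: le_trans (b_ge i); exact: ltW. Qed.
Let rb0 r i : 0 <= r ^+ 2 * b i. Proof. by rewrite mulr_ge0// sqr_ge0. Qed.
Let aB i : a i <= B. Proof. by have := ab i; have := bB i; have := delta0; lra. Qed.

Lemma annuli_term_ge0 r j i : 0 <= annuli_term r j i.
Proof.
rewrite subr_ge0; apply: gamma_cdf_homo => //.
by apply: ler_wpM2l; [exact: sqr_ge0|have := ab i; have := delta0; lra].
Qed.

(** After scaling, at most one annulus comes within [kappa] of a given index; every other term is at
    most [E / r] by the tail bounds. *)
Lemma annuli_eig_le r j (M : R) : 1 <= r -> 0 <= M -> (forall i, annuli_term r j i <= M) ->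
  annuli_eig r j <= M + n%:R * E / r.
Proof.
move=> r1 M0 TM; have r0 : 0 < r by lra.
have Er0 : 0 <= E / r by rewrite divr_ge0// ltW.
have k0 := kappa0; have kE : delta = 3 * kappa by rewrite /kappa; field.
have far i : r ^+ 2 * (b i + kappa) <= j%:R \/ j%:R <= r ^+ 2 * (a i - kappa) ->
    annuli_term r j i <= E / r.
  case=> h.
    have := cdf_far_right r1 (b0 i) (bB i) h; have := gamma_cdf_ge0 j (ra0 r i).
    by rewrite /annuli_term; lra.
  have := cdf_far_left r1 (a_ge0 i) (aB i) h; have := gamma_cdf_le1 j (rb0 r i).
  by rewrite /annuli_term; lra.
rewrite -mulrA mulr_natl.
case: (pselect (exists i, ~ (r ^+ 2 * (b i + kappa) <= j%:R \/ j%:R <= r ^+ 2 * (a i - kappa)))) => [[i hi]|nh]; last first.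
  apply: (@le_trans _ _ (\sum_(i < n) (E / r))); last by rewrite sumr_const card_ord lerDr.
  by apply: ler_sum => i _; apply: far; apply: contrapT => h; apply: nh; exists i.
have hb : j%:R < r ^+ 2 * (b i + kappa) by rewrite ltNge; apply/negP => h; apply: hi; left.
have ha : r ^+ 2 * (a i - kappa) < j%:R by rewrite ltNge; apply/negP => h; apply: hi; right.
rewrite /annuli_eig (bigD1 i)//=; apply: lerD => //.
apply: (@le_trans _ _ (\sum_(k < n | k != i) (E / r))).
  apply: ler_sum => k ki; apply: far.
  case: (disj ki) => h; [left|right].
    by apply: le_trans (ltW ha); apply: ler_wpM2l; [exact: sqr_ge0|move: h; rewrite kE; lra].
  by apply: (le_trans (ltW hb)); apply: ler_wpM2l; [exact: sqr_ge0|move: h; rewrite kE; lra].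
rewrite sumr_const -[leLHS]mulr_natl -[leRHS]mulr_natl ler_wpM2r// ler_nat.
by rewrite -[leqRHS]card_ord; exact: max_card.
Qed.

(** For negative [x] the intervals shrink and may become empty. For [a i = 0] the lower endpoint is
    0 whatever [x] is. *)
Let Lo r x i := r ^+ 2 * a i - x * (r * Num.sqrt (2 * a i)).
Let Up r x i := r ^+ 2 * b i + x * (r * Num.sqrt (2 * b i)).

Lemma annuli_eig_upper r x j : 1 <= r -> (forall i, ~ (Lo r x i <= j%:R <= Up r x i)) ->
  annuli_eig r j <= gtail x + c0 / r + n%:R * E / r.
Proof.
move=> r1 h; have r0 : 0 < r by lra.
have cr0 : 0 <= c0 / r by apply: divr_ge0; [exact: c0_ge0|exact: ltW].
have g0 := gtail_ge0 x.
apply: annuli_eig_le => //; first by rewrite addr_ge0.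
move=> i; have /negP := h i; rewrite negb_and -!ltNge => /orP[hj|hj].
  have da : delta <= a i.
    (* A full disc has no index below its interval, so the inner end is a true circle here. *)
    case: (a0 i) => // ai0; move: hj; rewrite /Lo ai0 !mulr0 sqrtr0 !mulr0 subr0.
    by rewrite ltNge ler0n.
  have hj' : j%:R <= r ^+ 2 * a i + - x * (r * Num.sqrt (2 * a i)).
    by rewrite mulNr; apply: ltW.
  have := cdf_ge r1 da hj'; have := gamma_cdf_le1 j (rb0 r i).
  by rewrite gtailN /annuli_term; move: (c0 / r) => z; lra.
have := cdf_le r1 (b_ge i) (ltW hj); have := gamma_cdf_ge0 j (ra0 r i).
by rewrite /annuli_term; move: (c0 / r) => z; lra.
Qed.

(** The index is far from one of the two ends. Away from the inner end the subtracted term is at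
    most [E / r]; close to it, the term of the outer end is within [E / r] of 1. *)
Lemma annuli_eig_lower r x j i : 1 <= r -> Lo r x i <= j%:R <= Up r x i ->
  gtail x - (c0 + E) / r <= annuli_eig r j.
Proof.
move=> r1 /andP[hL hU]; have r0 : 0 < r by lra.
have k0 := kappa0; have kE : delta = 3 * kappa by rewrite /kappa; field.
apply: (@le_trans _ _ (annuli_term r j i)); last first.
  rewrite /annuli_eig (bigD1 i)//= lerDl sumr_ge0// => k _; exact: annuli_term_ge0.
rewrite mulrDl /annuli_term.
have cr0 : 0 <= c0 / r by apply: divr_ge0; [exact: c0_ge0|exact: ltW].
have Er0 : 0 <= E / r by rewrite divr_ge0// ltW.
case: (leP (r ^+ 2 * (a i + kappa)) j%:R) => hj.
  have := cdf_far_right r1 (a_ge0 i) (aB i) hj; have := cdf_ge r1 (b_ge i) hU.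
  by move: (c0 / r) (E / r) => u v; lra.
have hj' : j%:R <= r ^+ 2 * (b i - kappa).
  apply: (le_trans (ltW hj)); apply: ler_wpM2l; first exact: sqr_ge0.
  by have := ab i; rewrite kE; lra.
have := cdf_far_left r1 (b0 i) (bB i) hj'.
case: (a0 i) => [ai0|da].
  rewrite ai0 mulr0 gamma_cdf0; have := gtail_le1 x; move: cr0 Er0.
  by move: (c0 / r) (E / r) => u v; lra.
have hL' : r ^+ 2 * a i + - x * (r * Num.sqrt (2 * a i)) <= j%:R by rewrite mulNr.
have := cdf_le r1 da hL'; rewrite gtailN.
by move: (c0 / r) (E / r) => u v; lra.
Qed.

(** For [x > - eta * r] no interval is empty ([narrow]), and for [x < eta * r] the intervals of
    distinct annuli are disjoint ([shift_small]). Beyond these thresholds [gtail x] is within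
    [eta^-1 / r] of 1 or 0. The [4 * B] bounds the sum of two square roots. *)
Let eta := delta / (4 * B).

Let eta0 : 0 < eta. Proof. by rewrite divr_gt0//; have := B1; lra. Qed.

Let sqrt_bound t : t <= B -> Num.sqrt (2 * t) <= 2 * B.
Proof.
move=> tB; have b1 := B1; have B2 : 0 <= 2 * B by lra.
rewrite -[leRHS](ger0_norm B2) -sqrtr_sqr; apply: ler_wsqrtr.
have : 0 <= (2 * B) * (2 * B - 1) by apply: mulr_ge0; lra.
by rewrite expr2; lra.
Qed.

Let narrow r x i : 1 <= r -> Up r x i < Lo r x i -> x <= - (eta * r).
Proof.
rewrite /Up /Lo => r1 h; have r0 : 0 < r by lra.
have d0 := delta0; have b1 := B1.
have sa := sqrt_bound (aB i); have sb := sqrt_bound (bB i).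
have sa0 := sqrtr_ge0 (2 * a i); have sb0 := sqrtr_ge0 (2 * b i).
move: (Num.sqrt _) (Num.sqrt _) sa sb sa0 sb0 h => u v sa sb sa0 sb0 h.
have h1 : r * delta <= r * (b i - a i) by rewrite ler_pM2l//; have := ab i; lra.
have h2 : r * (r * (b i - a i) + x * (u + v)) < 0 by rewrite expr2 in h; lra.
have h3 : r * (b i - a i) + x * (u + v) < 0 by rewrite pmulr_rlt0 in h2.
have rd : 0 < r * delta by rewrite mulr_gt0.
case: (leP 0 x) => x0.
  have : 0 <= x * (u + v) by rewrite mulr_ge0// addr_ge0.
  by lra.
have : 0 <= - x * (4 * B - (u + v)) by apply: mulr_ge0; lra.
move=> h4; rewrite lerNr /eta mulrAC ler_pdivrMr ?mulr_gt0//; lra.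
Qed.

Let shift_small r x t : 1 <= r -> 0 < t -> t <= B -> x < eta * r ->
  x * (r * Num.sqrt (2 * t)) < r ^+ 2 * (delta / 2).
Proof.
move=> r1 t0 tB xr; have r0 : 0 < r by lra.
have d0 := delta0; have b1 := B1.
have s0 : 0 < Num.sqrt (2 * t) by rewrite sqrtr_gt0 mulr_gt0.
have e0 := eta0.
apply: (@lt_le_trans _ _ (eta * r * (r * Num.sqrt (2 * t)))); first by rewrite ltr_pM2r// mulr_gt0.
apply: (@le_trans _ _ (eta * r * (r * (2 * B)))).
  by apply: ler_wpM2l; [rewrite ltW// mulr_gt0|apply: ler_wpM2l; [exact: ltW|exact: sqrt_bound]].
rewrite (_ : eta * r * (r * (2 * B)) = r ^+ 2 * (delta / 2))//.
by rewrite /eta; field; rewrite gt_eqF//; lra.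
Qed.

Let A := \sum_(i < n) (b i - a i).
Let P := \sum_(i < n) (Num.sqrt (a i) + Num.sqrt (b i)).

Let sum_len r x : \sum_(i < n) (Up r x i - Lo r x i) = r ^+ 2 * A + x * (Num.sqrt 2 * r * P).
Proof.
rewrite /A /P !mulr_sumr -big_split /=; apply: eq_bigr => i _.
by rewrite /Up /Lo !sqrtrM//; ring.
Qed.

Lemma annuli_kth_bound : (0 < n)%N -> exists C : R, 0 < C /\ forall r k (m : R), 1 <= r -> 0 <= m ->
  (forall x, 0 <= x -> x < m ->
     exists s : seq nat, [/\ uniq s, size s = k.+1 & forall j, j \in s -> x < annuli_eig r j]) ->
  (forall x (s : seq nat), m < x -> uniq s -> (forall j, j \in s -> x <= annuli_eig r j) -> (size s <= k)%N) ->
  `|m - gtail ((k.+1%:R - r ^+ 2 * A) / (Num.sqrt 2 * r * P))| <= C / r.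
Proof.
move=> n0.
have P0 : 0 < P.
  rewrite /P (bigD1 (Ordinal n0))//=; apply: ltr_wpDr.
    by apply: sumr_ge0 => i _; rewrite addr_ge0 ?sqrtr_ge0.
  by rewrite ltr_wpDl ?sqrtr_ge0// sqrtr_gt0; apply: lt_le_trans (b_ge _); exact: delta0.
have e0 := eta0; have ei0 : 0 < eta^-1 by rewrite invr_gt0.
(* Rounding at the ends of [n] intervals moves [x] by at most [(n + 1) / w]; by the Lipschitz bound
   this costs [D / r]. The errors of the entries themselves go into [C0]. *)
pose D := n.+1%:R / (Num.sqrt 2 * P).
have s2 : 0 < Num.sqrt 2 :> R by rewrite sqrtr_gt0.
have D0 : 0 < D by rewrite divr_gt0// mulr_gt0.
pose C0 := c0 + n%:R * E + E + eta^-1.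
have C00 : 0 < C0.
  apply: ltr_wpDl => //; apply: addr_ge0; last exact: E0.
  by apply: addr_ge0; [exact: c0_ge0|apply: mulr_ge0; [exact: ler0n|exact: E0]].
exists (C0 + D); split; first by rewrite addr_gt0.
move=> r k m r1 m0 Hgt Hlt; have r0 : 0 < r by lra.
set w := Num.sqrt 2 * r * P; have w0 : 0 < w by rewrite !mulr_gt0.
set xk := (_ - _) / w.
have Dr : n.+1%:R / w = D / r by rewrite /D /w; field; rewrite !gt_eqF.
have cr0 : 0 <= c0 / r by apply: divr_ge0; [exact: c0_ge0|exact: ltW].
have Er0 : 0 <= E / r by apply: divr_ge0; [exact: E0|exact: ltW].
have nEr0 : 0 <= n%:R * E / r by rewrite -mulrA mulr_ge0.
have eir0 : 0 < eta^-1 / r by rewrite divr_gt0.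
have C0r : C0 / r = c0 / r + n%:R * E / r + E / r + eta^-1 / r by rewrite /C0 !mulrDl.
have eri : (eta * r)^-1 = eta^-1 / r by rewrite invfM.
have er0 : 0 < eta * r by rewrite mulr_gt0.
rewrite mulrDl ler_norml; apply/andP; split; last first.
(* Chosen so that the total length of the intervals plus the rounding error [n] is [k], too little
   for the [k + 1] indices in [s]. *)
- pose x := (k%:R - n%:R - r ^+ 2 * A) / w.
  have xw : x * w = k%:R - n%:R - r ^+ 2 * A by rewrite /x divfK// gt_eqF.
  have xxk : xk - x = D / r.
    rewrite -Dr /xk /x -mulrBl; congr (_ / _); rewrite -[k.+1%:R]natr1 -[n.+1%:R]natr1; ring.
  have xle : x <= xk by rewrite -subr_ge0 xxk divr_ge0 ?ltW.
  have := gtail_lipschitz xle; rewrite xxk => gl.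
  suff : m <= gtail x + C0 / r by move: gl; move: (C0 / r) (D / r) (gtail x) (gtail xk) => *; lra.
  rewrite leNgt; apply/negP => mX.
  have [s [us sk sX]] := Hgt _ (addr_ge0 (gtail_ge0 x) (ltW (divr_gt0 C00 r0))) mX.
  case: (pselect (exists i, Up r x i < Lo r x i)) => [[i hi]|hn].
    (* With an empty interval [x] is so negative that [gtail x] is nearly 1, while no entry exceeds
       [1 + n * E / r]. *)
    have xn := narrow r1 hi.
    have := gtail_le xn; have := gtail_le_inv er0; rewrite gtailN eri => g1 g2.
    have j0s : nth 0%N s 0 \in s by rewrite mem_nth// sk.
    have := sX _ j0s.
    have : annuli_eig r (nth 0%N s 0) <= 1 + n%:R * E / r.
      apply: annuli_eig_le => // i'; rewrite /annuli_term.
      have := gamma_cdf_le1 (nth 0%N s 0) (rb0 r i'); have := gamma_cdf_ge0 (nth 0%N s 0) (ra0 r i').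
      by move: (gamma_cdf _ _) (gamma_cdf _ _) => p q; lra.
    rewrite C0r; move: g1 g2 cr0 Er0 nEr0.
    move: (annuli_eig _ _) (gtail x) (gtail _) (c0 / r) (n%:R * E / r) (E / r) (eta^-1 / r) => *; lra.
  have hLU i : Lo r x i <= Up r x i by rewrite leNgt; apply/negP => h; apply: hn; exists i.
  have cov : (size s <= \sum_(i < n) count (fun j : nat => (Lo r x i <= j%:R <= Up r x i)%R) s)%N.
    apply: size_le_sum_count => j js; apply: contrapT => nj.
    have := annuli_eig_upper r1 (_ : forall i, ~ (Lo r x i <= j%:R <= Up r x i)).
    move=> /(_ (fun i h => nj (ex_intro _ i h))); have := sX _ js.
    rewrite C0r; move: Er0 eir0.
    move: (annuli_eig _ _) (gtail x) (c0 / r) (n%:R * E / r) (E / r) (eta^-1 / r) => *; lra.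
  move: cov; rewrite sk -(ler_nat R) natr_sum leNgt => /negP; apply.
  apply: (@le_lt_trans _ _ (\sum_(i < n) (Up r x i - Lo r x i + 1))).
    apply: ler_sum => i _; apply: count_itv_le => //.
    by have := hLU i; lra.
  rewrite big_split /= sum_len -/w xw sumr_const card_ord -[k.+1%:R]natr1.
  by rewrite (_ : r ^+ 2 * A + _ + _ = k%:R); [rewrite ltrDl|ring].
(* Chosen so that the total length minus the rounding error [n] is [k + 1], too much for the at most
   [k] entries above the level. *)
- pose x := (k.+1%:R + n%:R - r ^+ 2 * A) / w.
  have xw : x * w = k.+1%:R + n%:R - r ^+ 2 * A by rewrite /x divfK// gt_eqF.
  have xxk : x - xk = n%:R / w.
    by rewrite /xk /x -mulrBl; congr (_ / _); ring.
  have nw : n%:R / w <= D / r by rewrite -Dr ler_pM2r ?invr_gt0// ler_nat.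
  have xle : xk <= x by rewrite -subr_ge0 xxk divr_ge0// ltW.
  have := gtail_lipschitz xle; rewrite xxk => gl.
  suff : gtail x - C0 / r <= m by move: gl nw; move: (C0 / r) (D / r) (gtail x) (gtail xk) (n%:R / w) => *; lra.
  rewrite leNgt; apply/negP => mX.
  have X0 : 0 < gtail x - C0 / r by apply: le_lt_trans mX.
  (* Otherwise [gtail x] would be at most [eta^-1 / r], contradicting [C0 / r < gtail x]. *)
  have xer : x < eta * r.
    rewrite ltNge; apply/negP => h; have := gtail_le h; have := gtail_le_inv er0.
    rewrite eri; move: X0 cr0 Er0 nEr0; rewrite C0r.
    move: (gtail x) (gtail _) (c0 / r) (n%:R * E / r) (E / r) (eta^-1 / r) => *; lra.
  have bp i : 0 < b i by apply: lt_le_trans (b_ge i); exact: delta0.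
  have Uplt i : Up r x i < r ^+ 2 * (b i + delta / 2).
    by rewrite mulrDr /Up ltrD2l; exact: shift_small.
  have Loge i : a i = 0 /\ Lo r x i = 0 \/ delta <= a i /\ r ^+ 2 * (a i - delta / 2) <= Lo r x i.
    case: (a0 i) => h; [left; split=> //|right; split=> //].
      by rewrite /Lo h !mulr0 sqrtr0 !mulr0 subr0.
    rewrite mulrBr /Lo lerD2l lerN2; apply: ltW; apply: shift_small => //.
    by apply: lt_le_trans h; exact: delta0.
  have Lo0 i : 0 <= Lo r x i.
    case: (Loge i) => [[_ ->]//|[h h']]; apply: le_trans h'; apply: mulr_ge0; first exact: sqr_ge0.
    by have := delta0; lra.
  pose M := (\sum_(i < n) Num.bound `|Up r x i|)%N.
  have UM i : Up r x i < M%:R.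
    apply: (le_lt_trans (ler_norm _)).
    apply: (@lt_le_trans _ _ (Num.bound `|Up r x i|)%:R); first exact: archi_boundP.
    by rewrite ler_nat /M (bigD1 i)//= leq_addr.
  pose s := [seq j <- iota 0 M | [exists i : 'I_n, (Lo r x i <= j%:R <= Up r x i)%R]].
  have ss : (size s <= k)%N.
    apply: (Hlt _ _ mX); first by rewrite filter_uniq// iota_uniq.
    move=> j; rewrite mem_filter => /andP[/existsP[i hi] _].
    apply: le_trans (annuli_eig_lower r1 hi); rewrite C0r mulrDl.
    move: nEr0 eir0.
    move: (gtail x) (c0 / r) (n%:R * E / r) (E / r) (eta^-1 / r) => *; lra.
  have disjLU i i' : b i + delta <= a i' -> Up r x i < Lo r x i'.
    move=> h; apply: (lt_le_trans (Uplt i)).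
    case: (Loge i') => [[h' _]|[_ h']].
      by have := bp i; have := delta0; lra.
    by apply: le_trans h'; apply: ler_wpM2l; [exact: sqr_ge0|lra].
  have sge : (\sum_(i < n) count (fun j : nat => (Lo r x i <= j%:R <= Up r x i)%R) (iota 0 M) <= size s)%N.
    apply: sum_count_le_size => i i' j /andP[l1 u1] /andP[l2 u2].
    apply/eqP; apply: contrapT => /negP ii'.
    case: (disj ii') => /disjLU h.
      by have := le_lt_trans u1 (lt_le_trans h l2); rewrite ltxx.
    by have := le_lt_trans u2 (lt_le_trans h l1); rewrite ltxx.
  have := leq_trans sge ss; rewrite -(ler_nat R) natr_sum leNgt => /negP; apply.
  apply: (@lt_le_trans _ _ (\sum_(i < n) (Up r x i - Lo r x i - 1))); last first.
    by apply: ler_sum => i _; apply: count_itv_ge.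
  rewrite sumrB sum_len -/w xw sumr_const card_ord -[k.+1%:R]natr1.
  by rewrite (_ : r ^+ 2 * A + _ - _ = k%:R + 1); [rewrite ltrDl|ring].
Qed.

End annuli_counting.

(** * Structure of radial sets *)

Section radial_structure.
Context {R : realType}.
Implicit Types (z w : R * R) (Omega : set (R * R)).

Lemma enorm_ge0 z : 0 <= enorm z. Proof. exact: sqrtr_ge0. Qed.

Lemma sqr_enorm z : enorm z ^+ 2 = z.1 ^+ 2 + z.2 ^+ 2.
Proof. by rewrite sqr_sqrtr// addr_ge0 ?sqr_ge0. Qed.

Lemma enorm_le z (s : R) : 0 <= s -> (enorm z <= s) = (z.1 ^+ 2 + z.2 ^+ 2 <= s ^+ 2).
Proof. by move=> s0; rewrite -sqr_enorm ler_pXn2r// nnegrE enorm_ge0. Qed.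

Lemma enorm_axis (s : R) : 0 <= s -> enorm (s, 0) = s.
Proof. by move=> s0; rewrite /enorm /= expr0n addr0 sqrtr_sqr ger0_norm. Qed.

Lemma continuous_enorm : continuous (@enorm R).
Proof.
move=> z; apply: (@continuous_comp _ _ _ (fun w : R * R => w.1 ^+ 2 + w.2 ^+ 2) Num.sqrt); last exact: sqrt_continuous.
apply: cvgD.
  by apply: (@continuous_comp _ _ _ fst (fun x : R => x ^+ 2)); [exact: cvg_fst|exact: exprn_continuous].
by apply: (@continuous_comp _ _ _ snd (fun x : R => x ^+ 2)); [exact: cvg_snd|exact: exprn_continuous].
Qed.

Lemma pos_lower_bound (I : finType) (P : pred I) (f : I -> R) : (forall i, P i -> 0 < f i) ->
  exists d : R, 0 < d /\ forall i, P i -> d <= f i.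
Proof.
move=> f0; exists (\big[Num.min/1]_(i | P i) f i); split.
  by elim/big_ind: _ => // x y x0 y0; rewrite lt_min x0.
by move=> i Pi; exact: bigmin_le_cond.
Qed.

Lemma compact_connected_itv (K : set R) : K !=set0 -> compact K -> connected K ->
  exists a b, [/\ K a, K b & K = [set s | a <= s <= b]].
Proof.
move=> K0 cK /connected_intervalP iK.
have cid : {within K, continuous (id : R -> R)} by apply: continuous_subspaceT => x; exact: cvg_id.
have [b /set_mem Kb bP] := compact_EVT_max K0 cK cid.
have [a /set_mem Ka aP] := compact_EVT_min K0 cK cid.
exists a, b; split=> //; apply/seteqP; split=> s /=.
  by move=> Ks; rewrite aP ?bP ?inE.
by move=> sab; exact: (iK a b).
Qed.

(** The norm maps a component of the planar set into one component of [S], so [F] recovers each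
    component of [S] from any point of the planar component through [(s, 0)]. *)
Lemma finite_radial_components (S : set R) : S `<=` [set s | 0 <= s] ->
  finite_set [set connected_component [set z | S (enorm z)] z | z in [set z | S (enorm z)]] ->
  finite_set [set connected_component S s | s in S].
Proof.
move=> S0; set Om := [set z | S (enorm z)] => fin.
pose F (C : set (R * R)) := connected_component S (enorm (xget ((0 : R), (0 : R)) C)).
apply: (sub_finite_set _ (finite_image F fin)) => _ /= [s Ss <-].
have Oz : Om (s, 0) by rewrite /Om /= enorm_axis//; exact: S0.
exists (connected_component Om (s, 0)); first by exists (s, 0).
set C := connected_component Om (s, 0).
have Cw : C (xget ((0 : R), (0 : R)) C).
  by apply: (@xgetPex _ _ C); exists (s, 0); exact: connected_component_refl.
rewrite /F; apply/esym/same_connected_component.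
apply: (@connected_component_max _ S (@enorm R @` C) s).
- by exists (s, 0); [exact: connected_component_refl|rewrite enorm_axis//; exact: S0].
- by move=> _ [w /connected_component_sub h <-].
- apply: connected_continuous_connected; first exact: component_connected.
  by apply: continuous_subspaceT; exact: continuous_enorm.
- by exists (xget ((0 : R), (0 : R)) C).
Qed.

Lemma disjoint_closed_itvs (S : set R) : compact S -> finite_set [set connected_component S s | s in S] ->
  exists n (a b : 'I_n -> R), [/\ forall i, S (a i), forall i, a i <= b i,
    forall i j, i != j -> b i < a j \/ b j < a i &
    forall s, S s <-> exists i, a i <= s <= b i].
Proof.
move=> cS /finite_seqP[q0 qE0].
set q := undup q0; have qE K : K \in q <-> exists2 s, S s & connected_component S s = K.
  by rewrite mem_undup; move/seteqP: qE0 => [h1 h2]; split=> [/h2|/h1].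
have qi (i : 'I_(size q)) : exists2 s, S s & connected_component S s = nth set0 q i.
  by apply/qE; exact: mem_nth.
have H (i : 'I_(size q)) : exists ab : R * R, [/\ nth set0 q i ab.1, nth set0 q i ab.2 &
    nth set0 q i = [set s | ab.1 <= s <= ab.2]].
  have [s Ss <-] := qi i.
  have clS : closed S by apply: compact_closed => //; exact: norm_hausdorff.
  have [|||a [b [h1 h2 h3]]] := @compact_connected_itv (connected_component S s).
  - by exists s; exact: connected_component_refl.
  - by apply: (subclosed_compact _ cS); [exact: component_closed|exact: connected_component_sub].
  - exact: component_connected.
  by exists (a, b).
have [ab abP] := choice H.
have aq (i : 'I_(size q)) : nth set0 q i (ab i).1 by have [] := abP i.
have ab_ (i : 'I_(size q)) : (ab i).1 <= (ab i).2.
  by have [h _ E] := abP i; move: h; rewrite E /= => /andP[].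
exists (size q), (fun i => (ab i).1), (fun i => (ab i).2); split=> //.
- by move=> i; have := aq i; have [s Ss <-] := qi i; exact: connected_component_sub.
- move=> i j ij; apply: contrapT => /not_orP[/negP]; rewrite -leNgt => h1 /negP; rewrite -leNgt => h2.
  (* If neither interval lies to the left of the other, both contain the larger left endpoint, so
     the two components coincide. *)
  pose s := Num.max (ab i).1 (ab j).1.
  have [_ _ Ei] := abP i; have [_ _ Ej] := abP j.
  have si : nth set0 q i s by rewrite Ei /= /s le_max lexx /= ge_max ab_ h1.
  have sj : nth set0 q j s by rewrite Ej /= /s le_max lexx orbT /= ge_max ab_ h2.
  have [x Sx Ex] := qi i; have [y Sy Ey] := qi j.
  have Exy : nth set0 q i = nth set0 q j.
    rewrite -Ex -Ey; rewrite -Ex in si; rewrite -Ey in sj.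
    by rewrite (same_connected_component si) (same_connected_component sj).
  move/eqP: Exy; rewrite nth_uniq ?undup_uniq// => /eqP ij'.
  by move/eqP: ij; apply; exact: val_inj.
- move=> s; split=> [Ss|[i ]].
    have sq : connected_component S s \in q by apply/qE; exists s.
    have iq : (index (connected_component S s) q < size q)%N by rewrite index_mem.
    exists (Ordinal iq); have [_ _ E] := abP (Ordinal iq).
    have : nth set0 q (Ordinal iq) s by rewrite /= nth_index//; exact: connected_component_refl.
    by rewrite E.
  have [_ _ E] := abP i => h.
  have : nth set0 q i s by rewrite E.
  by have [x Sx <-] := qi i; exact: connected_component_sub.
Qed.

(** A degenerate interval would be an isolated circle, or the origin alone. Regular closedness
    yields interior points near it, and a small displacement of such a point changes its norm
    without leaving the set. *)
Lemma radial_structure Omega : Omega !=set0 -> compact Omega -> regclosed Omega ->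
  rotation_invariant Omega -> finite_set [set connected_component Omega z | z in Omega] ->
  exists n (a b : 'I_n -> R), [/\ (0 < n)%N, forall i, 0 <= a i /\ a i < b i,
    forall i j, i != j -> b i < a j \/ b j < a i &
    forall z, Omega z <-> exists i, a i <= enorm z <= b i].
Proof.
move=> [z0 Oz0] cO regO [S S0 OE] fin.
have SE : S = @enorm R @` Omega.
  apply/seteqP; split=> s; last by case=> z; rewrite OE /= => h <-.
  by move=> Ss; exists (s, 0); rewrite ?OE /= enorm_axis//; exact: S0.
have cS : compact S.
  by rewrite SE; apply: continuous_compact => //; apply: continuous_subspaceT; exact: continuous_enorm.
have [|n [a [b [aS ab disj SP]]]] := disjoint_closed_itvs cS.
  by apply: finite_radial_components => //; rewrite -OE.
have OP z : Omega z <-> exists i, a i <= enorm z <= b i by rewrite OE /=; exact: SP.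
have a0 i : 0 <= a i by exact: S0.
exists n, a, b; split=> //; first by have /OP[[i ilt] _] := Oz0; exact: leq_ltn_trans ilt.
move=> i; split=> //; rewrite lt_neqAle ab andbT; apply/negP => /eqP abi.
have [d [d0 dP]] : exists d : R, 0 < d /\ forall j, j != i -> b j + d <= a i \/ b i + d <= a j.
  have [|d [d0 dP]] := @pos_lower_bound 'I_n (fun j => j != i) (fun j => Num.max (a i - b j) (a j - b i)).
    by move=> j /disj; rewrite lt_max !subr_gt0 => -[->|->]//; rewrite orbT.
  exists d; split=> // j /dP; rewrite le_max => /orP[] h; [left|right]; lra.
set rho := a i in abi dP.
have : closure (interior Omega) (rho, 0).
  by rewrite regO; apply/OP; exists i; rewrite enorm_axis -?/rho ?a0// -abi lexx.
have nB : nbhs (rho, 0) [set w | `|rho - enorm w| < d].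
  have : (@enorm R) x @[x --> (rho, 0)] --> enorm (rho, 0) by exact: continuous_enorm.
  by rewrite enorm_axis ?a0// => /cvgrPdist_lt /(_ d d0).
move=> /(_ _ nB)[w [Iw /= wd]].
have band w' : Omega w' -> `|rho - enorm w'| < d -> enorm w' = rho.
  move=> /OP[j /andP[h1 h2]] h; have [ji|ji] := eqVneq j i.
    by apply/eqP; rewrite eq_le {1}abi -ji h2 /rho -ji h1.
  by move: h; rewrite ltr_norml => /andP[]; case: (dP j ji); lra.
have wr : enorm w = rho by apply: band => //; exact: interior_subset.
move: Iw => /nbhs_ballP[e /= e0 eO].
pose t := Num.min e d / 2.
have t0 : 0 < t by rewrite divr_gt0// lt_min e0.
have me : Num.min e d <= e by rewrite ge_min lexx.
have md : Num.min e d <= d by rewrite ge_min lexx orbT.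
have te : t < e by rewrite /t ltr_pdivrMr//; lra.
have td : t < d by rewrite /t ltr_pdivrMr//; lra.
(* Moving away from the vertical axis strictly increases the norm, by at most [t], so [w'] stays in
   the band where every point of the set has norm [rho]. *)
pose w' : R * R := (if 0 <= w.1 then w.1 + t else w.1 - t, w.2).
have Ow' : Omega w'.
  apply: eO; split; rewrite /ball /= /w' /=; last by rewrite subrr normr0.
  by case: ifP => _; rewrite ?opprD ?opprB addrA ?subrr ?addrCA ?subrr ?add0r ?addr0 ?normrN gtr0_norm.
have sq' : w'.1 ^+ 2 = w.1 ^+ 2 + 2 * t * `|w.1| + t ^+ 2.
  by rewrite /w' /=; case: (leP 0 w.1) => h; [rewrite ger0_norm//|rewrite ltr0_norm//]; ring.
have rw := sqr_enorm w; have rw' := sqr_enorm w'; rewrite sq' in rw'; rewrite wr in rw.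
have w1r : `|w.1| <= rho.
  have rho0 : 0 <= rho := a0 i.
  by rewrite -ler_sqr ?nnegrE// real_normK ?num_real// rw lerDl sqr_ge0.
have wle : enorm w' <= rho + t.
  rewrite enorm_le; last by rewrite addr_ge0 ?a0 ?ltW.
  rewrite sq' sqrrD; have : 0 <= t * (rho - `|w.1|) by apply: mulr_ge0; [exact: ltW|rewrite subr_ge0].
  by have -> : w'.2 = w.2 by []; lra.
have wgt : rho < enorm w'.
  rewrite ltNge enorm_le ?a0// sq' -ltNge; have : 0 <= t * `|w.1| by apply: mulr_ge0; [exact: ltW|].
  have : 0 < t ^+ 2 by rewrite exprn_gt0.
  by have -> : w'.2 = w.2 by []; lra.
have : enorm w' = rho by apply: band => //; rewrite ltr_norml; apply/andP; split; lra.
by move=> E; rewrite E ltxx in wgt.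
Qed.

End radial_structure.

(** * Hausdorff measure of circles *)

Section circles.
Context {R : realType}.
Implicit Types (x y s t rho : R) (z w : R * R) (U : set (R * R)).

Lemma sin_mean x : 0 <= x -> exists2 c, 0 <= c <= x & sin x = cos c * x.
Proof.
move=> x0; have [c cx] := @mean_value R sin cos 0 x x0 (fun u _ => is_derive_sin u).
by rewrite sin0 !subr0 => ->; exists c.
Qed.

Lemma cos_ge x : 0 <= x -> 1 - x <= cos x.
Proof.
move=> x0; have [c cx] := @mean_value R cos (fun u => - sin u) 0 x x0 (fun u _ => is_derive_cos u).
rewrite cos0 subr0 => E; have : 0 <= (1 - sin c) * x by rewrite mulr_ge0// subr_ge0 sin_le1.
by lra.
Qed.

Lemma cos_antitone x y : 0 <= x -> x <= y -> y <= pi -> cos y <= cos x.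
Proof.
move=> x0; rewrite le_eqVlt => /orP[/eqP ->//|xy yp].
by rewrite ltW// ltr_cos// in_itv /=; apply/andP; split; lra.
Qed.

Lemma sin_monotone x y : 0 <= x -> x <= y -> y <= pi / 2 -> sin x <= sin y.
Proof.
move=> x0; rewrite le_eqVlt => /orP[/eqP ->//|xy yp].
have p0 := @pi_gt0 R.
by rewrite ltW// ltr_sin// in_itv /=; apply/andP; split; lra.
Qed.

Lemma sin_supplement x : sin (pi - x) = sin x.
Proof. by rewrite -opprB sinN -[X in sin X]/(x - pi) sinB cospi sinpi; ring. Qed.

Lemma sin_le_id x : 0 <= x -> sin x <= x.
Proof.
move=> x0; have [c _ ->] := sin_mean x0.
by rewrite ler_piMl// cos_le1.
Qed.

Definition circle rho x : R * R := (rho * cos x, rho * sin x).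

Lemma enorm_circle rho x : 0 <= rho -> enorm (circle rho x) = rho.
Proof.
move=> r0; rewrite /enorm /circle /= !exprMn -mulrDr cos2Dsin2 mulr1 sqrtr_sqr.
exact: ger0_norm.
Qed.

Lemma enorm_chord rho s t : 0 <= rho -> s <= t -> t <= s + 2 * pi ->
  enorm (circle rho s - circle rho t) = 2 * rho * sin ((t - s) / 2).
Proof.
move=> r0 st ts; pose m := (s + t) / 2; pose h := (t - s) / 2.
have -> : s = m - h by rewrite /m /h; lra.
have -> : t = m + h by rewrite /m /h; lra.
rewrite -/h (_ : m + h - (m - h) = h * 2); last by ring.
rewrite mulfK// /enorm /circle /= !cosD !sinD cosN sinN.
have h0 : 0 <= 2 * rho * sin h.
  by apply: mulr_ge0; [exact: mulr_ge0|apply: sin_ge0_pi; rewrite /h; apply/andP; split; lra].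
rewrite -[RHS](ger0_norm h0) -sqrtr_sqr; congr Num.sqrt.
transitivity ((2 * rho * sin h) ^+ 2 * (cos m ^+ 2 + sin m ^+ 2)); first by ring.
by rewrite cos2Dsin2 mulr1.
Qed.

Lemma polar rho z : 0 < rho -> enorm z = rho -> exists2 x, 0 <= x <= 2 * pi & z = circle rho x.
Proof.
move=> r0 zr; have := sqr_enorm z; rewrite zr; case: z {zr} => u v /= E.
pose c := u / rho; pose d := v / rho.
have cd : c ^+ 2 + d ^+ 2 = 1 by rewrite /c /d !expr_div_n -mulrDl -E divff// expf_neq0// gt_eqF.
have c1 : -1 <= c <= 1.
  have := sqr_ge0 d; rewrite -ler_norml -(ler_sqr _ ler01) ?nnegrE// real_normK ?num_real// expr1n; lra.
have uE : u = rho * c by rewrite /c mulrC divfK// gt_eqF.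
have vE : v = rho * d by rewrite /d mulrC divfK// gt_eqF.
have ca : cos (acos c) = c by apply: acosK; rewrite in_itv.
have sa : sin (acos c) = `|d| by rewrite sin_acos// -sqrtr_sqr; congr Num.sqrt; lra.
have a0 := acos_ge0 c1; have ap := acos_lepi c1; have p0 := @pi_gt0 R.
case: (leP 0 d) => d0.
  exists (acos c); first by apply/andP; split; lra.
  by rewrite /circle ca sa ger0_norm// uE vE.
exists (2 * pi - acos c); first by apply/andP; split; lra.
have -> : 2 * pi - acos c = - acos c + pi *+ 2 by rewrite -[pi *+ 2]mulr_natl addrC.
by rewrite /circle cosD2pi sinD2pi cosN sinN ca sa ltr0_norm// opprK uE vE.
Qed.

(** With [x] half the arc, the chord is [2 * rho * sin x]. A short chord means that [x] is small or
    near [pi]; stopping [2 * x0] before a full turn excludes the latter. Then [sin x >= x * cos x0]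
    by the mean value theorem. *)
Lemma arc_le_chord rho (x0 : R) s t : 0 < rho -> 0 < x0 -> x0 < pi / 2 ->
  0 <= s -> s <= t -> t <= 2 * pi - 2 * x0 ->
  enorm (circle rho s - circle rho t) < 2 * rho * sin x0 ->
  (t - s) * (rho * cos x0) <= enorm (circle rho s - circle rho t).
Proof.
move=> r0 x00 x0p s0 st tp; have tp' : t <= s + 2 * pi by lra.
rewrite (enorm_chord (ltW r0) st tp').
set x := (t - s) / 2 => h.
have x_ge0 : 0 <= x by rewrite /x; lra.
have sx : sin x < sin x0 by rewrite ltr_pM2l ?mulr_gt0// in h.
have xx0 : x <= x0.
  rewrite leNgt; apply/negP => x0x; move: sx; rewrite ltNge => /negP; apply.
  case: (leP x (pi / 2)) => xp; first by apply: sin_monotone => //; exact: ltW.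
  by rewrite -(sin_supplement x); apply: sin_monotone; rewrite /x in xp *; lra.
have [c /andP[c0 cx] ->] := sin_mean x_ge0.
have -> : t - s = 2 * x by rewrite /x; lra.
have -> : 2 * rho * (cos c * x) = 2 * x * (rho * cos c) by ring.
apply: ler_wpM2l; first by rewrite mulr_ge0.
by apply: ler_wpM2l; [exact: ltW|apply: cos_antitone; lra].
Qed.

Lemma enorm_triangle z w : enorm (z - w) >= enorm z - enorm w.
Proof.
have := le_normcD (Complex (z.1 - w.1) (z.2 - w.2)) (Complex w.1 w.2).
have -> : Complex (z.1 - w.1) (z.2 - w.2) + Complex w.1 w.2 = Complex z.1 z.2 :> R[i].
  by apply: complexP; rewrite ?ReD ?ImD /= subrK.
by rewrite lerBlDr.
Qed.

Lemma diam_ge0 U : (0 <= diam U)%E.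
Proof. by apply: ereal_sup_ubound; left. Qed.

Lemma le_diam U z w : U z -> U w -> ((enorm (z - w))%:E <= diam U)%E.
Proof. by move=> Uz Uw; apply: ereal_sup_ubound; right; exists z, w. Qed.

Lemma diam_le U (d : R) : 0 <= d -> (forall z w, U z -> U w -> enorm (z - w) <= d) ->
  (diam U <= d%:E)%E.
Proof.
move=> d0 h; apply: ge_ereal_sup => x [->|[z [w [Uz Uw ->]]]]; first by rewrite lee_fin.
by rewrite lee_fin h.
Qed.

Lemma diam_set0 : diam (set0 : set (R * R)) = 0%E.
Proof. by apply/eqP; rewrite eq_le diam_ge0 andbT; apply: diam_le. Qed.

Lemma enorm_distC z w : enorm (z - w) = enorm (w - z).
Proof. by rewrite /enorm /= -(sqrrN (z.1 - w.1)) -(sqrrN (z.2 - w.2)) !opprB. Qed.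

Definition arc rho N k : set (R * R) :=
  [set circle rho x | x in [set x | 2 * pi / N%:R * k%:R <= x <= 2 * pi / N%:R * (k%:R + 1)]].

Lemma diam_arc rho N k : 0 < rho -> (0 < N)%N -> (diam (arc rho N k) <= (rho * (2 * pi / N%:R))%:E)%E.
Proof.
move=> r0 N0; have p0 := @pi_gt0 R.
have N1 : (1 : R) <= N%:R by rewrite ler1n.
set a := 2 * pi / N%:R; have a0 : 0 <= a by rewrite divr_ge0// mulr_ge0// ltW.
have ap : a <= 2 * pi by rewrite /a ler_pdivrMr ?(lt_le_trans ltr01 N1)// ler_peMr// mulr_ge0// ltW.
apply: diam_le; first by rewrite mulr_ge0// ltW.
move=> _ _ [s hs <-] [t ht <-].
wlog st : s t hs ht / s <= t.
  by move=> W; case: (leP s t) => [|/ltW] st; [exact: W|rewrite enorm_distC; exact: W].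
move: hs ht => /= /andP[hs _] /andP[_ ht].
have tsa : t - s <= a by rewrite mulrDr mulr1 -/a in ht; rewrite -/a in hs; lra.
have tp' : t <= s + 2 * pi by lra.
rewrite (enorm_chord (ltW r0) st tp').
have h : sin ((t - s) / 2) <= (t - s) / 2 by apply: sin_le_id; lra.
rewrite mulrAC mulrC; apply: ler_wpM2l; first exact: ltW.
by lra.
Qed.

Lemma arc_cover rho N z : 0 < rho -> (0 < N)%N -> enorm z = rho ->
  exists2 k, (k < N)%N & arc rho N k z.
Proof.
move=> r0 N0 zr; have p0 := @pi_gt0 R.
have N1 : (0 : R) < N%:R by rewrite ltr0n.
have [x /andP[x0 xp] ->] := polar r0 zr.
pose a : R := 2 * pi / N%:R; have a0 : 0 < a by rewrite divr_gt0// mulr_gt0.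
have Na : a * N%:R = 2 * pi by rewrite /a divfK// gt_eqF.
have q0 : 0 <= x / a by rewrite divr_ge0// ltW.
have /andP[k1 k2] := Num.Theory.truncn_itv q0.
set k := Num.truncn (x / a) in k1 k2.
have xa : x = a * (x / a) by rewrite mulrC divfK// gt_eqF.
case: (ltnP k N) => kN.
  exists k => //; exists x => //=; rewrite -/a xa; apply/andP; split; rewrite ler_pM2l//.
  by rewrite natr1 ltW.
exists N.-1; first by rewrite prednK.
exists x => //=; rewrite -/a; have -> : (N.-1)%:R = N%:R - 1 :> R by rewrite -[in RHS](prednK N0) -natr1 addrK.
rewrite subrK Na xp andbT mulrBr mulr1 Na.
have : a * N%:R <= a * (x / a) by rewrite ler_pM2l//; apply: le_trans k1; rewrite ler_nat.
by rewrite -xa Na; lra.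
Qed.

Lemma circle_cover (s : seq R) (d : R) : 0 < d -> (forall rho, rho \in s -> 0 < rho) ->
  exists L : seq (set (R * R)), [/\ forall z, enorm z \in s -> exists2 U, U \in L & U z,
    forall U, U \in L -> (diam U <= d%:E)%E &
    (\sum_(U <- L) diam U <= (2 * pi * \sum_(rho <- s) rho)%:E)%E].
Proof.
move=> d0; elim: s => [|rho s IH] s0.
  by exists [::]; split=> //; rewrite !big_nil mulr0.
have [|L [L1 L2 L3]] := IH; first by move=> r rs; apply: s0; rewrite inE rs orbT.
have r0 : 0 < rho by apply: s0; rewrite inE eqxx.
have p0 := @pi_gt0 R.
have c0 : 0 <= rho * (2 * pi) / d by rewrite divr_ge0 ?ltW// mulr_gt0// mulr_gt0.
pose N := (Num.truncn (rho * (2 * pi) / d)).+1.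
have /andP[_ Nd] := Num.Theory.truncn_itv c0.
have N0 : (0 : R) < N%:R by rewrite ltr0n.
exists ([seq arc rho N k | k <- iota 0 N] ++ L); split.
- move=> z; rewrite inE => /orP[/eqP zr|/L1[U UL Uz]]; last by exists U; rewrite // mem_cat UL orbT.
  have [k kN kz] := arc_cover r0 (ltn0Sn _ : (0 < N)%N) zr.
  by exists (arc rho N k) => //; rewrite mem_cat map_f// mem_iota.
- move=> U; rewrite mem_cat => /orP[/mapP[k _ ->]|/L2//].
  apply: (le_trans (diam_arc _ r0 (ltn0Sn _))); rewrite lee_fin mulrA ler_pdivrMr//.
  by apply: ltW; rewrite -ltr_pdivrMl// [_^-1 * _]mulrC.
- have -> : \sum_(r <- rho :: s) r = rho + \sum_(r <- s) r by rewrite big_cons.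
  rewrite big_cat mulrDr EFinD; apply: leeD => //.
  rewrite big_map.
  apply: (@le_trans _ _ (\sum_(k <- iota 0 N) (rho * (2 * pi / N%:R))%:E)%E).
    by apply: lee_sum => k _; exact: diam_arc.
  rewrite sumEFin lee_fin big_const_seq count_predT size_iota iter_addr_0 -[leLHS]mulr_natl.
  by rewrite le_eqVlt; apply/orP; left; apply/eqP; field; rewrite gt_eqF.
Qed.

Lemma hausdorff1_circles_le (s : seq R) (d : R) : 0 < d -> (forall rho, rho \in s -> 0 < rho) ->
  (hausdorff1_pre d [set z | enorm z \in s] <= (2 * pi * \sum_(rho <- s) rho)%:E)%E.
Proof.
move=> d0 s0; have [L [L1 L2 L3]] := circle_cover d0 s0.
(* The finite cover is continued by empty sets, whose diameter is 0 by the convention in [diam]. *)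
apply: le_trans L3; apply: ereal_inf_lbound; exists (nth set0 L); last first.
  rewrite (nneseries_split 0 (size L)); last by move=> k _; exact: diam_ge0.
  rewrite add0n eseries0 ?adde0; last by move=> k kL _; rewrite nth_default// diam_set0.
  by rewrite [RHS](big_nth set0).
split=> [z /= /L1[U UL Uz]|i].
  by exists (index U L) => //; rewrite nth_index.
case: (ltnP i (size L)) => iL; first by apply: L2; exact: mem_nth.
by rewrite nth_default// diam_set0 lee_fin ltW.
Qed.

End circles.

Section hull.
Context {R : realType}.
Local Notation mu := (@lebesgue_measure R).
Implicit Types (V : set R).

(** Covering sets are arbitrary, so the parameters they cover need not form a measurable set. Its
    closed interval hull is measurable and no longer than its spread. *)
Definition hull V : set R := if `[< V !=set0 >] then [set x | inf V <= x <= sup V] else set0.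

Lemma hullE V : V !=set0 -> hull V = [set` `[inf V, sup V]].
Proof. by move=> /asboolP h; rewrite /hull h; apply/seteqP; split=> x /=; rewrite in_itv. Qed.

Lemma hull0 : hull set0 = set0.
Proof. by rewrite /hull; case: asboolP => // -[]. Qed.

Lemma measurable_hull V : measurable (hull V).
Proof.
have [V0|V0] := pselect (V !=set0); first by rewrite hullE//; exact: measurable_itv.
by rewrite /hull; case: asboolP => // h; case: (V0 h).
Qed.

Lemma sub_hull V (a b : R) : (forall x, V x -> a <= x <= b) -> V `<=` hull V.
Proof.
move=> h x Vx; rewrite hullE; last by exists x.
rewrite /= in_itv /=; apply/andP; split.
  by apply: ge_inf => //; exists a => y /h/andP[].
by apply: ub_le_sup => //; exists b => y /h/andP[].
Qed.

Lemma measure_hull V (d : R) : 0 <= d -> (forall x y, V x -> V y -> x <= y -> y - x <= d) ->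
  (mu (hull V) <= d%:E)%E.
Proof.
move=> d0 h; have [V0|V0] := pselect (V !=set0); last first.
  by rewrite /hull; case: asboolP => // _; rewrite measure0 lee_fin.
have hd x y : V x -> V y -> y - x <= d.
  move=> Vx Vy; case: (leP x y) => xy; first exact: h.
  by lra.
rewrite hullE// lebesgue_measure_itv /=; case: ifP => _; last by rewrite lee_fin.
rewrite -EFinB lee_fin lerBlDr; apply: ge_sup => // y Vy.
rewrite -lerBlDl; apply: lb_le_inf => // x Vx.
by have := hd _ _ Vx Vy; lra.
Qed.

End hull.

Section hausdorff_circles.
Context {R : realType}.
Local Notation mu := (@lebesgue_measure R).
Implicit Types (x y s t rho : R) (z w : R * R) (U : set (R * R)).

(** For a fine cover each set meets at most one of the circles, and its parameters there span at
    most its diameter divided by [rho * cos x0]. On every circle the spans have to cover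
    [[0, 2 * pi - 2 * x0]], so the diameters add up. *)
Lemma hausdorff1_pre_circles_ge (q : seq R) (x0 : R) : uniq q -> (forall rho, rho \in q -> 0 < rho) ->
  0 < x0 -> x0 < pi / 2 -> exists2 d : R, 0 < d &
  (((2 * pi - 2 * x0) * cos x0 * \sum_(rho <- q) rho)%:E <= hausdorff1_pre d [set z | enorm z \in q])%E.
Proof.
move=> uq q0 x00 x0p; have p0 := @pi_gt0 R.
pose n := size q; pose rho (i : 'I_n) := nth 0 q i.
have r0 i : 0 < rho i by apply: q0; exact: mem_nth.
have sx0 : 0 < sin x0 by apply: sin_gt0_pihalf; rewrite x00.
have cx0 : 0 < cos x0 by apply: cos_gt0_pihalf; apply/andP; split; lra.
(* [d1] makes chords short enough for [arc_le_chord] on every circle; [d2] keeps a covering set from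
   meeting two circles. *)
have [d1 [d10 d1P]] := @pos_lower_bound R 'I_n xpredT (fun i => 2 * rho i * sin x0)
  (fun i _ => mulr_gt0 (mulr_gt0 (ltr0n _ 2) (r0 i)) sx0).
have [|d2 [d20 d2P]] := @pos_lower_bound R ('I_n * 'I_n)%type (fun ij => ij.1 != ij.2)
  (fun ij => `|rho ij.1 - rho ij.2|).
  move=> [i j] /= ij; rewrite normr_gt0 subr_eq0; apply: contra ij.
  by rewrite /rho nth_uniq.
pose d := Num.min d1 d2 / 2.
have d0 : 0 < d by rewrite divr_gt0// lt_min d10.
have dd1 : d < d1.
  have : Num.min d1 d2 <= d1 by rewrite ge_min lexx.
  by rewrite /d ltr_pdivrMr//; lra.
have dd2 : d < d2.
  have : Num.min d1 d2 <= d2 by rewrite ge_min lexx orbT.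
  by rewrite /d ltr_pdivrMr//; lra.
exists d => //; apply: le_ereal_inf_tmp => _ [U [Ucov Ud] <-].
pose L := 2 * pi - 2 * x0.
pose V i j : set R := [set x | 0 <= x <= L /\ U j (circle (rho i) x)].
have cr0 i : 0 < rho i * cos x0 by rewrite mulr_gt0.
have diamE j : exists2 e : R, 0 <= e <= d & diam (U j) = e%:E.
  have h1 := diam_ge0 (U j); have h2 := Ud j.
  move: h1 h2; case: (diam (U j)) => [e| |]//; rewrite !lee_fin => h1 h2.
  by exists e => //; rewrite h1.
have chord_lt j z w : U j z -> U j w -> exists2 e, enorm (z - w) <= e <= d & diam (U j) = e%:E.
  move=> Uz Uw; have [e /andP[e0 ed] E] := diamE j; exists e => //.
  by rewrite ed andbT -lee_fin -E; exact: le_diam.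
have term_le i j : ((rho i * cos x0)%:E * mu (hull (V i j)) <= diam (U j))%E.
  have [e /andP[e0 ed] E] := diamE j.
  rewrite E muleC -lee_pdivlMr//; apply: measure_hull; first by rewrite divr_ge0// ltW.
  move=> s t [/andP[s0 sL] Us] [/andP[t0 tL] Ut] st; rewrite ler_pdivlMr//.
  have [e' /andP[he _] E'] := chord_lt _ _ _ Us Ut.
  have ee : e' = e by apply: EFin_inj; rewrite -E -E'.
  rewrite ee in he; apply: le_trans he; apply: arc_le_chord => //.
  have [e2 /andP[h1 h2] _] := chord_lt _ _ _ Us Ut.
  by apply: (le_lt_trans h1); apply: (le_lt_trans h2); apply: (lt_le_trans dd1); exact: d1P.
have sum_le j : (\sum_(i < n) (rho i * cos x0)%:E * mu (hull (V i j)) <= diam (U j))%E.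
  have [[i [x [xL Ux]]]|nV] := pselect (exists i, V i j !=set0); last first.
    rewrite big1 ?diam_ge0// => i _.
    have -> : V i j = set0.
      by apply/seteqP; split=> // x Vx; case: nV; exists i, x.
    by rewrite hull0 measure0 mule0.
  rewrite (bigD1 i)//= big1 ?adde0// => k ki.
  have -> : V k j = set0.
    apply/seteqP; split=> // y [yL Uy]; exfalso.
    have [e /andP[h1 h2] _] := chord_lt _ _ _ Ux Uy.
    have [e' /andP[h3 h4] _] := chord_lt _ _ _ Uy Ux.
    have := @d2P (i, k); rewrite /= eq_sym => /(_ ki) h.
    have := enorm_triangle (circle (rho i) x) (circle (rho k) y).
    have := enorm_triangle (circle (rho k) y) (circle (rho i) x).
    rewrite !enorm_circle ?(ltW (r0 _))// => h5 h6.
    have : `|rho i - rho k| <= d by rewrite ler_norml; apply/andP; split; lra.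
    by lra.
  by rewrite hull0 measure0 mule0.
have L0 : 0 <= L by rewrite /L; lra.
have cover i : (L%:E <= \sum_(0 <= j <oo) mu (hull (V i j)))%E.
  apply: (@le_trans _ _ (mu [set` `[0, L]])).
    by rewrite lebesgue_measure_itv /= lte_fin; case: ltP => h; rewrite ?oppr0 ?adde0 ?lee_fin.
  apply: measure_sigma_subadditive.
  - by move=> j; exact: measurable_hull.
  - exact: measurable_itv.
  move=> x /=; rewrite in_itv /= => xL.
  have cq : [set z : R * R | enorm z \in q] (circle (rho i) x).
    by rewrite /= enorm_circle ?ltW//; exact: mem_nth.
  have [j _ Uj] := Ucov _ cq.
  exists j => //; apply: (@sub_hull _ (V i j) 0 L) => //.
  by move=> y [].
apply: (@le_trans _ _ (\sum_(0 <= j <oo) (\sum_(i < n) (rho i * cos x0)%:E * mu (hull (V i j))))%E); last first.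
  apply: lee_nneseries => // j _ _; apply: sume_ge0 => i _.
  by apply: mule_ge0; rewrite ?lee_fin ?(ltW (cr0 i)).
rewrite nneseries_sum; last by move=> i j _; apply: mule_ge0; rewrite ?lee_fin ?(ltW (cr0 i)).
apply: (@le_trans _ _ (\sum_(i < n) (rho i * cos x0)%:E * L%:E)%E); last first.
  apply: lee_sum => i _; rewrite nneseriesZl//.
  by apply: lee_wpmul2l => //; rewrite lee_fin ltW.
rewrite -/L (big_nth 0) big_mkord mulr_sumr -sumEFin; apply: lee_sum => i _.
by rewrite lee_fin le_eqVlt; apply/orP; left; apply/eqP; rewrite /rho; ring.
Qed.

Lemma hausdorff1_circles (q : seq R) : uniq q -> (forall rho, rho \in q -> 0 < rho) ->
  hausdorff1 [set z : R * R | enorm z \in q] = (2 * pi * \sum_(rho <- q) rho)%:E.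
Proof.
move=> uq q0; have p0 := @pi_gt0 R.
set S := \sum_(_ <- _) _; set H := hausdorff1 _.
have S0 : 0 <= S by rewrite /S big_seq; apply: sumr_ge0 => r /q0/ltW.
have up : (H <= (2 * pi * S)%:E)%E.
  by apply: ge_ereal_sup => _ [d d0 <-]; exact: hausdorff1_circles_le.
have low x : 0 < x -> x < pi / 2 -> (((2 * pi - 2 * x) * cos x * S)%:E <= H)%E.
  move=> x0 xp; have [d d0 h] := hausdorff1_pre_circles_ge uq q0 x0 xp.
  by apply: (le_trans h); apply: ereal_sup_ubound; exists d.
have [h E] : exists h, H = h%:E.
  have := low (pi / 4) _ _; case: (H) up => [h| |] // _ l; first by exists h.
  by have := l _ _; rewrite leNgt ltNyr => h; exfalso; suff : false by []; apply: h; lra.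
rewrite E in up *.
apply/eqP; rewrite eqe eq_le -lee_fin up /= leNgt; apply/negP => hS.
pose g := 2 * pi * S - h; have g0 : 0 < g by rewrite /g; lra.
(* To first order in [x], the lower bound loses [c * x] against the full length, and [x] below is
   chosen so that this is less than the supposed gap [g]. *)
pose c := (2 + 2 * pi) * S; have c0 : 0 <= c by rewrite mulr_ge0//; lra.
pose x := g / (c + g + 1); have cg0 : 0 < c + g + 1 by lra.
have x0 : 0 < x by rewrite divr_gt0.
have x1 : x < 1 by rewrite ltr_pdivrMr//; lra.
have xp : x < pi / 2 by have := @pi_ge2 R; lra.
have cx : c * x < g.
  by rewrite mulrA ltr_pdivrMr// [g * _]mulrC mulrDl mulrDl; have := mulr_gt0 g0 g0; lra.
have := low x x0 xp; rewrite E lee_fin leNgt => /negP; apply.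
have c1 := cos_ge (ltW x0).
apply: (@lt_le_trans _ _ ((2 * pi - 2 * x) * (1 - x) * S)); last first.
  by rewrite ler_wpM2r// ler_wpM2l//; lra.
have : 0 <= x * x * S by rewrite mulr_ge0// mulr_ge0 ?ltW.
have -> : (2 * pi - 2 * x) * (1 - x) * S = 2 * pi * S - c * x + 2 * (x * x * S) by rewrite /c; ring.
by rewrite /g in cx; lra.
Qed.

End hausdorff_circles.

(** * Radial sets as unions of annuli *)

Section radial_union.
Context {R : realType}.
Local Notation T := (measurableTypeR R).
Local Notation mu1 := (@lebesgue_measure R).
Local Notation mu2 := (mu1 \x mu1)%E.
Variables (n : nat) (a b : 'I_n -> R).
Hypothesis a0 : forall i, 0 <= a i.
Hypothesis ab : forall i, a i < b i.
Hypothesis disj : forall i j, i != j -> b i < a j \/ b j < a i.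
Implicit Types (z : T * T) (i j : 'I_n).

Definition radial_union : set (T * T) := [set z | exists i, a i <= sqnorm z <= b i].

Lemma measurable_radial_union : measurable radial_union.
Proof.
rewrite (_ : radial_union = \bigcup_(i in [set: 'I_n]) (sqnorm @^-1` [set` `[a i, b i]])).
  by apply: fin_bigcup_measurable => // i _; exact: measurable_sqnorm_itv.
apply/seteqP; split=> z [i ].
  by move=> h; exists i => //=; rewrite in_itv.
by move=> _ /=; rewrite in_itv /= => h; exists i.
Qed.

(** The half-open annuli are disjoint and miss only the inner circles, which are null sets. *)
Lemma ge0_integral_radial_union (G : T * T -> R) : measurable_fun setT G -> (forall z, 0 <= G z) ->
  (\int[mu2]_(z in radial_union) (G z)%:E = \sum_(i < n) \int[mu2]_(z in annulus (a i) (b i)) (G z)%:E)%E.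
Proof.
move=> mG G0.
have mE : measurable_fun setT (EFin \o G) by apply/measurable_EFinP.
have mP (D : set (T * T)) : measurable D -> measurable_fun setT ((EFin \o G) \_ D).
  by move=> mD; apply/(measurable_restrictT _ mD); exact: measurable_funTS.
have P0 (D : set (T * T)) z : (0 <= ((EFin \o G) \_ D) z)%E.
  by rewrite patchE; case: ifP => _ //; rewrite lee_fin.
rewrite integral_mkcond; under eq_bigr do rewrite integral_mkcond.
rewrite -ge0_integral_sum//; last by move=> i; apply: mP; exact: measurable_annulus.
apply: ge0_ae_eq_integral => //.
- by apply: mP; exact: measurable_radial_union.
- by apply: emeasurable_sum => i; apply: mP; exact: measurable_annulus.
- by move=> z _; apply: sume_ge0.
have H : {ae mu2, forall z, forall i, sqnorm z <> a i}.
  apply: filter_forall => i; exists (sqnorm @^-1` [set a i]); split.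
  - by rewrite -set_itv1; exact: measurable_sqnorm_itv.
  - exact: measure_circle.
  - by move=> z /= /contrapT.
apply: negligibleS H => z /=; apply: contra_not => za _.
rewrite patchE; case: ifPn => [/set_mem[i /andP[h1 h2]]|zU].
  have hi : z \in annulus (a i) (b i).
    apply/mem_set; rewrite /annulus /= in_itv /= h2 andbT lt_neqAle h1 andbT.
    by apply/eqP => E; case: (za i).
  rewrite (bigD1 i)//= patchE hi big1 ?adde0// => j ji.
  rewrite patchE ifN//; apply/negP => /set_mem; rewrite /annulus /= in_itv /= => /andP[h3 h4].
  by case: (disj ji); lra.
rewrite big1// => i _; rewrite patchE ifN//; apply: contra zU => /set_mem h.
apply/mem_set; exists i; move: h; rewrite /annulus /= in_itv /= => /andP[h1 ->].
by rewrite ltW.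
Qed.

Lemma measure_radial_union : mu2 radial_union = (\sum_(i < n) pi * (b i - a i))%:E.
Proof.
have := @ge0_integral_radial_union (fun=> 1) (measurable_cst _) (fun=> ler01).
rewrite integral_cst; last exact: measurable_radial_union.
rewrite mul1e => ->; rewrite -sumEFin; apply: eq_bigr => i _.
rewrite integral_cst; last exact: measurable_annulus.
by rewrite mul1e; exact: (measure_annulus (a0 i) (ltW (ab i))).
Qed.

Variable B : R.
Hypothesis bB : forall i, b i <= B.

Lemma radial_union_bounded z : radial_union z -> normc (zc z) <= Num.sqrt B.
Proof.
move=> [i /andP[_ h]]; rewrite -[leLHS]ger0_norm ?normc_ge0// -sqrtr_sqr normc_zc.
by apply: ler_wsqrtr; exact: le_trans (bB i).
Qed.

Lemma radial_union_rot (c s : R) z : c ^+ 2 + s ^+ 2 = 1 -> radial_union (rot c s z) <-> radial_union z.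
Proof. by move=> cs; rewrite /radial_union /= sqnorm_rot. Qed.

Lemma radial_eig_union k : radial_eig radial_union k =
  \sum_(i < n) (gamma_cdf k (pi * b i) - gamma_cdf k (pi * a i)).
Proof.
have p0 := @pi_ge0 R.
have mU := measurable_radial_union.
have Ufin : (mu2 radial_union < +oo)%E by rewrite measure_radial_union ltry.
pose G z := radial_density k (sqnorm z).
have mG : measurable_fun setT (G : T * T -> R).
  by apply: (measurableT_comp (measurable_radial_density k)); exact: measurable_sqnorm.
have G0 z : 0 <= G z.
  by rewrite mulr_ge0 ?expR_ge0// divr_ge0// exprn_ge0// mulr_ge0// sqnorm_ge0.
have mF : measurable_fun setT (fun z : T * T => expR (- (pi * sqnorm z)) * sqnorm z ^+ k).
  apply: measurable_funM; last by apply: measurable_funX; exact: measurable_sqnorm.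
  apply: measurableT_comp => //; apply: measurable_funN.
  by apply: measurable_funM; [exact: measurable_cst|exact: measurable_sqnorm].
transitivity (Rintegral mu2 radial_union G).
  rewrite /radial_eig /moment mulrC -RintegralZl//; last first.
    apply: (@integrable_le _ _ _ mu2 _ mU _ (fun=> B ^+ k)); first exact: measurable_funTS.
      exact: integrable_cst_radial.
    move=> z [i /andP[_ h]]; have s0 := sqnorm_ge0 z.
    have sB : sqnorm z <= B := le_trans h (bB i).
    rewrite ger0_norm; last by rewrite mulr_ge0 ?expR_ge0// exprn_ge0.
    rewrite -[leRHS]mul1r; apply: ler_pM; [exact: expR_ge0|exact: exprn_ge0| |].
      by rewrite -expR0 ler_expR lerNl oppr0 mulr_ge0.
    by rewrite lerXn2r// nnegrE// (le_trans s0).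
  by apply: eq_Rintegral => z _; rewrite /G /radial_density exprMn; ring.
rewrite /Rintegral ge0_integral_radial_union//.
have E i : (\int[mu2]_(z in annulus (a i) (b i)) (G z)%:E = (gamma_cdf k (pi * b i) - gamma_cdf k (pi * a i))%:E)%E.
  rewrite -(Rintegral_radial_density k (a0 i) (ltW (ab i))) /Rintegral fineK//.
  apply: integrable_fin_num; first exact: measurable_annulus.
  apply: (@integrable_annulus _ (radial_density k) (expR 0 * ((pi * b i) ^+ k / k`!%:R)) _ _
    (a0 i) (ltW (ab i)) (@measurable_radial_density _ k)).
  move=> s /andP[s1 s2]; have s0 : 0 <= s by apply: le_trans s1.
  have ps0 : 0 <= (pi * s) ^+ k / k`!%:R by rewrite divr_ge0// exprn_ge0// mulr_ge0.
  rewrite /radial_density ger0_norm; last by rewrite mulr_ge0 ?expR_ge0.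
  apply: ler_pM => //.
    by rewrite ler_expR lerNl oppr0 mulr_ge0.
  rewrite ler_wpM2r ?invr_ge0// lerXn2r ?nnegrE ?mulr_ge0// ?(le_trans s0 s2)//.
  by rewrite ler_wpM2l.
by under eq_bigr do rewrite E; rewrite sumEFin.
Qed.

End radial_union.

Section eigenvalue_limits.
Context {R : realType}.
Variables (n : nat) (u v : 'I_n -> R).
Hypotheses (n0 : (0 < n)%N) (u0 : forall i, 0 <= u i) (uv : forall i, u i < v i).

Lemma gamma_cdf_lt k (x y : R) : 0 <= x -> x < y -> gamma_cdf k x < gamma_cdf k y.
Proof.
move=> x0 xy; pose m := (x + y) / 2.
have xm : x <= m by rewrite /m; lra.
have my : m < y by rewrite /m; lra.
have m0 : 0 < m by rewrite /m; lra.
apply: (le_lt_trans (gamma_cdf_homo k x0 xm)).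
have [c /andP[mc _] E] := mean_value (ltW my) (fun t _ => is_derive_gamma_cdf k t).
have c0 : 0 < c by apply: lt_le_trans mc.
rewrite -subr_gt0 E mulr_gt0 ?subr_gt0// mulr_gt0 ?expR_gt0// divr_gt0 ?exprn_gt0//.
Qed.

Lemma gamma_cdf_sum_gt0 k : 0 < \sum_(i < n) (gamma_cdf k (v i) - gamma_cdf k (u i)).
Proof.
rewrite (bigD1 (Ordinal n0))//=; apply: ltr_wpDr.
  by apply: sumr_ge0 => i _; rewrite subr_ge0 ltW// gamma_cdf_lt.
by rewrite subr_gt0 gamma_cdf_lt.
Qed.

Lemma gamma_cdf_sum_cvg0 (x : R) : 0 < x ->
  exists N, forall k, (N <= k)%N -> \sum_(i < n) (gamma_cdf k (v i) - gamma_cdf k (u i)) < x.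
Proof.
move=> x0.
have v0 i : 0 <= v i by apply: le_trans (u0 i) _; exact: ltW.
pose B := \sum_(i < n) v i; have B0 : 0 <= B by apply: sumr_ge0.
have vB i : v i <= B by rewrite /B (bigD1 i)//= lerDl sumr_ge0.
have q0 : 0 <= B + 1 + B / x by rewrite !addr_ge0// divr_ge0// ltW.
(* Then [k + 1 - B] exceeds 1, so its square may be replaced by itself, and exceeds [B / x], so the
   sum is below [x]. *)
exists (Num.truncn (B + 1 + B / x)) => k Nk.
have /andP[_ h] := Num.Theory.truncn_itv q0.
have hk : B + 1 + B / x < k.+1%:R by apply: (lt_le_trans h); rewrite ler_nat.
have Bx0 : 0 <= B / x by rewrite divr_ge0// ltW.
have d1 : 1 <= k.+1%:R - B by lra.
have d2 : B / x < k.+1%:R - B by lra.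
have d0 : 0 < k.+1%:R - B by lra.
have term i : gamma_cdf k (v i) - gamma_cdf k (u i) <= v i / (k.+1%:R - B).
  have vBi := vB i.
  have vk : v i < k.+1%:R by lra.
  have g1 := gamma_cdf_le (v0 i) vk; have g0 := gamma_cdf_ge0 k (u0 i).
  apply: (@le_trans _ _ (v i / (k.+1%:R - v i) ^+ 2)); first by lra.
  apply: ler_wpM2l => //; rewrite lef_pV2 ?posrE ?exprn_gt0//; last by lra.
  have e1 : k.+1%:R - B <= k.+1%:R - v i by lra.
  apply: (le_trans e1); rewrite -[leLHS]mulr1 expr2; apply: ler_wpM2l; lra.
apply: (@le_lt_trans _ _ (\sum_(i < n) v i / (k.+1%:R - B))); first by apply: ler_sum => i _; exact: term.
by rewrite -mulr_suml -/B ltr_pdivrMr// mulrC -ltr_pdivrMr.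
Qed.

End eigenvalue_limits.

(** * Boundary and perimeter of a radial set *)

Section radial_boundary.
Context {R : realType}.
Variables (n : nat) (a b : 'I_n -> R) (d : R) (Om : set (R * R)).
Hypotheses (a0 : forall i, 0 <= a i) (ab : forall i, a i < b i) (d0 : 0 < d).
Hypothesis gap : forall i j, i != j -> b i + d <= a j \/ b j + d <= a i.
Hypothesis OmP : forall z, Om z <-> exists i, a i <= enorm z <= b i.
Hypothesis Ocl : closed Om.
Implicit Types (z w : R * R) (i j : 'I_n) (t : R).

(** An inner radius 0 is left out, since the origin is then an interior point; this does not change
    the sum of the radii. *)
Definition boundary_radii : seq R :=
  [seq b i | i <- enum 'I_n] ++ [seq a i | i <- enum 'I_n & a i != 0].

Let ab_sep i j : a i != b j.
Proof.
have [->|/gap ij] := eqVneq i j; first by rewrite lt_eqF.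
by apply/eqP; have := ab i; have := ab j; have := d0; case: ij; lra.
Qed.

Lemma boundary_radii_uniq : uniq boundary_radii.
Proof.
have inj (f : 'I_n -> R) : (forall i, a i <= f i <= b i) -> injective f.
  move=> h i j E; apply/eqP; apply: contrapT => /negP/gap.
  by have /andP[h1 h2] := h i; have /andP[h3 h4] := h j; have := d0; rewrite E in h1 h2; case; lra.
rewrite cat_uniq; apply/and3P; split.
- by rewrite map_inj_uniq ?enum_uniq//; apply: inj => i; rewrite lexx ltW.
- apply/hasPn => x /mapP[i _ ->]; apply/negP => /mapP[j _ E].
  by have := ab_sep i j; rewrite E eqxx.
- rewrite map_inj_uniq; first by apply: filter_uniq; exact: enum_uniq.
  by apply: inj => i; rewrite lexx ltW.
Qed.

Lemma boundary_radii_gt0 (rho : R) : rho \in boundary_radii -> 0 < rho.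
Proof.
rewrite mem_cat => /orP[/mapP[i _ ->]|/mapP[i + ->]]; first exact: le_lt_trans (ab i).
by rewrite mem_filter => /andP[ai _]; rewrite lt_neqAle eq_sym ai a0.
Qed.

Lemma sum_boundary_radii : \sum_(rho <- boundary_radii) rho = \sum_(i < n) (a i + b i).
Proof.
rewrite big_cat /= !big_map big_filter /= !big_enum_cond /= big_split /= addrC; congr (_ + _).
rewrite [RHS](bigID (fun i => a i != 0))/= [X in _ = _ + X]big1 ?addr0// => i.
by rewrite negbK => /eqP.
Qed.

Lemma enorm_scale t z : 0 <= t -> enorm (t * z.1, t * z.2) = t * enorm z.
Proof.
move=> t0; rewrite /enorm /= !exprMn -mulrDr sqrtrM ?sqr_ge0// sqrtr_sqr.
by rewrite ger0_norm.
Qed.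

Let outside (s : R) i : b i < s < b i + d \/ a i - d < s < a i -> ~ exists j, a j <= s <= b j.
Proof.
move=> h [j /andP[h1 h2]]; have [E|/gap ij] := eqVneq i j.
  by rewrite E in h; case: h => /andP[]; lra.
by have := ab i; have := ab j; case: ij; case: h => /andP[]; lra.
Qed.

(** Off these radii a small change of the norm stays within the same interval. On them a dilation by
    a factor close to 1 leaves the set, outwards at [b i] and inwards at [a i]. *)
Lemma boundary_circles : closure Om `\` interior Om = [set z | enorm z \in boundary_radii].
Proof.
rewrite -(closure_id Om).1//; apply/seteqP; split=> z /=.
  move=> [/OmP[i /andP[h1 h2]] nI]; apply: contrapT => zq; apply: nI.
  have zb : enorm z < b i.
    rewrite lt_neqAle h2 andbT; apply/eqP => E; apply: zq.
    by rewrite mem_cat E map_f// mem_enum.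
  have za : a i = 0 \/ a i < enorm z.
    have [ai|ai] := eqVneq (a i) 0; [by left|right].
    rewrite lt_neqAle h1 andbT; apply/eqP => E; apply: zq.
    by rewrite mem_cat -E map_f ?orbT// mem_filter ai mem_enum.
  have ce : (@enorm R) w @[w --> z] --> enorm z by exact: continuous_enorm.
  have eb : 0 < b i - enorm z by lra.
  rewrite /interior; case: za => za.
    apply: filterS ((cvgrPdist_lt _ _).1 ce _ eb) => w /= hw; apply/OmP; exists i.
    rewrite za enorm_ge0 /=; move: hw; rewrite ltr_norml => /andP[]; lra.
  have ea : 0 < enorm z - a i by lra.
  near=> w; apply/OmP; exists i.
  have : `|enorm z - enorm w| < b i - enorm z.
    by near: w; exact: ((cvgrPdist_lt _ _).1 ce _ eb).
  have : `|enorm z - enorm w| < enorm z - a i.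
    by near: w; exact: ((cvgrPdist_lt _ _).1 ce _ ea).
  by rewrite !ltr_norml => /andP[h3 h4] /andP[h5 h6]; apply/andP; split; lra.
move=> zq; have z0 := boundary_radii_gt0 zq; set rho := enorm z in zq z0.
have [i [zi up]] : exists i, (rho = b i \/ rho = a i) /\ True.
  move: zq; rewrite mem_cat => /orP[/mapP[i _ E]|/mapP[i _ E]]; exists i; split=> //; [by left|by right].
split.
  by apply/OmP; exists i; rewrite -/rho; have := ab i; case: zi => -> h; apply/andP; split; lra.
move=> /nbhs_ballP[e /= e0 eO].
pose m := Num.min e (Num.min d rho).
have m0 : 0 < m by rewrite !lt_min e0 d0.
have me : m <= e by rewrite ge_min lexx.
have md : m <= d by rewrite !ge_min lexx orbT.
have mr : m <= rho by rewrite !ge_min lexx !orbT.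
(* The dilation moves [z] by [m / 2]: within the ball of radius [e], and less than the gap [d] to
   the other annuli. *)
pose t := m / (2 * rho).
have t0 : 0 < t by rewrite divr_gt0// mulr_gt0.
have tr : t * rho = m / 2 by rewrite /t; field; rewrite gt_eqF.
have t1 : t < 1 by rewrite /t ltr_pdivrMr ?mulr_gt0//; lra.
have z1 : `|z.1| <= rho.
  by rewrite -ler_sqr ?nnegrE ?(ltW z0)// real_normK ?num_real// sqr_enorm lerDl sqr_ge0.
have z2 : `|z.2| <= rho.
  by rewrite -ler_sqr ?nnegrE ?(ltW z0)// real_normK ?num_real// sqr_enorm lerDr sqr_ge0.
have inO (s : R) : `|s| = t -> Om ((1 + s) * z.1, (1 + s) * z.2).
  move=> st; have small x : `|x| <= rho -> `|x - (1 + s) * x| < e.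
    move=> xr; rewrite (_ : x - (1 + s) * x = - (s * x)); last by ring.
    rewrite normrN normrM st; apply: (@le_lt_trans _ _ (t * rho)); last by lra.
    by apply: ler_wpM2l => //; exact: ltW.
  by apply: eO; split; exact: small.
case: zi => zi.
  have := inO t (gtr0_norm t0) => /OmP; rewrite enorm_scale -/rho; last by lra.
  apply: (@outside _ i); left; rewrite mulrDl mul1r tr -zi; apply/andP; split; lra.
have := inO (- t) (_ : _); rewrite normrN gtr0_norm// => /(_ erefl) /OmP.
rewrite enorm_scale -/rho; last by lra.
by apply: (@outside _ i); right; rewrite mulrDl mul1r mulNr tr -zi; apply/andP; split; lra.
Unshelve. all: by end_near.
Qed.

Lemma perimeter_radial : perimeter Om = 2 * pi * \sum_(i < n) (a i + b i).
Proof.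
rewrite /perimeter boundary_circles (hausdorff1_circles boundary_radii_uniq boundary_radii_gt0).
by rewrite sum_boundary_radii.
Qed.

End radial_boundary.

Theorem proposition2p5 (R : realType) (Omega : set (R * R))
    (Omega_neq0 : Omega !=set0)
    (Omega_compact : compact Omega)
    (Omega_regclosed : regclosed Omega)
    (Omega_rot : rotation_invariant Omega)
    (Omega_comp : finite_set [set connected_component Omega z | z in Omega]) :
  exists C r0 : R, [/\ 0 < C, 0 < r0 &
    forall (r : R) (k : nat), r0 <= r -> (1 <= k)%N ->
      `| kth_eigenvalue (loc_op (@gauss_window R) (dilate r Omega)) k
         - 1 / 2 * erfc (Num.sqrt (2 * pi)
             * ((k%:R - r ^+ 2 * area Omega) / (r * perimeter Omega))) |
      <= C / r].
Proof.
have [n [al [be [n0 albe disj OmP]]]] :=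
  radial_structure Omega_neq0 Omega_compact Omega_regclosed Omega_rot Omega_comp.
have al0 i : 0 <= al i by have [] := albe i.
have ab i : al i < be i by have [] := albe i.
have be0 i : 0 < be i by apply: le_lt_trans (ab i).
have p0 := @pi_gt0 R.
have Ocl : closed Omega by rewrite -Omega_regclosed; exact: closed_closure.
have disj2 i j : i != j -> be i ^+ 2 < al j ^+ 2 \/ be j ^+ 2 < al i ^+ 2.
  by move=> /disj[] h; [left|right]; rewrite ltrXn2r// ?nnegrE// ?ltW.
have ab2 i : al i ^+ 2 < be i ^+ 2 by rewrite ltrXn2r// ?nnegrE// ltW.
have dilE (r : R) : 0 < r ->
    dilate r Omega = radial_union (fun i => r ^+ 2 * al i ^+ 2) (fun i => r ^+ 2 * be i ^+ 2).
  move=> r0; have ri0 : 0 <= r^-1 by rewrite invr_ge0 ltW.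
  have rE (z : R * R) i : (al i <= enorm (z.1 / r, z.2 / r) <= be i) =
      (r ^+ 2 * al i ^+ 2 <= sqnorm z <= r ^+ 2 * be i ^+ 2).
    rewrite !(mulrC _ r^-1) enorm_scale// ler_pdivlMl// ler_pdivrMl//.
    rewrite -!exprMn [sqnorm z](_ : _ = enorm z ^+ 2); last by rewrite sqr_enorm.
    have r1 := mulr_ge0 (ltW r0) (al0 i); have r2 := mulr_ge0 (ltW r0) (ltW (be0 i)).
    by rewrite !ler_pXn2r ?nnegrE ?enorm_ge0.
  apply/seteqP; split=> z.
    by move=> /OmP[i hi]; exists i; rewrite -rE.
  by move=> [i hi]; apply/OmP; exists i; rewrite rE.
have areaE : area Omega = \sum_(i < n) (pi * be i ^+ 2 - pi * al i ^+ 2).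
  (* The set is its own dilation by 1, so the description of dilations applies to it. *)
  rewrite /area; have <- : radial_union (fun i => 1 ^+ 2 * al i ^+ 2) (fun i => 1 ^+ 2 * be i ^+ 2) = Omega.
    rewrite -dilE//; apply/seteqP; split=> -[x y]; rewrite /dilate /= !divr1 //.
  rewrite [X in fine X]measure_radial_union; last 3 first.
  - by move=> i; rewrite mulr_ge0// sqr_ge0.
  - by move=> i; rewrite !expr1n !mul1r.
  - by move=> i j ij; rewrite !expr1n !mul1r; exact: disj2.
  by apply: eq_bigr => i _; rewrite expr1n; ring.
have [d [d0 dgap]] : exists d : R, 0 < d /\ forall i j, i != j -> be i + d <= al j \/ be j + d <= al i.
  have [|d [d0 dP]] := @pos_lower_bound R ('I_n * 'I_n)%type (fun ij => ij.1 != ij.2)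
      (fun ij => Num.max (al ij.2 - be ij.1) (al ij.1 - be ij.2)).
    by move=> [i j] /= /disj; rewrite lt_max !subr_gt0 => -[->|->]//; rewrite orbT.
  exists d; split=> // i j ij; have := dP (i, j) ij; rewrite /= le_max => /orP[] h; [left|right]; lra.
have periE := perimeter_radial al0 ab d0 dgap OmP Ocl.
pose a i := pi * al i ^+ 2; pose b i := pi * be i ^+ 2.
have [|d1 [d10 d1P]] := @pos_lower_bound R 'I_n (fun i => al i != 0) a.
  by move=> i ai; rewrite mulr_gt0// exprn_gt0// lt_neqAle eq_sym ai al0.
have [|d2 [d20 d2P]] := @pos_lower_bound R 'I_n xpredT (fun i => b i - a i).
  by move=> i _; rewrite subr_gt0 ltr_pM2l.
have [|d3 [d30 d3P]] := @pos_lower_bound R ('I_n * 'I_n)%type (fun ij => ij.1 != ij.2)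
    (fun ij => Num.max (a ij.2 - b ij.1) (a ij.1 - b ij.2)).
  by move=> [i j] /= /disj2; rewrite lt_max !subr_gt0 !ltr_pM2l// => -[->|->]//; rewrite orbT.
(* One constant below the nonzero inner values, the widths and the gaps, as the counting estimate
   requires. *)
pose delta := Num.min d1 (Num.min d2 d3).
have delta0 : 0 < delta by rewrite !lt_min d10 d20.
have dl1 : delta <= d1 by rewrite ge_min lexx.
have dl2 : delta <= d2 by rewrite !ge_min lexx orbT.
have dl3 : delta <= d3 by rewrite !ge_min lexx !orbT.
have a_ge0 i : 0 <= a i by rewrite mulr_ge0 ?sqr_ge0// ltW.
have b_ge0 i : 0 <= b i by rewrite mulr_ge0 ?sqr_ge0// ltW.
have a_lt_b i : a i < b i by rewrite ltr_pM2l.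
pose B := 1 + \sum_(i < n) b i.
have B1 : 1 <= B by rewrite lerDl sumr_ge0.
have bB i : b i <= B by rewrite /B (bigD1 i)//= addrCA lerDl addr_ge0// sumr_ge0.
have ha i : a i = 0 \/ delta <= a i.
  have [E|ai] := eqVneq (al i) 0; [left|right]; first by rewrite /a E expr0n mulr0.
  exact: le_trans (d1P i ai).
have hab i : a i + delta <= b i by have := d2P i isT; lra.
have hgap i j : i != j -> b i + delta <= a j \/ b j + delta <= a i.
  by move=> ij; have := d3P (i, j) ij; rewrite /= le_max => /orP[] h; [left|right]; lra.
have [C [C0 HC]] := annuli_kth_bound delta0 B1 ha hab bB hgap n0.
exists C, 1; split=> // r [//|k] r1 _.
have r0 : 0 < r by lra.
have r20 : 0 < r ^+ 2 by rewrite exprn_gt0.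
pose ar i := r ^+ 2 * al i ^+ 2; pose br i := r ^+ 2 * be i ^+ 2.
have ar0 i : 0 <= ar i by rewrite mulr_ge0 ?sqr_ge0.
have arbr i : ar i < br i by rewrite ltr_pM2l.
have rdisj i j : i != j -> br i < ar j \/ br j < ar i.
  by move=> /disj2[] h; [left|right]; rewrite ltr_pM2l.
have brB i : br i <= \sum_(j < n) br j.
  rewrite (bigD1 i)//= lerDl; apply: sumr_ge0 => j _; exact: le_trans (ar0 j) (ltW (arbr j)).
pose e := annuli_eig a b r.
have eE j : radial_eig (dilate r Omega) j = e j.
  rewrite dilE// (radial_eig_union ar0 arbr rdisj brB); apply: eq_bigr => i _.
  rewrite /annuli_term /a /b /ar /br; congr (gamma_cdf _ _ - gamma_cdf _ _); ring.
have ra0 i : 0 <= r ^+ 2 * a i by rewrite mulr_ge0// ltW.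
have rab i : r ^+ 2 * a i < r ^+ 2 * b i by rewrite ltr_pM2l.
have e0 j : 0 < e j by exact: (gamma_cdf_sum_gt0 n0 ra0 rab).
have ecvg x : 0 < x -> exists N, forall j, (N <= j)%N -> e j < x.
  exact: (gamma_cdf_sum_cvg0 ra0 rab).
have dimE (m : R) (s : seq nat) : 0 < m -> uniq s -> (forall j, e j = m <-> j \in s) ->
    has_dim (eigenspace_of (loc_op (@gauss_window R) (dilate r Omega)) m) (size s).
  move=> m0 us sP.
  have sP' j : radial_eig (dilate r Omega) j = m <-> j \in s by rewrite eE.
  rewrite dilE// in sP' *.
  apply: (has_dim_eigenspace _ _ _ _ _ m0 us sP').
  - exact: measurable_radial_union.
  - by rewrite [ltLHS](measure_radial_union ar0 arbr rdisj) ltry.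
  - exact: sqrtr_ge0 (\sum_(j < n) br j).
  - exact: radial_union_bounded brB.
  - exact: radial_union_rot.
have [_ mu0 _] := kth_listing e0 ecvg dimE.
have := HC r k _ r1 (mu0 k) (kth_eigenvalue_gt e0 ecvg dimE (k := k)) (kth_eigenvalue_lt e0 ecvg dimE (k := k)).
rewrite -areaE /gtail.
(* The perimeter is [2 * pi] times the sum of all radii, and [sqrt (a i)] is [sqrt pi] times a
   radius; so the denominator equals [r * perimeter Omega / sqrt (2 * pi)]. *)
suff -> : (k.+1%:R - r ^+ 2 * area Omega) /
    (Num.sqrt 2 * r * (\sum_(i < n) (Num.sqrt (a i) + Num.sqrt (b i)))) =
    Num.sqrt (2 * pi) * ((k.+1%:R - r ^+ 2 * area Omega) / (r * perimeter Omega)) by [].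
have S0 : 0 < \sum_(i < n) (al i + be i).
  rewrite (bigD1 (Ordinal n0))//=; apply: ltr_wpDr; last by rewrite ltr_wpDl.
  by apply: sumr_ge0 => i _; rewrite addr_ge0// ltW.
have -> : \sum_(i < n) (Num.sqrt (a i) + Num.sqrt (b i)) = Num.sqrt pi * \sum_(i < n) (al i + be i).
  rewrite mulr_sumr; apply: eq_bigr => i _.
  have sq x : 0 <= x -> Num.sqrt (pi * x ^+ 2) = Num.sqrt pi * x :> R.
    by move=> x0; rewrite sqrtrM ?(ltW p0)// sqrtr_sqr ger0_norm.
  by rewrite /a /b !sq ?mulrDr// ltW.
rewrite periE sqrtrM//; move: (\sum_(i < n) _) S0 => S S0.
have s2 : Num.sqrt 2 ^+ 2 = 2 :> R by rewrite sqr_sqrtr.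
have sp : Num.sqrt pi ^+ 2 = pi :> R by rewrite sqr_sqrtr// ltW.
have s20 : 0 < Num.sqrt 2 :> R by rewrite sqrtr_gt0.
have sp0 : 0 < Num.sqrt pi :> R by rewrite sqrtr_gt0.
rewrite (_ : 2 * pi * S = Num.sqrt 2 ^+ 2 * Num.sqrt pi ^+ 2 * S); last by rewrite s2 sp.
by field; rewrite !gt_eqF.
Qed.
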